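(* Let $K$ be a $p$-adic field with valuation ring $R_K$, and let $f_1,\ldots,f_l\in R_K[x_1,\ldots,x_n]$ be polynomials, not all zero, having a common zero in $R_K^n$. For $j\ge 0$ let $N_j(\boldsymbol{f})$ be the number of solutions in $(R_K/P_K^j)^n$ of the system $f_i(x)\equiv 0 \bmod P_K^j$, $i=1,\ldots,l$. Let $\sigma:X_K\to R_K^n$ be a log-principalization of the ideal $\mathcal{I}_{\boldsymbol{f}}=(f_1,\ldots,f_l)$ with numerical data $(N_i,v_i)$, $i\in T$, and let $\lambda(\mathcal{I}_{\boldsymbol{f}})=\min_{i\in T}\frac{v_i}{N_i}$. Then $$\limsup_{j\to\infty}\left[N_j(\boldsymbol{f})\,q^{-nj}\right]^{1/j}=q^{-\lambda(\mathcal{I}_{\boldsymbol{f}})}.$$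
   Context: $K$ is a finite extension of $\mathbb{Q}_p$, $R_K$ its valuation ring, $P_K$ the maximal ideal of $R_K$, and $q$ the cardinality of $R_K/P_K$. Log-principalization: put $U=R_K^n$ and let $Z_K\subset U$ be the common zero set of $f_1,\ldots,f_l$. A log-principalization of $\mathcal{I}_{\boldsymbol{f}}$ is a map $\sigma:X_K\to U$ such that: (1) $X_K$ is an $n$-dimensional $K$-analytic manifold and $\sigma$ is a proper $K$-analytic map which is a composition of finitely many blow-ups in closed submanifolds and which is an isomorphism outside $Z_K$; (2) $\sigma^{-1}(Z_K)=\bigcup_{i\in T}E_i$, where the $E_i$ are (nonempty) closed submanifolds of $X_K$ of codimension one, each equipped with a pair of positive integers $(N_i,v_i)$, such that at every $b\in X_K$ there are local coordinates $(y_1,\ldots,y_n)$ around $b$ for which, if $E_1,\ldots,E_p$ are the $E_i$ containing $b$, on some neighborhood of $b$: $E_i$ is given by $y_i=0$ for $i=1,\ldots,p$; the ideal $\sigma^*(\mathcal{I}_{\boldsymbol{f}})$ generated by the $f_j\circ\sigma$ is generated by $\varepsilon(y)\prod_{i=1}^p y_i^{N_i}$; and $\sigma^*(dx_1\wedge\cdots\wedge dx_n)=\eta(y)\left(\prod_{i=1}^p y_i^{v_i-1}\right)dy_1\wedge\cdots\wedge dy_n$, where $\varepsilon,\eta$ are units in the local ring of $X_K$ at $b$. The pairs $(N_i,v_i)$, $i\in T$, are the numerical data of $\sigma$. *)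

(* Defs.v *)
From HB Require Import structures.
From mathcomp Require Import all_boot all_order all_algebra all_field finmap.
From mathcomp Require Import all_classical all_reals all_analysis.
From mathcomp Require mpoly.

Set Implicit Arguments.
Unset Strict Implicit.
Unset Printing Implicit Defensive.

Import Order.TTheory GRing.Theory Num.Theory.

Local Open Scope classical_set_scope.
Local Open Scope ring_scope.

HB.mixin Record isUltrametric (R : realType) K of GRing.Field K := {
  absv : K -> R ;
  absv_ge0 : forall x, 0 <= absv x ;
  absv_eq0 : forall x, (absv x == 0) = (x == 0) ;
  absvM : forall x y, absv (x * y) = absv x * absv y ;
  absvD : forall x y, absv (x + y) <= Num.max (absv x) (absv y)
}.

#[short(type="ultrametricFieldType")]
HB.structure Definition UltrametricField (R : realType) :=
  {K of GRing.Field K & isUltrametric R K}.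

HB.mixin Record absv_extends (R : realType) (F : ultrametricFieldType R) K
    of UltrametricField R K & FieldExt F K := {
  absv_alg : forall a : F, absv (a%:A : K) = absv a
}.

#[short(type="ultrametricExtType")]
HB.structure Definition UltrametricExt (R : realType)
    (F : ultrametricFieldType R) :=
  {K of UltrametricField R K & FieldExt F K & absv_extends R F K}.

Section Topology.
Context {R : realType} (K : ultrametricFieldType R).

Lemma absv0 : absv (0 : K) = 0.
Proof. by apply/eqP; rewrite absv_eq0. Qed.

Lemma absv1 : absv (1 : K) = 1.
Proof.
have n0 : absv (1 : K) != 0 by rewrite absv_eq0 oner_neq0.
by apply: (mulfI n0); rewrite -absvM !mulr1.
Qed.

Lemma absvN (x : K) : absv (- x) = absv x.
Proof.
rewrite -mulN1r absvM; suff -> : absv (-1 : K) = 1 by rewrite mul1r.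
have : absv (-1 : K) ^+ 2 == 1 by rewrite expr2 -absvM mulrNN mulr1 absv1.
rewrite sqrf_eq1 => /orP[/eqP //|/eqP h].
by have := absv_ge0 (-1 : K); rewrite h oppr_ge0 leNgt ltr01.
Qed.

Definition absv_ball (x : K) (e : R) : set K := [set y | absv (x - y) < e].

Lemma absv_ball_center (x : K) (e : R) : 0 < e -> absv_ball x e x.
Proof. by rewrite /absv_ball /= subrr absv0. Qed.

Lemma absv_ball_sym (x y : K) (e : R) : absv_ball x e y -> absv_ball y e x.
Proof. by rewrite /absv_ball /= -opprB absvN. Qed.

Lemma absv_ball_triangle (x y z : K) (e1 e2 : R) :
  absv_ball x e1 y -> absv_ball y e2 z -> absv_ball x (e1 + e2) z.
Proof.
rewrite /absv_ball /= => h1 h2; have -> : x - z = (x - y) + (y - z).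
  by rewrite addrA subrK.
apply: le_lt_trans (absvD _ _) _; rewrite gt_max.
have e1p := le_lt_trans (absv_ge0 _) h1.
have e2p := le_lt_trans (absv_ge0 _) h2.
by rewrite (lt_le_trans h1) ?lerDl ?ltW // (lt_le_trans h2) // lerDr ltW.
Qed.

HB.instance Definition _ := hasNbhs.Build (UltrametricField.sort K)
  (nbhs_ (entourage_ absv_ball)).
HB.instance Definition _ := Nbhs_isPseudoMetric.Build R
  (UltrametricField.sort K) erefl absv_ball_center absv_ball_sym
  absv_ball_triangle erefl.

End Topology.

(* [F] is the completion of the rationals for the [p]-adic absolute value. *)
Record is_Qp (R : realType) (p : nat) (F : ultrametricFieldType R) : Prop := {
  Qp_absv : forall m : nat, (0 < m)%N ->
    absv (m%:R : F) = p%:R ^- logn p m ;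
  Qp_dense : dense (range (ratr : rat -> F)) ;
  Qp_complete : forall G : set_system F, ProperFilter G -> cauchy G ->
    exists x : F, G --> x
}.

Section ValuationRing.
Context {R : realType} (K : ultrametricFieldType R).

Definition valring_pred : pred K := fun x => absv x <= 1.

Lemma valring_subring : subring_closed valring_pred.
Proof.
split; rewrite ?unfold_in /valring_pred ?absv1 // => x y;
  rewrite !unfold_in /valring_pred => hx hy.
  by apply: (le_trans (absvD _ _)); rewrite absvN ge_max hx.
by rewrite absvM; apply: mulr_ile1 => //; exact: absv_ge0.
Qed.

HB.instance Definition _ := GRing.isSubringClosed.Build K valring_pred
  valring_subring.

Definition valring : Type := {x : K | x \in valring_pred}.

HB.instance Definition _ := SubChoice.on valring.
HB.instance Definition _ := [SubChoice_isSubComNzRing of valring by <:].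
HB.instance Definition _ :=
  PseudoMetric.copy valring (initial_topology (val : valring -> K)).

Definition maxideal : set valring := [set x | absv (val x) < 1].

(* The ideal power is all of [A] for [j = 0], thanks to the coefficients
   [c]. *)
Definition idealX (A : comNzRingType) (I : set A) (j : nat) : set A :=
  [set x | exists m (c : 'I_m -> A) (a : 'I_m -> 'I_j -> A),
     (forall k t, I (a k t)) /\ x = \sum_(k < m) c k * \prod_(t < j) a k t].

Definition coset_mod (j : nat) (x : valring) : set valring :=
  [set y | idealX maxideal j (y - x)].

Definition residue_card : nat := #|` fset_set (range (coset_mod 1))|.

(* Elements of [(R_K / P_K^j)^n] are represented as row vectors of cosets. *)
Definition solutions (n l : nat) (f : 'I_l -> mpoly.mpoly n valring) (j : nat)
    : set 'rV[set valring]_n :=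
  [set X | exists2 x : 'rV[valring]_n, X = map_mx (coset_mod j) x &
     forall i, idealX maxideal j (mpoly.meval (x 0) (f i))].

Definition num_solutions (n l : nat) (f : 'I_l -> mpoly.mpoly n valring)
    (j : nat) : nat := #|` fset_set (solutions f j)|.

End ValuationRing.

Section Analytic.
Context {R : realType} (K : ultrametricFieldType R).

Definition has_sum (I : choiceType) (u : I -> K) (s : K) : Prop :=
  forall A, nbhs s A -> exists F : {fset I}, forall G : {fset I},
    (F `<=` G)%fset -> A (\sum_(i <- G) u i).

Definition analytic_at (n : nat) (g : 'rV[K]_n -> K) (a : 'rV[K]_n) : Prop :=
  exists c : {ffun 'I_n -> nat} -> K, \forall x \near (a : 'rV[K]_n),
    has_sum (fun m => c m * \prod_(i < n) ((x : 'rV[K]_n) 0 i - a 0 i) ^+ m i)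
      (g x).

Definition partial (n : nat) (g : 'rV[K]_n -> K) (j : 'I_n) (a : 'rV[K]_n)
    : K :=
  xget 0 [set d | (g (a + t *: delta_mx 0 j) - g a) / t @[t --> (0 : K)^'] --> d].

(* [coord] and [param] are mutually inverse homeomorphisms between [dom] and
   [codom]; their values elsewhere are irrelevant. *)
Record chart (n : nat) (X : topologicalType) := Chart {
  dom : set X ;
  codom : set 'rV[K]_n ;
  coord : X -> 'rV[K]_n ;
  param : 'rV[K]_n -> X ;
  dom_open : open dom ;
  codom_open : open codom ;
  coord_codom : forall x, dom x -> codom (coord x) ;
  param_dom : forall z, codom z -> dom (param z) ;
  coordK : forall x, dom x -> param (coord x) = x ;
  paramK : forall z, codom z -> coord (param z) = z ;
  coord_cont : forall x, dom x -> {for x, continuous coord} ;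
  param_cont : forall z, codom z -> {for z, continuous param}
}.

Definition chart_analytic (n : nat) (X : topologicalType) (c : chart n X)
    (h : X -> K) (x : X) : Prop :=
  analytic_at (h \o param c) (coord c x).

Definition compatible (n : nat) (X : topologicalType) (c d : chart n X)
    : Prop :=
  forall x, dom c x -> dom d x -> forall i,
    chart_analytic c (fun y => coord d y 0 i) x /\
    chart_analytic d (fun y => coord c y 0 i) x.

Record manifold (n : nat) := Manifold {
  carrier :> topologicalType ;
  atlas : set (chart n carrier) ;
  manifold_hausdorff : hausdorff_space carrier ;
  atlas_cover : forall x, exists2 c, atlas c & dom c x ;
  atlas_compatible : forall c d, atlas c -> atlas d -> compatible c d
}.

Definition local_coordinates (n : nat) (M : manifold n) (c : chart n M)
    : Prop :=
  forall d, atlas d -> compatible c d.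

Definition analytic_fun_at (n : nat) (M : manifold n) (h : M -> K) (x : M)
    : Prop :=
  forall c, atlas c -> dom c x -> chart_analytic c h x.

Definition analytic_map_at (n m : nat) (M : manifold n) (N : manifold m)
    (s : M -> N) (x : M) : Prop :=
  {for x, continuous s} /\
  forall d, atlas d -> dom d (s x) ->
    forall i, analytic_fun_at (fun y => coord d (s y) 0 i) x.

Definition analytic_map (n m : nat) (M : manifold n) (N : manifold m)
    (s : M -> N) : Prop :=
  forall x, analytic_map_at s x.

Definition iso_outside (n : nat) (M N : manifold n) (s : M -> N) (Z : set N)
    : Prop :=
  exists t : N -> M,
    (forall y, ~ Z y -> s (t y) = y /\ analytic_map_at t y) /\
    (forall x, ~ Z (s x) -> t (s x) = x /\ analytic_map_at s x).

Definition adapted (n : nat) (M : manifold n) (r : nat) (hr : (r <= n)%N)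
    (C : set M) (c : chart n M) : Prop :=
  local_coordinates c /\
  forall x, dom c x ->
    (C x <-> forall i : 'I_r, coord c x 0 (widen_ord hr i) = 0).

Definition closed_submanifold (n : nat) (M : manifold n) (r : nat)
    (hr : (r <= n)%N) (C : set M) : Prop :=
  closed C /\ forall b, C b -> exists2 c, dom c b & adapted hr C c.

Definition incident (n r : nat) (hr : (r <= n)%N) (y : 'rV[K]_n)
    (u : 'rV[K]_r) : Prop :=
  forall i j,
    y 0 (widen_ord hr i) * u 0 j = y 0 (widen_ord hr j) * u 0 i.

(* Over the domain of [c], with coordinates [y], the map [s] is the projection
   to [y] of the incidence variety { (y, [u]) | y_i u_j = y_j u_i, i, j < r },
   where [u] gives homogeneous coordinates on the projective space P^(r-1);
   the chart of that variety where u_k <> 0 has coordinates u_i / u_k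
   (i < r, i <> k), y_k and y_i (r <= i). *)
Record local_blowup (n : nat) (M N : manifold n) (s : M -> N) (r : nat)
    (hr : (r <= n)%N) (c : chart n N) (u : M -> 'rV[K]_r) : Prop := {
  blowup_incident : forall w, dom c (s w) ->
    u w != 0 /\ incident hr (coord c (s w)) (u w) ;
  blowup_bij : forall (x : N) (v : 'rV[K]_r), dom c x -> v != 0 ->
    incident hr (coord c x) v ->
    exists! w, s w = x /\ exists2 t : K, t != 0 & u w = t *: v ;
  blowup_chart : forall k : 'I_r, exists d : chart n M,
    [/\ local_coordinates d,
        dom d = [set w | dom c (s w) /\ u w 0 k != 0] &
        forall w, dom d w ->
          (forall i, i != k ->
             coord d w 0 (widen_ord hr i) = u w 0 i / u w 0 k) /\
          (forall i : 'I_n, i = widen_ord hr k \/ (r <= i)%N ->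
             coord d w 0 i = coord c (s w) 0 i)]
}.

Definition is_blowup (n : nat) (M N : manifold n) (s : M -> N) (C : set N)
    : Prop :=
  exists r (hr : (r <= n)%N),
    [/\ (0 < r)%N, closed_submanifold hr C, analytic_map s, iso_outside s C &
        forall b, C b -> exists c,
          [/\ dom c b, adapted hr C c &
              exists u : M -> 'rV[K]_r, local_blowup s hr c u]].

Inductive blowup_composition (n : nat) :
    forall M N : manifold n, (M -> N) -> Prop :=
| BlowupNil (M : manifold n) : blowup_composition (fun x : M => x)
| BlowupCons (M N P : manifold n) (s : M -> N) (t : N -> P) (C : set N) :
    is_blowup s C -> blowup_composition t ->
    blowup_composition (fun x => t (s x)).

(* Ideal generated by [g] in the local ring at [b], as a set of
   representatives of germs. *)
Definition germ_ideal (n : nat) (M : manifold n) (b : M) (l : nat)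
    (g : 'I_l -> M -> K) : set (M -> K) :=
  [set h | exists a : 'I_l -> M -> K,
     (forall j, analytic_fun_at (a j) b) /\
     \forall y \near b, h y = \sum_(j < l) a j y * g j y].

Definition germ_unit (n : nat) (M : manifold n) (b : M) (h : M -> K) : Prop :=
  analytic_fun_at h b /\ h b != 0.

End Analytic.

Section Polydisc.
Context {R : realType} (K : ultrametricFieldType R) (n : nat).

Local Notation U := 'rV[valring K]_n.

Definition polydisc : set 'rV[K]_n := [set z | forall i, absv (z 0 i) <= 1].

Definition polydisc_coord (x : U) : 'rV[K]_n := map_mx val x.

Definition polydisc_param (z : 'rV[K]_n) : U := map_mx (insubd 0) z.

Lemma ball_absvE (x y : K) (e : R) : ball x e y = (absv (x - y) < e).
Proof. by []. Qed.

Lemma ball_valringE (x y : valring K) (e : R) :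
  ball x e y = (absv (val x - val y) < e).
Proof. by []. Qed.

Lemma polydisc_open : open polydisc.
Proof.
rewrite openE => z zD; apply/nbhs_ballP; exists 1 => //= w [_ zw] i.
have -> : w 0 i = z 0 i - (z 0 i - w 0 i) by rewrite opprB addrC subrK.
apply: le_trans (absvD _ _) _; rewrite absvN ge_max zD /=.
by have := zw 0 i; rewrite ball_absvE => /ltW.
Qed.

Lemma polydisc_coord_codom (x : U) : polydisc (polydisc_coord x).
Proof. by move=> i; rewrite mxE; exact: (valP (x 0 i)). Qed.

Lemma polydisc_coordK (x : U) : polydisc_param (polydisc_coord x) = x.
Proof. by apply/rowP => i; rewrite !mxE valKd. Qed.

Lemma polydisc_paramK (z : 'rV[K]_n) :
  polydisc z -> polydisc_coord (polydisc_param z) = z.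
Proof. by move=> zD; apply/rowP => i; rewrite !mxE insubdK //; exact: zD. Qed.

Lemma polydisc_coord_cont : continuous polydisc_coord.
Proof.
move=> x B /nbhs_ballP[e /= e0 sB]; apply/nbhs_ballP; exists e => //= y [_ xy].
by apply: sB; split=> // i j; have := xy i j; rewrite !mxE.
Qed.

Lemma polydisc_param_cont (z : 'rV[K]_n) :
  polydisc z -> {for z, continuous polydisc_param}.
Proof.
move=> zD B /nbhs_ballP[e /= e0 sB].
have Dz : nbhs z polydisc by apply: open_nbhs_nbhs; split=> //; exact: polydisc_open.
have zB : nbhs z (ball z e) by exact: nbhsx_ballx.
apply: filterS2 Dz zB => w wD [_ zw]; apply: sB; split=> // i j.
rewrite !mxE [i]ord1 ball_valringE !insubdK; last 2 first.
- exact: (wD j).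
- exact: (zD j).
by have := zw 0 j; rewrite ball_absvE.
Qed.

Definition polydisc_chart : chart K n U :=
  @Chart R K n U setT polydisc polydisc_coord polydisc_param openT polydisc_open
    (fun x _ => polydisc_coord_codom x) (fun z _ => I)
    (fun x _ => polydisc_coordK x) polydisc_paramK
    (fun x _ => @polydisc_coord_cont x) polydisc_param_cont.

Lemma polydisc_hausdorff : hausdorff_space U.
Proof.
rewrite ball_hausdorff => x y xy.
have [i xyi] : exists i, x 0 i != y 0 i.
  apply/existsP; apply: contraNT xy; rewrite negb_exists => /forallP h.
  by apply/eqP/rowP => i; have := h i; rewrite negbK => /eqP.
have d0 : 0 < absv (val (x 0 i) - val (y 0 i)).
  rewrite lt_neqAle absv_ge0 andbT eq_sym absv_eq0 subr_eq0.
  by apply: contra xyi => /eqP /val_inj ->.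
exists (PosNum d0, PosNum d0); apply/eqP/seteqP; split=> // z [[_ xz] [_ yz]].
have := xz 0 i; have := yz 0 i; rewrite !ball_valringE /= => hy hx.
suff : absv (val (x 0 i) - val (y 0 i)) < absv (val (x 0 i) - val (y 0 i)).
  by rewrite ltxx.
have {1}-> : val (x 0 i) - val (y 0 i) =
    (val (x 0 i) - val (z 0 i)) + - (val (y 0 i) - val (z 0 i)).
  by rewrite opprB addrA subrK.
by apply: le_lt_trans (absvD _ _) _; rewrite absvN gt_max hx.
Qed.

Lemma analytic_at_coord (g : 'rV[K]_n -> K) (a : 'rV[K]_n) (i : 'I_n) :
  (\forall x \near (a : 'rV[K]_n), g x = (x : 'rV[K]_n) 0 i) ->
  analytic_at g a.
Proof.
move=> ga.
pose m0 : {ffun 'I_n -> nat} := [ffun => 0%N].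
pose m1 : {ffun 'I_n -> nat} := [ffun j => (j == i) : nat].
have m01 : m0 != m1.
  by apply/eqP => /ffunP /(_ i); rewrite !ffunE eqxx.
exists (fun m => if m == m0 then a 0 i else if m == m1 then 1 else 0).
apply: filterS ga => x -> A /nbhs_singleton Ax.
exists [fset m0; m1]%fset => G sG.
rewrite -(big_fset_incl _ sG) /=; last first.
  by move=> m _; rewrite !inE negb_or => /andP[/negPf -> /negPf ->]; rewrite mul0r.
rewrite big_fsetU1 ?inE //= big_seq_fset1 !eqxx eq_sym (negPf m01) mul1r.
rewrite big1 => [|j _]; last by rewrite ffunE expr0.
rewrite mulr1 (bigD1 i) //= ffunE eqxx expr1 big1 => [|j /negPf ji]; last first.
  by rewrite ffunE ji expr0.
by rewrite mulr1 addrC subrK.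
Qed.

Lemma polydisc_chart_compatible : compatible polydisc_chart polydisc_chart.
Proof.
move=> x _ _ i; suff h : chart_analytic polydisc_chart
    (fun y => coord polydisc_chart y 0 i) x by [].
apply: (@analytic_at_coord _ _ i).
have Dx : nbhs (polydisc_coord x) polydisc.
  apply: open_nbhs_nbhs; split; [exact: polydisc_open|exact: polydisc_coord_codom].
by apply: filterS Dx => z zD /=; rewrite polydisc_paramK.
Qed.

Lemma polydisc_cover (x : U) : exists2 c, [set polydisc_chart] c & dom c x.
Proof. by exists polydisc_chart. Qed.

Lemma polydisc_compatible (c d : chart K n U) :
  [set polydisc_chart] c -> [set polydisc_chart] d -> compatible c d.
Proof. by move=> -> ->; exact: polydisc_chart_compatible. Qed.

Definition polydisc_manifold : manifold K n :=
  @Manifold R K n U [set polydisc_chart] polydisc_hausdorff polydisc_cover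
    polydisc_compatible.

End Polydisc.

Section LogPrincipalization.
Context {R : realType} (K : ultrametricFieldType R) (n l : nat).
Variable f : 'I_l -> mpoly.mpoly n (valring K).

Local Notation U := (polydisc_manifold K n).

Definition eval_at (i : 'I_l) (x : U) : valring K :=
  mpoly.meval ((x : 'rV[valring K]_n) 0) (f i).

Definition zero_locus : set U := [set x | forall i, eval_at i x = 0].

Definition jacobian (M : manifold K n) (s : M -> U) (c : chart K n M) (y : M)
    : 'M[K]_n :=
  \matrix_(i, j)
    partial (fun z => coord (polydisc_chart K n) (s (param c z)) 0 i) j
      (coord c y).

(* [e] enumerates the components through [b], so that [y _ k], for [k < p],
   are the first [p] local coordinates. *)
Definition normal_crossings (M : manifold K n) (s : M -> U) (T : finType)
    (E : T -> set M) (N v : T -> nat) (b : M) : Prop :=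
  exists (p : nat) (hp : (p <= n)%N) (e : 'I_p -> T) (c : chart K n M)
         (eps eta : M -> K),
    let y (x : M) (k : 'I_p) : K := coord c x 0 (widen_ord hp k) in
    [/\ [/\ injective e, (forall i, E i b <-> exists k, e k = i),
            local_coordinates c & dom c b],
        germ_unit b eps /\ germ_unit b eta,
        \forall x \near b, forall k, E (e k) x <-> y x k = 0,
        germ_ideal b (fun j x => val (eval_at j (s x))) =
          germ_ideal b (fun (_ : 'I_1) x =>
            eps x * \prod_(k < p) y x k ^+ N (e k)) &
        \forall x \near b, \det (jacobian s c x) =
          eta x * \prod_(k < p) y x k ^+ (v (e k)).-1].

Record log_principalization (M : manifold K n) (s : M -> U) (T : finType)
    (E : T -> set M) (N v : T -> nat) : Prop := {
  lp_proper : forall A : set U, compact A -> compact (s @^-1` A) ;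
  lp_analytic : analytic_map s ;
  lp_blowups : blowup_composition s ;
  lp_iso : iso_outside s zero_locus ;
  lp_preimage : s @^-1` zero_locus = \bigcup_i E i ;
  lp_nonempty : forall i, E i !=set0 ;
  lp_divisor : forall i, exists hn : (1 <= n)%N, closed_submanifold hn (E i) ;
  lp_positive : forall i, (0 < N i)%N /\ (0 < v i)%N ;
  lp_crossings : forall b, normal_crossings s E N v b
}.

End LogPrincipalization.

(* For a finite nonempty [T] this infimum is the minimum. *)
Definition lambda (R : realType) (T : finType) (N v : T -> nat) : R :=
  inf [set (v i)%:R / (N i)%:R | i in [set: T]].

(* Main.v *)
(* Let pi be a uniformizer, rho = |pi| and O the valuation ring. The quantity
   N_j(f) q^(-nj) is the Haar measure of V_j = { x | max_i |f_i(x)| <= rho^j };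
   measures are estimated by counting cosets of pi^k O^n for large k.

   By properness V_j is covered by finitely many boxes of X_K on which, after
   rescaling, sigma becomes a map Phi from O^n to itself with an integral
   Jacobian J, |Phi(w + h) - Phi(w) - h J(w)| <= |h|^2,
   |det J(w)| = rho^d prod |w_k|^(v_k - 1), and max_i |f_i(Phi(w))| comparable
   to prod |w_k|^(N_k).  When |det J(w)| = rho^D and M > D, Newton's iteration
   shows that Phi maps w + pi^M O^n onto Phi(w) + pi^M O^n J(w), whose measure
   is q^(-nM - D) by the Smith form of J(w).  Hence the image of the shell
   |w_k| = rho^(m_k) has measure at most q^(-sum v_k m_k), and comparable to it
   because sigma is injective off the exceptional divisors.

   Upper bound: v_k >= lambda N_k, so a shell meeting V_j has image of measure
   O(q^(-lambda j)).  There are O(j^n) shells with all m_k < L j, and the rest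
   lies in slabs |w_k| <= rho^(L j), of image O(q^(-L j)) since Phi is Lipschitz.
   Lower bound: one shell along a component E_i with v_i / N_i = lambda.
   Thus c q^(-lambda j) <= N_j(f) q^(-nj) <= B (j + 1)^n q^(-lambda j). *)

Require Import Defs.
From mathcomp Require Import all_boot all_order all_algebra.
From mathcomp Require Import all_field finmap.
From mathcomp Require Import all_classical all_reals all_analysis.
From mathcomp Require Import(canonicals) mpoly.
From mathcomp Require Import ring lra zify.

Set Implicit Arguments.
Unset Strict Implicit.
Unset Printing Implicit Defensive.

Import Order.TTheory GRing.Theory Num.Theory.
Import numFieldNormedType.Exports.

Local Open Scope classical_set_scope.
Local Open Scope ring_scope.

(** * Compactness of the unit ball *)

Section Compactness.
Context {R : realType}.

(** The Jacobian degenerates along the exceptional divisors, so the Newton radius depends on the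
    shell, hence on [j]. This is harmless: cosets may be counted at any level [k] large enough for
    the set at hand, and from level [j] on the coset count of [V_j] grows by exactly [q^n] per
    level. Upper bounds come from lists that cover a set, lower bounds from lists of pairwise
    incongruent points; a pigeonhole compares the two without losing a constant, since congruence
    modulo [pi^k] is an equivalence relation. Of analyticity only a first-order expansion with
    uniform quadratic error is retained. Derivatives of power series and exact solutions of Newton's
    equation are both extracted from compactness of the unit ball. That every point of the polydisc
    lifts to [X_K] is read off the blow-ups; it gives a component of the divisor and lets local
    estimates on [X_K] control all of [V_j]. The factor polynomial in [j] disappears under the
    [j]-th root, so the superior limit is in fact a limit. *)

Lemma ultra_seq (T : Type) (I : eqType) (G : set_system T) (s : seq I)
    (P : I -> set T) :
  UltraFilter G -> G [set x | exists2 c, c \in s & P c x] ->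
  exists c, G (P c).
Proof.
move=> UG; elim: s => [|a s IHs] Gs.
  have [x [c]] := filter_ex Gs; by rewrite in_nil.
have [Ga|Ga] := in_ultra_setVsetC (P a) UG; first by exists a.
apply: IHs; apply: filterS2 Gs Ga => x [c]; rewrite in_cons => /predU1P[->|cs] //.
by exists c.
Qed.

Lemma ultra_fmap (T U : Type) (g : T -> U) (G : set_system T) :
  UltraFilter G -> UltraFilter (g @ G).
Proof.
move=> UG; split=> [|H PH GH]; first exact: fmap_proper_filter.
rewrite eqEsubset; split=> // A HA.
have [//|GA] := in_ultra_setVsetC (g @^-1` A) UG.
have HC : H (~` A) by exact: GH.
by have [x []] := filter_ex (filterI HA HC).
Qed.

Definition complete_space (K : ultrametricFieldType R) : Prop :=
  forall G : set_system K, ProperFilter G -> cauchy G -> exists x : K, G --> x.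

Definition unit_ball (K : ultrametricFieldType R) : set K :=
  [set x | absv x <= 1].
Arguments unit_ball : clear implicits.

Lemma absvB_le (K : ultrametricFieldType R) (x y : K) (r : R) :
  absv x <= r -> absv y <= r -> absv (x - y) <= r.
Proof. by move=> hx hy; apply: le_trans (absvD _ _) _; rewrite absvN ge_max hx. Qed.

Lemma absvD_le (K : ultrametricFieldType R) (x y : K) (r : R) :
  absv x <= r -> absv y <= r -> absv (x + y) <= r.
Proof. by move=> hx hy; apply: le_trans (absvD _ _) _; rewrite ge_max hx. Qed.

Lemma absvD_lt (K : ultrametricFieldType R) (x y : K) (r : R) :
  absv x < r -> absv y < r -> absv (x + y) < r.
Proof. by move=> hx hy; apply: le_lt_trans (absvD _ _) _; rewrite gt_max hx. Qed.

Lemma absvB_lt (K : ultrametricFieldType R) (x y : K) (r : R) :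
  absv x < r -> absv y < r -> absv (x - y) < r.
Proof. by move=> hx hy; apply: absvD_lt => //; rewrite absvN. Qed.

Lemma absv_distC (K : ultrametricFieldType R) (x y : K) :
  absv (x - y) = absv (y - x).
Proof. by rewrite -opprB absvN. Qed.

Lemma absv_gt0 (K : ultrametricFieldType R) (x : K) : (0 < absv x) = (x != 0).
Proof. by rewrite lt_neqAle absv_ge0 andbT eq_sym absv_eq0. Qed.

Lemma absvX (K : ultrametricFieldType R) (x : K) m : absv (x ^+ m) = absv x ^+ m.
Proof.
elim: m => [|m IHm]; first by rewrite !expr0 absv1.
by rewrite !exprS absvM IHm.
Qed.

Lemma absvV (K : ultrametricFieldType R) (x : K) : absv x^-1 = (absv x)^-1.
Proof.
have [->|x0] := eqVneq x 0; first by rewrite invr0 absv0 invr0.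
have ax0 : absv x != 0 by rewrite absv_eq0.
by apply: (mulfI ax0); rewrite -absvM !mulfV // absv1.
Qed.

Lemma absv_prod (K : ultrametricFieldType R) I (s : seq I) (P : pred I)
    (g : I -> K) :
  absv (\prod_(i <- s | P i) g i) = \prod_(i <- s | P i) absv (g i).
Proof.
elim/big_rec2: _ => [|i x y _ <-]; [exact: absv1|exact: absvM].
Qed.

Lemma absv_sum (K : ultrametricFieldType R) I (s : seq I) (P : pred I)
    (g : I -> K) (r : R) :
  0 <= r -> (forall i, P i -> absv (g i) <= r) ->
  absv (\sum_(i <- s | P i) g i) <= r.
Proof.
move=> r0 h; elim/big_rec: _ => [|i x Pi xr]; first by rewrite absv0.
exact: absvD_le (h i Pi) xr.
Qed.

Lemma absv_nat (K : ultrametricFieldType R) m : absv (m%:R : K) <= 1.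
Proof.
elim: m => [|m IHm]; first by rewrite absv0.
by rewrite -addn1 natrD; apply: absvD_le => //; rewrite absv1.
Qed.

Lemma absv_int (K : ultrametricFieldType R) (m : int) : absv (m%:~R : K) <= 1.
Proof.
by case: m => m; rewrite ?NegzE ?rmorphN ?absvN; exact: absv_nat.
Qed.

(* Ultrafilters on a totally bounded set are Cauchy. *)
Lemma totally_bounded_compact (K : ultrametricFieldType R) :
  complete_space K ->
  (forall e : R, 0 < e -> exists s : seq K, forall x : K, absv x <= 1 ->
     exists2 c, c \in s & absv (c - x) < e) ->
  compact (unit_ball K).
Proof.
move=> Kc Ktb; rewrite compact_ultra => G UG GB.
have Gc : cauchy G.
  apply: cauchy_exP => e /Ktb[s hs].
  apply: (@ultra_seq _ _ _ s (fun c => ball c e)).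
  by apply: filterS GB => x /hs.
have [x Gx] := Kc G _ Gc; exists x; split => //=.
have /Gx Gb : nbhs x (ball x (1 : R)) by exact: nbhsx_ballx.
have [y [By]] := filter_ex (filterI GB Gb).
rewrite ball_absvE => xy; rewrite /unit_ball /= -(subrK y x).
by apply: absvD_le => //; exact: ltW.
Qed.

(** Each coordinate pushes an ultrafilter forward to a convergent one, and the finitely many
    coordinate limits assemble into a limit of the vectors. *)
Lemma rV_compact_all (T : topologicalType) n (A : set T) :
  compact A -> compact [set v : 'rV[T]_n | forall i, A (v 0 i)].
Proof.
rewrite !compact_ultra => Ac G UG GA.
have h i : exists x : T, A x /\ (fun v : 'rV[T]_n => v 0 i) @ G --> x.
  have UGi := @ultra_fmap _ _ (fun v : 'rV[T]_n => v 0 i) G UG.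
  have [|x [Ax Gx]] := Ac _ UGi; last by exists x.
  by apply: (@filterS _ G _ _ _ _ GA) => v; exact.
have {h} [x hx] := choice h.
exists (\row_i x i); split=> [i|B [P hP sPB]]; first by rewrite mxE; have [] := hx i.
suff : G [set v | forall i j, P i j (v i j)] by exact: filterS.
have hP' i : nbhs (x i) (P 0 i) by have := hP 0 i; rewrite mxE.
have FG : Filter G by exact: _.
have := @filter_forall _ _ (fun i (v : 'rV[T]_n) => P 0 i (v 0 i)) G FG
  (fun i => (hx i).2 _ (hP' i)).
by apply: filterS => v hv i j; rewrite ord1.
Qed.

Lemma exp_small (r e : R) : 0 <= r < 1 -> 0 < e -> exists k : nat, r ^+ k < e.
Proof.
move=> /andP[r0 r1] e0; have := @cvg_expr R r; rewrite ger0_norm // => /(_ r1).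
move=> /cvgrPdist_lt /(_ _ e0)[k _ /(_ k) /= hk]; exists k.
by have := hk (leqnn k); rewrite sub0r normrN ger0_norm ?exprn_ge0.
Qed.

Lemma absv_padic_dvd (p : nat) (F : ultrametricFieldType R) (k : nat) (z : int) :
  prime p -> is_Qp p F -> ((p ^ k)%N %| z)%Z -> absv (z%:~R : F) <= p%:R ^- k.
Proof.
move=> pp QF /dvdzP[u ->]; rewrite rmorphM absvM /= -[leRHS]mul1r.
apply: ler_pM; rewrite ?absv_ge0 ?absv_int //.
have -> : ((p ^ k)%N%:~R : F) = (p ^ k)%N%:R by [].
by rewrite (Qp_absv QF) ?expn_gt0 ?prime_gt0 // pfactorK.
Qed.

Lemma absv_padic_int (p : nat) (F : ultrametricFieldType R) (z : int) :
  is_Qp p F -> z != 0 -> absv (z%:~R : F) = p%:R ^- logn p `|z|.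
Proof.
move=> QF z0; rewrite -(Qp_absv QF) ?absz_gt0 //.
by case: z {z0} => m //; rewrite NegzE rmorphN absvN.
Qed.

Lemma absv_padic_unit (p : nat) (F : ultrametricFieldType R) (z : int) :
  prime p -> is_Qp p F -> ~~ (p %| `|z|)%N -> absv (z%:~R : F) = 1.
Proof.
move=> pp QF pz.
have z0 : z != 0 by apply: contraNneq pz => ->; rewrite dvdn0.
rewrite (absv_padic_int QF) // (_ : logn p `|z| = 0%N) ?expr0 ?invr1 //.
by apply/eqP; rewrite -leqn0 leqNgt -pfactor_dvdn ?absz_gt0 // expn1.
Qed.

(** The integers below [p ^ k] form the net: a [p]-adic integer is close to a rational with
    denominator prime to [p], and that denominator is invertible modulo [p ^ k]. *)
Lemma padic_totally_bounded (p : nat) (F : ultrametricFieldType R) :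
  prime p -> is_Qp p F -> forall e : R, 0 < e ->
  exists s : seq F, forall x : F, absv x <= 1 ->
     exists2 c, c \in s & absv (c - x) < e.
Proof.
move=> pp QF e e0.
have p0 : (0 < p%:R :> R) by rewrite ltr0n prime_gt0.
have [k ke] : exists k : nat, p%:R ^- k < e.
  have [|k hk] := @exp_small p%:R^-1 _ _ e0; last by exists k; rewrite -exprVn.
  by rewrite invr_ge0 ltW //= invf_lt1 // ltr1n prime_gt1.
exists [seq i%:R | i <- iota 0 (p ^ k)] => x x1.
(* A radius at most 1 keeps the rational approximation in the unit ball, which forces its
   denominator to be prime to [p]. *)
have [r xr re] : exists2 r : rat, absv (x - ratr r) < e & absv (ratr r : F) <= 1.
  have m0 : 0 < Num.min e 1 by rewrite lt_min e0 ltr01.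
  have xB : (ball x (Num.min e 1))° x by exact: nbhsx_ballx.
  have [y [/interior_subset xy [r _ ry]]] :
      ((ball x (Num.min e 1))° `&` range ratr) !=set0.
    by apply: (Qp_dense QF); [exists x|exact: open_interior].
  move: xy; rewrite -ry ball_absvE lt_min => /andP[xe x1'].
  exists r => //; rewrite -(subKr x (ratr r)).
  by apply: absvB_le => //; exact: ltW.
have rE : ratr r = (numq r)%:~R / (denq r)%:~R :> F by [].
have pd : ~~ (p %| `|denq r|)%N.
  apply/negP => pd; have pn : ~~ (p %| `|numq r|)%N.
    apply/negP => pn; have := coprime_num_den r.
    by rewrite /coprime => /eqP g1; have := dvdn_gcd p `|numq r| `|denq r|;
       rewrite pd pn g1 dvdn1 => /eqP p1; rewrite p1 in pp.
  have ad : absv ((denq r)%:~R : F) <= p%:R ^- 1.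
    by apply: absv_padic_dvd => //; rewrite expn1.
  move: re; rewrite rE absvM (absv_padic_unit pp QF pn) mul1r absvV.
  have d0 : 0 < absv ((denq r)%:~R : F).
    rewrite (absv_padic_int QF) ?denq_neq0 // invr_gt0 exprn_gt0 //.
  rewrite invf_le1 // => /le_trans /(_ ad).
  by rewrite expr1 invf_ge1 // lern1 leqNgt prime_gt1.
(* Bezout: [u] inverts the denominator modulo [p ^ k], so the residue of [numq r * u] approximates
   [r]. *)
have [[u v] /= uv] : exists uv : int * int, uv.1 * denq r + uv.2 * (p ^ k)%:Z = 1.
  apply/coprimezP; rewrite coprimezE /= coprimeXr // coprime_sym prime_coprime //.
have dvd : ((p ^ k)%N %| ((numq r * u) %% (p ^ k)%N)%Z * denq r - numq r)%Z.
  apply/dvdzP; exists (- (numq r * u %/ (p ^ k)%N)%Z * denq r - numq r * v).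
  have := divz_eq (numq r * u) (p ^ k)%N; set c := modz _ _; set d := divz _ _.
  move=> /(congr1 (fun z => z - d * (p ^ k)%N)); rewrite [RHS]addrC addKr => <-.
  by move: uv => /(congr1 ( *%R (numq r))); rewrite mulr1 => {2}<-; ring.
set c := ((numq r * u) %% (p ^ k)%N)%Z in dvd.
have pk0 : (p ^ k)%N%:Z != 0 by rewrite eqz_nat -lt0n expn_gt0 prime_gt0.
have c0 : 0 <= c by exact: modz_ge0.
exists (`|c|%N%:R).
  apply/mapP; exists `|c|%N => //; rewrite mem_iota /= add0n.
  by rewrite -ltz_nat gez0_abs // ltz_pmod // lt_def pk0.
have -> : (`|c|%N%:R : F) = c%:~R by rewrite -[in RHS](gez0_abs c0).
have d1 := absv_padic_unit pp QF pd.
have -> : c%:~R - x = (c%:~R - ratr r) - (x - ratr r) :> F.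
  by rewrite opprB addrA subrK.
apply: absvB_lt => //; apply: le_lt_trans _ ke.
have -> : absv (c%:~R - ratr r : F) =
    absv (c%:~R - ratr r : F) * absv ((denq r)%:~R : F) by rewrite d1 mulr1.
rewrite -absvM mulrBl rE divfK -?absv_gt0 ?d1 // -rmorphM -rmorphB.
exact: absv_padic_dvd pp QF dvd.
Qed.

Lemma padic_compact (p : nat) (F : ultrametricFieldType R) :
  prime p -> is_Qp p F -> compact (unit_ball F).
Proof.
move=> pp QF; apply: totally_bounded_compact; first exact: Qp_complete QF.
exact: padic_totally_bounded QF.
Qed.

Lemma nbhs_absvP (K : ultrametricFieldType R) (x : K) (A : set K) :
  nbhs x A <-> exists2 e : R, 0 < e & forall y, absv (x - y) < e -> A y.
Proof.
by split=> [/nbhs_ballP[e /= e0 h]|[e e0 h]]; [|apply/nbhs_ballP]; exists e.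
Qed.

Lemma absv_continuous (K : ultrametricFieldType R) :
  continuous (absv : K -> R).
Proof.
move=> x A /nbhs_ballP[e /= e0 sA].
apply/nbhs_absvP; exists e => // y xy; apply: sA; rewrite /= /ball /=.
rewrite ltr_norml; apply/andP; split.
  rewrite ltrBrDr addrC -ltrBrDr opprK.
  apply: le_lt_trans (_ : absv y <= Num.max (absv x) (absv (x - y))) _.
    by rewrite -[in leLHS](subKr x y) (le_trans (absvD _ _)) // absvN.
  by rewrite gt_max ltrDl e0 /= (lt_le_trans xy) // lerDr absv_ge0.
rewrite ltrBlDr.
apply: le_lt_trans (_ : absv x <= Num.max (absv y) (absv (x - y))) _.
  by rewrite -[in leLHS](subrK y x) addrC (le_trans (absvD _ _)).
by rewrite gt_max ltrDr e0 /= (lt_le_trans xy) // lerDl absv_ge0.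
Qed.

Lemma nbhs_rVP (K : ultrametricFieldType R) n (x : 'rV[K]_n) (A : set 'rV[K]_n) :
  nbhs x A <->
  exists2 e : R, 0 < e &
    forall y : 'rV[K]_n, (forall i, absv (x 0 i - y 0 i) < e) -> A y.
Proof.
split=> [/nbhs_ballP[e /= e0 h]|[e e0 h]].
  by exists e => // y hy; apply: h; split=> // i j; rewrite ord1 ball_absvE.
apply/nbhs_ballP; exists e => //= y [_ hy]; apply: h => i.
by have := hy 0 i; rewrite ball_absvE.
Qed.

Lemma finite_bound (I : finType) (g : I -> R) :
  exists2 B : R, 0 < B & forall i, g i <= B.
Proof.
exists (1 + \sum_i `|g i|) => [|i]; first by rewrite ltr_pwDl ?sumr_ge0.
rewrite (bigD1 i) //= (le_trans (ler_norm _)) // addrCA lerDl.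
by rewrite addr_ge0 ?sumr_ge0.
Qed.

Lemma exists_maxabs (K : ultrametricFieldType R) n (v : 'rV[K]_n) : v != 0 ->
  exists2 i, v 0 i != 0 & forall j, absv (v 0 j) <= absv (v 0 i).
Proof.
move=> v0; have [i0 vi0] : exists i, v 0 i != 0.
  by apply/rV0Pn.
case: (@Order.TotalTheory.arg_maxP _ _ _ i0 predT (fun i => absv (v 0 i))) => //= i _ h.
exists i => [|j]; last exact: h.
by rewrite -absv_gt0 (lt_le_trans _ (h i0 _)) // absv_gt0.
Qed.

(** * Passage from the base field to a finite extension *)

Section Extension.
Context (F : ultrametricFieldType R) (K : ultrametricExtType F).

Lemma absvZ (a : F) (x : K) : absv (a *: x) = absv a * absv x.
Proof. by rewrite -mulr_algl absvM absv_alg. Qed.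

Let d := \dim {:K}.
Let KU : ultrametricFieldType R := K.
Let L (v : 'rV[F]_d) : KU := \sum_i v 0 i *: (vbasis {:K})`_i.

Lemma absv_lincomb : exists2 B : R, 0 < B & forall (v : 'rV[F]_d) (r : R),
  0 <= r -> (forall i, absv (v 0 i) <= r) -> absv (L v) <= B * r.
Proof.
have [B B0 hB] := finite_bound (fun i : 'I_d => absv ((vbasis {:K})`_i)).
exists B => // v r r0 h; apply: absv_sum => [|i _]; first by rewrite mulr_ge0 // ltW.
by rewrite absvZ mulrC ler_pM ?absv_ge0.
Qed.

Lemma lincombB v w : L v - L w = L (v - w).
Proof. by rewrite -sumrB; apply: eq_bigr => i _; rewrite !mxE scalerBl. Qed.

Lemma lincomb_continuous : continuous L.
Proof.
move=> v A /nbhs_absvP[e e0 sA]; have [B B0 hB] := absv_lincomb.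
apply/nbhs_rVP; exists (e / B / 2); first by rewrite !divr_gt0.
move=> w vw; apply: sA; rewrite lincombB.
apply: (@le_lt_trans _ _ (B * (e / B / 2))).
  apply: hB => [|i]; first by rewrite !divr_ge0 ?ltW.
  by rewrite !mxE ltW.
have -> : B * (e / B / 2) = e / 2 by field; rewrite gt_eqF.
by lra.
Qed.

Hypothesis cF : compact (unit_ball F).
Hypothesis big : forall B : R, exists a : F, B <= absv a.

(** Half of the equivalence of norms in finite dimension: [c] is the minimum of [absv \o L] on the
    compact unit sphere of the sup norm, nonzero because the basis is free. Homogeneity extends the
    bound to all vectors. *)
Lemma lincomb_lower : exists2 c : R, 0 < c &
  forall (v : 'rV[F]_d) i, c * absv (v 0 i) <= absv (L v).
Proof.
pose S := [set v : 'rV[F]_d | (forall i, absv (v 0 i) <= 1) /\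
                              exists i, absv (v 0 i) = 1].
have cS : compact S.
  apply: (@subclosed_compact _ S [set v | forall i, unit_ball F (v 0 i)]).
  - rewrite closedE => v hv; have Sn : exists w, S w /\ forall i, absv (v 0 i - w 0 i) < 1.
      apply: contrapT => h; apply: hv; apply/nbhs_rVP; exists 1 => // w vw Sw.
      by apply: h; exists w.
    have [w [[w1 [i wi]] vw]] := Sn.
    have v1 j : absv (v 0 j) <= 1.
      by rewrite -(subrK (w 0 j) (v 0 j)); apply: absvD_le => //; exact: ltW.
    split=> //; exists i; apply/eqP; rewrite eq_le v1 leNgt; apply/negP => vi.
    have : absv (w 0 i) < 1.
      by rewrite -(subKr (v 0 i) (w 0 i)); exact: absvB_lt.
    by rewrite wi ltxx.
  - exact: rV_compact_all.
  - by move=> v [].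
have d0 : (0 < d)%N by rewrite adim_gt0.
have S0 : S !=set0.
  exists (const_mx 1); split=> [i|]; first by rewrite mxE absv1.
  by exists (Ordinal d0); rewrite mxE absv1.
have [|c0 /set_mem [c01 [i0 ci0]] hc0] := compact_EVT_min S0 cS (f := absv \o L).
  apply: continuous_subspaceT => v.
  by apply: continuous_comp; [exact: lincomb_continuous|exact: absv_continuous].
have Lc0 : 0 < absv (L c0).
  rewrite absv_gt0; apply/eqP => Lc.
  have /freeP := basis_free (vbasisP {:K}) => /(_ (fun i => c0 0 i) Lc i0) ci.
  by move: ci0; rewrite ci absv0 => /esym/eqP; rewrite oner_eq0.
exists (absv (L c0)) => // v i.
have [->|v0] := eqVneq v 0; first by rewrite mxE absv0 mulr0 absv_ge0.
have [j vj hj] := exists_maxabs v0.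
have aj : 0 < absv (v 0 j) by rewrite absv_gt0.
apply: (@le_trans _ _ (absv (L c0) * absv (v 0 j))); first by rewrite ler_pM2l.
have -> : L v = v 0 j *: L ((v 0 j)^-1 *: v).
  rewrite /L scaler_sumr; apply: eq_bigr => k _.
  by rewrite mxE scalerA mulrA mulfV // mul1r.
rewrite absvZ mulrC ler_pM2l //; apply: hc0; apply/mem_set; split=> [k|].
  by rewrite mxE absvM absvV mulrC ler_pdivrMr ?mul1r.
by exists j; rewrite mxE mulVf // absv1.
Qed.

(** With [absv a] at least [c^-1], the lower bound places the unit ball of [K] inside the continuous
    image of a compact set under [v |-> a *: L v]; it is closed because points at distance below 1
    from it belong to it. *)
Lemma extension_compact : compact (unit_ball K).
Proof.
have [c c0 hc] := lincomb_lower; have [a ha] := big c^-1.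
have ca : compact ((fun v : 'rV[F]_d => (a *: L v : KU)) @`
    [set v : 'rV[F]_d | forall i, unit_ball F (v 0 i)]).
  apply: continuous_compact; last exact: rV_compact_all.
  apply: continuous_subspaceT => v; apply: (continuous_comp (g := *:%R a : KU -> KU)).
    exact: lincomb_continuous.
  move=> A /nbhs_absvP[e e0 sA].
  apply/nbhs_absvP; exists (e / (1 + absv a)).
    by rewrite divr_gt0 // ltr_pwDl // absv_ge0.
  move=> w; rewrite ltr_pdivlMr ?ltr_pwDl ?absv_ge0 // => vw; apply: sA.
  rewrite /= -scalerBr absvZ mulrC; apply: le_lt_trans vw.
  by rewrite ler_wpM2l ?absv_ge0 // lerDr.
apply: subclosed_compact ca _.
  rewrite closedE => x hx; have [y [y1 xy]] : exists y : KU, unit_ball KU y /\ absv (x - y) < 1.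
    apply: contrapT => h; apply: hx; apply/nbhs_absvP; exists 1 => // y xy y1.
    by apply: h; exists y.
  by rewrite /unit_ball /= -(subrK y x); apply: absvD_le => //; exact: ltW.
have aa : 0 < absv a by apply: lt_le_trans ha; rewrite invr_gt0.
have a0 : a != 0 by rewrite -absv_gt0.
move=> x x1; pose v : 'rV[F]_d := \row_i coord (vbasis {:K}) i x.
have Lv : L v = x.
  rewrite [RHS](coord_vbasis (memvf x)); apply: eq_bigr => i _; by rewrite mxE.
exists (a^-1 *: v) => [i|].
  rewrite /unit_ball /= mxE absvM absvV mulrC ler_pdivrMr // mul1r.
  apply: le_trans ha; rewrite -[leRHS]mul1r ler_pdivlMr // mulrC.
  by apply: le_trans (hc v i) _; rewrite Lv.
rewrite -[RHS]Lv /L scaler_sumr; apply: eq_bigr => i _.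
by rewrite mxE scalerA mulrA mulfV // mul1r.
Qed.

End Extension.

Lemma padic_extension_compact (p : nat) (F : ultrametricFieldType R)
    (K : ultrametricExtType F) :
  prime p -> is_Qp p F -> compact (unit_ball K).
Proof.
move=> pp QF; apply: extension_compact; first exact: padic_compact QF.
move=> B.
have B0 : 0 < (1 + `|B|)^-1 by rewrite invr_gt0 ltr_pwDl.
have [|k hk] := @exp_small p%:R^-1 (1 + `|B|)^-1 _ B0.
  by rewrite invr_ge0 ler0n /= invf_lt1 ?ltr1n ?prime_gt1 // ltr0n prime_gt0.
exists ((p ^ k)%N%:R^-1); rewrite absvV (Qp_absv QF) ?expn_gt0 ?prime_gt0 //.
have pk : 0 < (p%:R^-1 : R) ^+ k by rewrite exprn_gt0 // invr_gt0 ltr0n prime_gt0.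
rewrite pfactorK // -exprVn; apply: (@le_trans _ _ (1 + `|B|)).
  by rewrite (le_trans (ler_norm _)) // lerDr.
by rewrite -[leLHS]invrK lef_pV2 ?posrE ?invr_gt0 ?ltr_pwDl // ltW.
Qed.

End Compactness.
Arguments unit_ball {R} K _.

(** If no finite list worked, the sets of points missed by finite lists would generate a proper
    filter; its cluster point [p] contradicts the list [[:: p]]. *)
Lemma compact_seq_cover (T : topologicalType) (A : set T) (W : T -> set T) :
  compact A -> (forall x, A x -> nbhs x (W x)) ->
  exists s : seq T, (forall c, c \in s -> A c) /\
    forall x, A x -> exists2 c, c \in s & W c x.
Proof.
move=> cA hW; apply: contrapT => nos.
pose D := [set s : seq T | forall c, c \in s -> A c].
pose B (s : seq T) := [set x | A x /\ forall c, c \in s -> ~ W c x].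
have D0 : D [::] by [].
have PB : ProperFilter (filter_from D B).
  apply: filter_from_proper => [|s sD].
    apply: filter_from_filter; first by exists [::].
    move=> s t sD tD; exists (s ++ t).
      by move=> c; rewrite mem_cat => /orP[/sD|/tD].
    by move=> x [Ax h]; split; split=> // c cs; apply: h; rewrite mem_cat cs ?orbT.
  apply: contrapT => nB; apply: nos; exists s; split=> // x Ax.
  apply: contrapT => nW; apply: nB; exists x; split=> // c cs Wc.
  by apply: nW; exists c.
have [|p [Ap cp]] := cA _ PB; first by exists [::] => // x [].
have Bp : filter_from D B (B [:: p]).
  by exists [:: p] => // c; rewrite inE => /eqP ->.
have [x [[_ /(_ p)]]] := cp _ _ Bp (hW p Ap).
by rewrite inE eqxx => /(_ isT).
Qed.

(** * Uniformizers and residues *)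

Section FiniteRange.

(** Replaces a cardinal of cosets by a list of representatives. The list [s0] supplies finiteness,
    without which [fset_set] would return the empty set by default. *)
Lemma fset_set_reps (T : choiceType) (U : choiceType) (g : T -> U) (S : set T)
    (s0 : seq T) :
  (forall x, S x -> exists2 c, c \in s0 & g x = g c) ->
  exists s : seq T, [/\ size s = #|` fset_set (g @` S)|, uniq s,
    forall x, x \in s -> S x,
    forall x, S x -> exists2 c, c \in s & g x = g c &
    {in s &, injective g}].
Proof.
move=> h0; have fin : finite_set (g @` S).
  apply: (@sub_finite_set _ _ [set` map g s0]); last exact: finite_seq.
  by move=> _ [x Sx <-] /=; have [c cs ->] := h0 x Sx; exact: map_f.
have [->|/set0P[x0 Sx0]] := eqVneq S set0.
  by exists [::]; split=> //; rewrite image_set0 fset_set0 cardfs0.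
pose h (u : U) := xget x0 [set x | S x /\ g x = u].
have hP u : u \in fset_set (g @` S) -> S (h u) /\ g (h u) = u.
  rewrite in_fset_set // => /set_mem [x Sx xu].
  by apply: (@xgetPex _ x0 [set x | S x /\ g x = u]); exists x.
exists (map h (fset_set (g @` S))); split.
- by rewrite size_map.
- rewrite map_inj_in_uniq ?fset_uniq // => u v /hP[_ hu] /hP[_ hv] huv.
  by rewrite -hu huv.
- by move=> _ /mapP[u /hP[Su _] ->].
- move=> x Sx; have gx : g x \in fset_set (g @` S).
    by rewrite in_fset_set //; apply/mem_set; exists x.
  by exists (h (g x)); [exact: map_f|have [_ ->] := hP _ gx].
- move=> _ _ /mapP[u /hP[_ hu] ->] /mapP[v /hP[_ hv] ->].
  by rewrite hu hv => ->.
Qed.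

End FiniteRange.

Section Uniformizer.
Context {R : realType} (K : ultrametricFieldType R).

Definition is_uniformizer (pi : K) : Prop :=
  [/\ pi != 0, absv pi < 1 & forall x : K, absv x < 1 -> absv x <= absv pi].

Lemma open_absv_lt (c : K) (r : R) : open [set x : K | absv (c - x) < r].
Proof.
rewrite openE => x /= cx; apply/nbhs_absvP; exists r.
  exact: le_lt_trans (absv_ge0 _) cx.
by move=> y xy /=; rewrite -(subrK x c) -addrA; exact: absvD_lt.
Qed.

(** The open unit ball of an ultrametric field is also closed, hence compact here, and [absv]
    attains its maximum on it. Discreteness of the valuation comes from this maximum. *)
Lemma uniformizer_exists : compact (unit_ball K) ->
  (exists2 x : K, x != 0 & absv x < 1) -> exists pi, is_uniformizer pi.
Proof.
move=> cK [x0 x00 x01].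
pose S := [set x : K | absv x < 1].
have cS : compact S.
  apply: (@subclosed_compact _ S (unit_ball K)) => //; last by move=> x /ltW.
  rewrite closedE => x hx; have [y [y1 xy]] : exists y : K, absv y < 1 /\ absv (x - y) < 1.
    apply: contrapT => h; apply: hx; apply/nbhs_absvP; exists 1 => // y xy y1.
    by apply: h; exists y.
  by rewrite /S /= -(subrK y x); apply: absvD_lt.
have [|||pi /set_mem pi1 hpi] := @compact_EVT_max K R absv S.
- by exists x0.
- by [].
- exact/continuous_subspaceT/absv_continuous.
exists pi; split=> // [|x x1]; last by apply: hpi; exact/mem_set.
by rewrite -absv_gt0; apply: lt_le_trans (hpi x0 _); rewrite ?absv_gt0 ?inE.
Qed.

Lemma residue_cover : compact (unit_ball K) ->
  exists s : seq K, (forall c, c \in s -> absv c <= 1) /\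
    forall x, absv x <= 1 -> exists2 c, c \in s & absv (x - c) < 1.
Proof.
move=> cK; have [|s [sB hs]] :=
    compact_seq_cover (W := fun c => [set x : K | absv (c - x) < 1]) cK.
  by move=> x _; apply: open_nbhs_nbhs; split; [exact: open_absv_lt|rewrite /= subrr absv0].
exists s; split=> // x /hs[c cs /= cx]; exists c => //.
by rewrite absv_distC.
Qed.

Context (pi : K) (pi_unif : is_uniformizer pi).

Local Notation rho := (absv pi).

Lemma unif_neq0 : pi != 0. Proof. by case: pi_unif. Qed.
Lemma rho_gt0 : 0 < rho. Proof. by rewrite absv_gt0 unif_neq0. Qed.
Lemma rho_lt1 : rho < 1. Proof. by case: pi_unif. Qed.
Lemma rhoX_gt0 k : 0 < rho ^+ k. Proof. by rewrite exprn_gt0 // rho_gt0. Qed.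
Lemma rhoX_ge0 k : 0 <= rho ^+ k. Proof. exact: ltW (rhoX_gt0 k). Qed.
Lemma rhoX_le1 k : rho ^+ k <= 1.
Proof. by rewrite exprn_ile1 ?(ltW rho_gt0) ?(ltW rho_lt1). Qed.

Lemma ler_rhoX i j : (rho ^+ i <= rho ^+ j) = (j <= i)%N.
Proof. by rewrite ler_iXn2l ?rho_gt0 ?rho_lt1. Qed.

Lemma rhoX_inj i j : rho ^+ i = rho ^+ j -> i = j.
Proof. by move=> h; apply/eqP; rewrite eqn_leq -!ler_rhoX h lexx. Qed.

Lemma absv_lt1 (x : K) : absv x < 1 -> absv x <= rho.
Proof. by case: pi_unif => _ _; exact. Qed.

(** Dividing by [pi] preserves integrality as long as [absv x < 1]; a power of [rho] below [absv x]
    bounds the number of divisions. *)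
Lemma absv_rhoX (x : K) : x != 0 -> absv x <= 1 -> exists m, absv x = rho ^+ m.
Proof.
move=> x0 x1; have ax : 0 < absv x by rewrite absv_gt0.
have [k hk] : exists k, rho ^+ k < absv x.
  by apply: exp_small => //; rewrite rho_lt1 ltW ?rho_gt0.
elim: k x x0 x1 ax hk => [|k IHk] x x0 x1 ax hk.
  by move: hk; rewrite expr0 ltNge x1.
have [xlt1|xge1] := ltP (absv x) 1; last first.
  by exists 0%N; apply/eqP; rewrite expr0 eq_le x1.
have xpi : absv (x / pi) = absv x / rho by rewrite absvM absvV.
have [|||/=|m hm] := IHk (x / pi).
- by rewrite mulf_neq0 // invr_eq0 unif_neq0.
- by rewrite xpi ler_pdivrMr ?rho_gt0 // mul1r absv_lt1.
- by rewrite xpi divr_gt0 // rho_gt0.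
- by rewrite xpi ltr_pdivlMr ?rho_gt0 // -exprSr.
by exists m.+1; rewrite exprSr -hm xpi divfK ?gt_eqF ?rho_gt0.
Qed.

Lemma absv_le_rhoX (x : K) k : absv x <= rho ^+ k ->
  exists2 y, absv y <= 1 & x = pi ^+ k * y.
Proof.
move=> hx; have pk : pi ^+ k != 0 by rewrite expf_neq0 ?unif_neq0.
exists (x / pi ^+ k); last by rewrite mulrC divfK.
by rewrite absvM absvV absvX ler_pdivrMr ?rhoX_gt0 ?mul1r.
Qed.

Lemma val_valringM (x y : valring K) : val (x * y) = val x * val y.
Proof. by []. Qed.

Lemma val_valringB (x y : valring K) : val (x - y) = val x - val y.
Proof. by []. Qed.

Lemma val_valring_prod (I : Type) (s : seq I) (P : pred I) (g : I -> valring K) :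
  val (\prod_(i <- s | P i) g i) = \prod_(i <- s | P i) val (g i).
Proof. exact: (big_morph _ val_valringM). Qed.

Lemma val_valringD (x y : valring K) : val (x + y) = val x + val y.
Proof. by []. Qed.

Lemma val_valring_sum (I : Type) (s : seq I) (P : pred I) (g : I -> valring K) :
  val (\sum_(i <- s | P i) g i) = \sum_(i <- s | P i) val (g i).
Proof. exact: (big_morph _ val_valringD). Qed.

(** Identifies the algebraic power of the maximal ideal with a ball. For the converse inclusion one
    term suffices: a unit-ball multiple of the product of [j] copies of [pi]. *)
Lemma idealXP j (x : valring K) :
  idealX (maxideal (K := K)) j x <-> absv (val x) <= rho ^+ j.
Proof.
split=> [[m [c [a [ha ->]]]]|hx].
  rewrite val_valring_sum; apply: absv_sum => [|i _]; first exact: rhoX_ge0.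
  rewrite val_valringM val_valring_prod absvM absv_prod -[leRHS]mul1r.
  apply: ler_pM; rewrite ?absv_ge0 ?prodr_ge0 //.
  - by move=> t _; exact: absv_ge0.
  - exact: valP (c i).
  rewrite -[leRHS](_ : \prod_(t < j) rho = _).
    by apply: ler_prod => t _; rewrite absv_ge0; apply: absv_lt1; exact: ha.
  by rewrite prodr_const card_ord.
have [y y1 xy] := absv_le_rhoX hx.
have p1 : pi \in valring_pred (K := K) by exact: ltW rho_lt1.
have y1' : y \in valring_pred (K := K) by [].
exists 1%N, (fun=> Sub y y1'), (fun _ _ => Sub pi p1); split.
  by move=> _ _; rewrite /maxideal /= rho_lt1.
apply: val_inj; rewrite big_ord1 val_valringM val_valring_prod /=.
by rewrite prodr_const card_ord mulrC.
Qed.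

Lemma coset_modP j (x y : valring K) :
  coset_mod j x = coset_mod j y <-> absv (val x - val y) <= rho ^+ j.
Proof.
split=> [h|h].
  have : coset_mod j x x by rewrite /coset_mod /= subrr; apply/idealXP; rewrite absv0 rhoX_ge0.
  by rewrite h /coset_mod /= => /idealXP; rewrite val_valringB.
apply/seteqP; split=> z; rewrite /coset_mod /= => /idealXP; rewrite val_valringB => hz;
  apply/idealXP; rewrite val_valringB /=.
  by rewrite -(subrK (val x) (val z)) -addrA; apply: absvD_le.
by rewrite -(subrK (val y) (val z)) -addrA; apply: absvD_le => //; rewrite absv_distC.
Qed.

Lemma residue_reps : compact (unit_ball K) ->
  exists s : seq K, [/\ size s = residue_card K, uniq s,
    forall c, c \in s -> absv c <= 1,
    forall x, absv x <= 1 -> exists2 c, c \in s & absv (x - c) <= rho &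
    forall c d, c \in s -> d \in s -> absv (c - d) <= rho -> c = d].
Proof.
move=> /residue_cover [s0 [s01 hs0]].
have [|s [sz us _ hs inj]] := @fset_set_reps _ _ (coset_mod (K := K) 1) setT
    (map (insubd 0) s0).
  move=> x _; have [c cs xc] := hs0 (val x) (valP x).
  exists (insubd 0 c); first exact: map_f.
  by apply/coset_modP; rewrite expr1 insubdK ?absv_lt1 //; exact: s01.
exists (map val s); split.
- by rewrite size_map.
- by rewrite map_inj_uniq //; exact: val_inj.
- by move=> _ /mapP[x _ ->]; exact: valP x.
- move=> x x1; have x1' : x \in valring_pred (K := K) by [].
  have [c cs /coset_modP] := hs (Sub x x1') I; rewrite expr1 /= => xc.
  by exists (val c) => //; exact: map_f.
- move=> _ _ /mapP[x xs ->] /mapP[y ys ->] h; congr val; apply: inj => //.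
  by apply/coset_modP; rewrite expr1.
Qed.

End Uniformizer.

(** * Integral matrices and the Smith form *)

Section MatrixBounds.
Context {R : realType} (K : ultrametricFieldType R).

Definition mxle m n (A : 'M[K]_(m, n)) (r : R) : Prop :=
  forall i j, absv (A i j) <= r.

Lemma mxle_trans m n (A : 'M[K]_(m, n)) r t : mxle A r -> r <= t -> mxle A t.
Proof. by move=> h rt i j; exact: le_trans (h i j) rt. Qed.

Lemma mxle0 m n r : 0 <= r -> mxle (0 : 'M[K]_(m, n)) r.
Proof. by move=> r0 i j; rewrite mxE absv0. Qed.

Lemma mxleD m n (A B : 'M[K]_(m, n)) r : mxle A r -> mxle B r -> mxle (A + B) r.
Proof. by move=> hA hB i j; rewrite mxE; exact: absvD_le. Qed.

Lemma mxleN m n (A : 'M[K]_(m, n)) r : mxle (- A) r <-> mxle A r.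
Proof. by split=> h i j; have := h i j; rewrite mxE absvN. Qed.

Lemma mxleB m n (A B : 'M[K]_(m, n)) r : mxle A r -> mxle B r -> mxle (A - B) r.
Proof. by move=> hA hB; apply: mxleD => //; exact/mxleN. Qed.

Lemma mxle_distC m n (A B : 'M[K]_(m, n)) r : mxle (A - B) r <-> mxle (B - A) r.
Proof. by rewrite -opprB; exact: mxleN. Qed.

Lemma mxle_dist_trans m n (A B C : 'M[K]_(m, n)) r :
  mxle (A - B) r -> mxle (B - C) r -> mxle (A - C) r.
Proof. by move=> h1 h2; rewrite -(subrK B A) -addrA; exact: mxleD. Qed.

Lemma mxleM m n p (A : 'M[K]_(m, n)) (B : 'M[K]_(n, p)) r t :
  0 <= r -> 0 <= t -> mxle A r -> mxle B t -> mxle (A *m B) (r * t).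
Proof.
move=> r0 t0 hA hB i j; rewrite mxE; apply: absv_sum => [|k _].
  exact: mulr_ge0.
by rewrite absvM ler_pM ?absv_ge0.
Qed.

Lemma mxleM1l m n p (A : 'M[K]_(m, n)) (B : 'M[K]_(n, p)) t :
  0 <= t -> mxle A 1 -> mxle B t -> mxle (A *m B) t.
Proof. by move=> t0 hA hB; rewrite -[t]mul1r; exact: mxleM. Qed.

Lemma mxleM1r m n p (A : 'M[K]_(m, n)) (B : 'M[K]_(n, p)) t :
  0 <= t -> mxle A t -> mxle B 1 -> mxle (A *m B) t.
Proof. by move=> t0 hA hB; rewrite -[t]mulr1; exact: mxleM. Qed.

Lemma mxleZ m n (a : K) (A : 'M[K]_(m, n)) r t :
  absv a <= t -> mxle A r -> mxle (a *: A) (t * r).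
Proof.
by move=> ha hA i j; rewrite mxE absvM ler_pM ?absv_ge0.
Qed.

Lemma mxle1 n : mxle (1%:M : 'M[K]_n) 1.
Proof. by move=> i j; rewrite mxE; case: eqP; rewrite ?absv1 // absv0. Qed.

Lemma absv_sign (b : nat) : absv ((-1) ^+ b : K) = 1.
Proof. by rewrite absvX absvN absv1 expr1n. Qed.

Lemma mxle_det n (A : 'M[K]_n) : mxle A 1 -> absv (\det A) <= 1.
Proof.
move=> hA; apply: absv_sum => // s _.
rewrite absvM absv_sign mul1r absv_prod.
rewrite -[leRHS](_ : \prod_(i < n) 1 = _); last by rewrite big1.
by apply: ler_prod => i _; rewrite absv_ge0 hA.
Qed.

Lemma mxle_adj n (A : 'M[K]_n) : mxle A 1 -> mxle (\adj A) 1.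
Proof.
move=> hA i j; rewrite mxE /cofactor absvM absv_sign mul1r.
by apply: mxle_det => k l; rewrite !mxE.
Qed.

(** Cramer's rule, with an integral adjugate. *)
Lemma mxle_inv n (A : 'M[K]_n) : \det A != 0 -> mxle A 1 ->
  mxle (invmx A) (absv (\det A))^-1.
Proof.
move=> dA hA; rewrite /invmx unitmxE unitfE dA -[X in mxle _ X]mulr1.
by apply: mxleZ (mxle_adj hA); rewrite absvV.
Qed.

(** The group GL_n of the valuation ring; its elements act as isometries of the sup norm. *)
Definition gl_int n (A : 'M[K]_n) : Prop := mxle A 1 /\ absv (\det A) = 1.

Lemma gl_int_unit n (A : 'M[K]_n) : gl_int A -> A \in unitmx.
Proof. by move=> [_ dA]; rewrite unitmxE unitfE -absv_gt0 dA. Qed.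

Lemma gl_int_inv n (A : 'M[K]_n) : gl_int A -> mxle (invmx A) 1.
Proof.
move=> gA; have [hA dA] := gA; rewrite -invr1 -dA; apply: mxle_inv => //.
by rewrite -absv_gt0 dA.
Qed.

Lemma gl_int_mul n (A B : 'M[K]_n) : gl_int A -> gl_int B -> gl_int (A *m B).
Proof.
move=> [hA dA] [hB dB]; split; first exact: mxleM1l.
by rewrite det_mulmx absvM dA dB mulr1.
Qed.

Lemma gl_int_tperm n (i j : 'I_n) : gl_int (tperm_mx i j : 'M[K]_n).
Proof.
split=> [k l|]; last by rewrite det_perm absv_sign.
by rewrite !mxE; case: eqP; rewrite ?absv1 // absv0.
Qed.

Lemma mxle_block m1 m2 n1 n2 (A : 'M[K]_(m1, n1)) (B : 'M[K]_(m1, n2))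
    (C : 'M[K]_(m2, n1)) (D : 'M[K]_(m2, n2)) r :
  mxle A r -> mxle B r -> mxle C r -> mxle D r -> mxle (block_mx A B C D) r.
Proof.
by move=> hA hB hC hD i j; rewrite !mxE; case: splitP => k _; rewrite mxE; case: splitP.
Qed.

(** An entry of largest absolute value divides all the others in the valuation ring, so clearing its
    row and column uses integral multipliers only. *)
Lemma smith_form n (A : 'M[K]_n) : exists (L Q : 'M[K]_n) (d : 'rV[K]_n),
  [/\ gl_int L, gl_int Q & A = L *m diag_mx d *m Q].
Proof.
elim: n A => [|n IHn] A.
  exists 1%:M, 1%:M, 0; split; rewrite ?[A]flatmx0 ?[RHS]flatmx0 //; split=> [[]//|];
  by rewrite det1 absv1.
have [->|/matrix0Pn [i0 [j0 Aij0]]] := eqVneq A 0.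
  exists 1%:M, 1%:M, 0; split; rewrite ?linear0 ?mulmx0 ?mul0mx //;
  by split; [exact: mxle1|rewrite det1 absv1].
case: (@Order.TotalTheory.arg_maxP _ _ _ (i0, j0) predT
  (fun ij : 'I_n.+1 * 'I_n.+1 => absv (A ij.1 ij.2))) => //= -[i j] _ /= hmax.
have {}hmax k l : absv (A k l) <= absv (A i j) by exact: (hmax (k, l)).
have Aij : A i j != 0.
  by rewrite -absv_gt0 (lt_le_trans _ (hmax i0 j0)) // absv_gt0.
pose T1 : 'M[K]_n.+1 := tperm_mx i 0; pose T2 : 'M[K]_n.+1 := tperm_mx j 0.
pose B : 'M[K]_(1 + n) := T1 *m A *m T2.
suff [L [Q [d [gL gQ hB]]]] : exists (L Q : 'M[K]_(1 + n)) (d : 'rV[K]_(1 + n)),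
    [/\ gl_int L, gl_int Q & B = L *m diag_mx d *m Q].
  have gT1 : gl_int T1 by exact: gl_int_tperm.
  have gT2 : gl_int T2 by exact: gl_int_tperm.
  exists (T1 *m L), (Q *m T2), d; split; [exact: gl_int_mul|exact: gl_int_mul|].
  have TT k : tperm_mx k 0 *m tperm_mx k 0 = 1%:M :> 'M[K]_n.+1.
    by rewrite -perm_mxM perm.tperm2 perm_mx1.
  have -> : A = T1 *m B *m T2.
    by rewrite /B !mulmxA TT mul1mx -mulmxA TT mulmx1.
  by rewrite hB !mulmxA.
have B00 : B 0 0 = A i j.
  by rewrite /B -xrowE -xcolE !mxE !perm.tpermR.
have hB k l : absv (B k l) <= absv (A i j).
  by rewrite /B -xrowE -xcolE !mxE.
set a := A i j in Aij hB B00.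
clearbody B.
have a0 : 0 < absv a by rewrite absv_gt0.
pose u := ursubmx B; pose v := dlsubmx B; pose D := drsubmx B.
have Bblock : B = block_mx a%:M u v D.
  rewrite -[LHS]submxK; congr block_mx; rewrite [LHS]mx11_scalar.
  rewrite !mxE -B00; have lr0 : lshift n 0 = 0 :> 'I_(1 + n) by exact/val_inj.
  by rewrite lr0.
have sc m1 m2 (X : 'M[K]_(m1, m2)) : (forall k l, absv (X k l) <= absv a) ->
    mxle (a^-1 *: X) 1.
  by move=> hX k l; rewrite mxE absvM absvV mulrC ler_pdivrMr // mul1r.
have hu : mxle (a^-1 *: u) 1 by apply: sc => k l; rewrite !mxE.
have hv : mxle (a^-1 *: v) 1 by apply: sc => k l; rewrite !mxE.
(* Induction applies to the Schur complement of the pivot [a]. *)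
have [L [Q [d [[hL dL] [hQ dQ] hD]]]] := IHn (D - (a^-1 *: v) *m u).
exists (block_mx 1%:M 0 (a^-1 *: v) L), (block_mx 1%:M (a^-1 *: u) 0 Q),
  (row_mx a%:M d); split.
- split; first by apply: mxle_block => //; [exact: mxle1|exact: mxle0].
  by rewrite det_lblock det1 mul1r.
- split; first by apply: mxle_block => //; [exact: mxle1|exact: mxle0].
  by rewrite det_ublock det1 mul1r.
rewrite diag_mx_row Bblock.
rewrite (_ : diag_mx a%:M = a%:M); last first.
  by apply/matrixP => k l; rewrite !mxE !ord1.
rewrite !mulmx_block !mul1mx !mul0mx !mulmx0 !mulmx1 !addr0 !add0r.
rewrite -!scalemxAl -!scalemxAr -?mulmxA !mul_mx_scalar mul_scalar_mx !scalerA.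
rewrite !mulVf // !scale1r mul0mx addr0 -scalemxAr scalerA divfK //.
by congr block_mx; rewrite mulmxA -hD -scalemxAl addrC subrK.
Qed.

End MatrixBounds.

(** * Nets modulo powers of the uniformizer *)

Section Nets.
Context {R : realType} (K : ultrametricFieldType R).
Context (pi : K) (pi_unif : is_uniformizer pi) (cK : compact (unit_ball K)).

Local Notation rho := (absv pi).
Local Notation q := (residue_card K).

Definition covers m n k (s : seq 'M[K]_(m, n)) (S : set 'M[K]_(m, n)) : Prop :=
  forall x, S x -> exists2 c, c \in s & mxle (x - c) (rho ^+ k).

Definition spread m n k (s : seq 'M[K]_(m, n)) : Prop :=
  uniq s /\ forall x y, x \in s -> y \in s -> mxle (x - y) (rho ^+ k) -> x = y.

Definition is_net m n k (s : seq 'M[K]_(m, n)) (S : set 'M[K]_(m, n)) : Prop :=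
  [/\ spread k s, forall x, x \in s -> S x & covers k s S].

(** Pigeonhole: by the ultrametric inequality two points within [rho ^+ k] of the same centre are
    within [rho ^+ k] of each other, so distinct points of [s] use distinct centres of [t]. *)
Lemma spread_le_covers m n k (s t : seq 'M[K]_(m, n)) (S : set 'M[K]_(m, n)) :
  spread k s -> (forall x, x \in s -> S x) -> covers k t S ->
  (size s <= size t)%N.
Proof.
move=> [us hs] sS tS.
have h0 x : exists c, x \in s -> c \in t /\ mxle (x - c) (rho ^+ k).
  have [xs|] := boolP (x \in s); last by exists x.
  by have [c ct xc] := tS x (sS x xs); exists c.
have [g hg] := choice h0.
rewrite -(size_map g); apply: uniq_leq_size.
  rewrite map_inj_in_uniq // => x y xs ys gxy; apply: hs => //.
  have [_ hx] := hg x xs; have [_ hy] := hg y ys.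
  by apply: mxle_dist_trans hx _; rewrite gxy mxle_distC.
by move=> _ /mapP[x xs ->]; have [] := hg x xs.
Qed.

Lemma residue_card_gt1 : (1 < q)%N.
Proof.
have [s [<- us s1 hs sep]] := residue_reps pi_unif cK.
have [|c cs hc] := hs 0; first by rewrite absv0.
have [|d ds hd] := hs 1; first by rewrite absv1.
rewrite -[2%N]/(size [:: c; d]); apply: uniq_leq_size; last first.
  by move=> x; rewrite !inE => /orP[/eqP->|/eqP->].
rewrite /= inE andbT; apply/eqP => cd; have := rho_lt1 pi_unif.
rewrite ltNge => /negP; apply; rewrite -(absv1 K) (_ : 1 = (1 - d) - (0 - c)).
  exact: absvB_le.
by rewrite cd; ring.
Qed.

(** Base-[pi] expansions: [rep j c] reads the [j] lowest base-[q] digits of [c] as residue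
    representatives, so that the integers below [q ^ j] index the residues modulo [pi ^+ j]. *)
Lemma digit_reps : exists rep : nat -> nat -> K, forall j,
  [/\ forall c, absv (rep j c) <= 1,
      forall x, absv x <= 1 -> exists2 c, (c < q ^ j)%N & absv (x - rep j c) <= rho ^+ j &
      forall c d, (c < q ^ j)%N -> (d < q ^ j)%N ->
        absv (rep j c - rep j d) <= rho ^+ j -> c = d].
Proof.
have [s [sz us s1 hs sep]] := residue_reps pi_unif cK.
have q0 : (0 < q)%N by exact: ltnW residue_card_gt1.
pose rep := fix rep j c := if j is j'.+1 then nth 0 s (c %% q)%N + pi * rep j' (c %/ q)%N else 0.
have rep1 j c : absv (rep j c) <= 1.
  elim: j c => [|j IHj] c /=; first by rewrite absv0.
  apply: absvD_le; first by rewrite s1 // mem_nth // sz ltn_mod.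
  by rewrite absvM mulr_ile1 ?absv_ge0 // ltW ?(rho_lt1 pi_unif).
exists rep => j; split=> //.
  elim: j => [|j IHj] x x1; first by exists 0%N => //=; rewrite subr0 expr0.
  have [r rs xr] := hs x x1.
  have [|y y1 xy] := absv_le_rhoX pi_unif (k := 1) (x := x - r).
    by rewrite expr1.
  have [c cq yc] := IHj y y1.
  have ri : (index r s < q)%N by rewrite -sz index_mem.
  exists (index r s + q * c)%N.
    rewrite expnS; apply: (@leq_trans (q * c.+1)); last by rewrite leq_mul2l cq orbT.
    by rewrite mulnS ltn_add2r.
  rewrite /= mulnC addnC modnMDl divnMDl // modn_small // divn_small // addn0.
  rewrite nth_index // opprD addrA xy expr1 -mulrBr absvM exprS.
  by rewrite ler_pM2l ?(rho_gt0 pi_unif).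
elim: j => [|j IHj] c d; first by rewrite expn0 !ltnS !leqn0 => /eqP -> /eqP ->.
move=> cq dq /= h.
have hd (e : nat) : (e < q ^ j.+1)%N -> (e %/ q < q ^ j)%N.
  by move=> eq; rewrite ltn_divLR // -expnSr.
have pir (e : K) : absv e <= 1 -> absv (pi * e) <= rho.
  by move=> e1; rewrite absvM ler_piMr ?absv_ge0.
have rcd : nth 0 s (c %% q)%N = nth 0 s (d %% q)%N.
  apply: sep; rewrite ?mem_nth ?sz ?ltn_mod //.
  set x := nth _ _ _ in h *; set y := nth _ _ _ in h *.
  set x' := pi * _ in h *; set y' := pi * _ in h *.
  have -> : x - y = (x + x' - (y + y')) - (x' - y') by ring.
  apply: absvB_le; last by apply: absvB_le; exact: pir.
  by apply: le_trans h _; rewrite -[leRHS]expr1 (ler_rhoX pi_unif).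
have mcd : (c %% q = d %% q)%N.
  by apply/eqP; rewrite -(nth_uniq 0 _ _ us) ?rcd ?sz ?ltn_mod.
have dcd : (c %/ q = d %/ q)%N.
  apply: IHj; rewrite ?hd //.
  move: h; rewrite rcd opprD addrACA subrr add0r -mulrBr absvM exprS.
  by rewrite ler_pM2l ?(rho_gt0 pi_unif).
by rewrite (divn_eq c q) (divn_eq d q) mcd dcd.
Qed.

Definition box n (a : 'I_n -> nat) : set 'rV[K]_n :=
  [set x | forall i, absv (x 0 i) <= rho ^+ a i].

Lemma box_net n (a : 'I_n -> nat) k : (forall i, a i <= k)%N ->
  exists2 s, is_net k s (box a) & size s = (q ^ (\sum_i (k - a i)))%N.
Proof.
move=> ak; have [rep hrep] := digit_reps.
pose rT i := 'I_(q ^ (k - a i)).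
pose pt (g : {dffun forall i, rT i}) : 'rV[K]_n :=
  \row_i (pi ^+ a i * rep (k - a i)%N (g i)).
have rhok i : rho ^+ k = rho ^+ a i * rho ^+ (k - a i) by rewrite -exprD subnKC.
have pt_sep g h : mxle (pt g - pt h) (rho ^+ k) -> g = h.
  move=> gh; apply/ffunP => i; apply: val_inj.
  have [_ _ sep] := hrep (k - a i)%N; apply: sep; rewrite ?ltn_ord //.
  have := gh 0 i; rewrite !mxE -mulrBr absvM absvX (rhok i).
  by rewrite ler_pM2l ?(rhoX_gt0 pi_unif).
have pt_inj : injective pt.
  by move=> g h gh; apply: pt_sep; rewrite gh subrr; apply: mxle0; exact: rhoX_ge0.
exists [seq pt g | g : {dffun forall i, rT i}]; last first.
  rewrite size_image card_dep_ffun foldrE big_map big_enum /= expn_sum.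
  by apply: eq_bigr => i _; rewrite card_ord.
split.
- split; first by rewrite map_inj_uniq ?enum_uniq.
  by move=> _ _ /mapP[g _ ->] /mapP[h _ ->] /pt_sep ->.
- move=> _ /mapP[g _ ->] i; rewrite mxE absvM absvX ler_piMr ?rhoX_ge0 //.
  by have [] := hrep (k - a i)%N.
move=> x hx.
have hy i : exists c : rT i, absv (x 0 i - pi ^+ a i * rep (k - a i)%N c) <= rho ^+ k.
  have [y y1 xy] := absv_le_rhoX pi_unif (hx i).
  have [_ /(_ y y1)[c cq yc] _] := hrep (k - a i)%N.
  exists (Ordinal cq); rewrite xy -mulrBr absvM absvX (rhok i).
  by rewrite ler_pM2l ?(rhoX_gt0 pi_unif).
pose g : {dffun forall i, rT i} := [ffun i => sval (cid (hy i))].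
exists (pt g); first by apply: map_f; rewrite mem_enum.
by move=> z i; rewrite ord1 !mxE ffunE; case: cid.
Qed.

(** The module over the valuation ring spanned by the rows of [A]. *)
Definition lattice n (A : 'M[K]_n) : set 'rV[K]_n :=
  [set x | exists2 w : 'rV[K]_n, mxle w 1 & x = w *m A].

(** The volume of a lattice is the absolute value of its determinant. In Smith form the lattice is
    the image of a box under the isometry [Q], and the exponents of the box sum to [d]; [d <= k]
    keeps each of them at most [k]. *)
Lemma lattice_net n (A : 'M[K]_n) d k :
  mxle A 1 -> absv (\det A) = rho ^+ d -> (d <= k)%N ->
  exists2 s, is_net k s (lattice A) & size s = (q ^ (n * k - d))%N.
Proof.
move=> A1 dA dk.
have [L [Q [g [gL gQ AE]]]] := smith_form A.
have [uL uQ] := (gl_int_unit gL, gl_int_unit gQ).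
have dg : absv (\det A) = \prod_i absv (g 0 i).
  by rewrite AE !det_mulmx det_diag !absvM absv_prod gL.2 gQ.2 mul1r mulr1.
have g0 i : g 0 i != 0.
  have : absv (\det A) != 0 by rewrite dA gt_eqF // (rhoX_gt0 pi_unif).
  by rewrite dg => /prodf_neq0 /(_ i isT); rewrite absv_eq0.
have g1 i : absv (g 0 i) <= 1.
  have -> : g 0 i = (invmx L *m A *m invmx Q) i i.
    rewrite AE !mulmxA mulVmx // mul1mx -mulmxA mulmxV // mulmx1.
    by rewrite mxE eqxx.
  apply: mxleM1l => //; last exact: gl_int_inv.
  by apply: mxleM1l => //; exact: gl_int_inv.
have [a ha] := choice (fun i => absv_rhoX pi_unif (g0 i) (g1 i)).
have sa : (\sum_i a i)%N = d.
  apply: (rhoX_inj pi_unif); rewrite -dA dg.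
  rewrite (eq_bigr _ (fun i _ => ha i)).
  by elim/big_rec2: _ => [|i x y _ <-]; rewrite ?expr0 // exprD.
have ak i : (a i <= k)%N.
  by apply: leq_trans dk; rewrite -sa (bigD1 i) //= leq_addr.
have [s [[us ss] sS cS] sz] := box_net ak.
have QQ m (x : 'M[K]_(m, n)) : x *m Q *m invmx Q = x by rewrite mulmxK.
have Qle m (x : 'M[K]_(m, n)) r : 0 <= r -> mxle (x *m Q) r <-> mxle x r.
  move=> r0; split=> [h|h]; last by apply: mxleM1r => //; case: gQ.
  by rewrite -[x]QQ; apply: mxleM1r => //; exact: gl_int_inv.
exists [seq x *m Q | x <- s]; last first.
  rewrite size_map sz; congr (_ ^ _)%N; rewrite -sa.
  rewrite sumnB; last by move=> i _; exact: ak.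
  by rewrite sum_nat_const card_ord.
split.
- split; first by rewrite map_inj_uniq // => x y /(congr1 (mulmx^~ (invmx Q))); rewrite !QQ.
  move=> _ _ /mapP[x xs ->] /mapP[y ys ->]; rewrite -mulmxBl => /Qle h.
  by congr (_ *m _); apply: ss => //; apply: h; exact: rhoX_ge0.
- move=> _ /mapP[x /sS xb ->].
  exists ((\row_i (x 0 i / g 0 i)) *m invmx L).
    apply: mxleM1l => //; last exact: gl_int_inv.
    move=> z i; rewrite mxE absvM absvV ha ler_pdivrMr ?(rhoX_gt0 pi_unif) //.
    by rewrite mul1r; exact: xb.
  rewrite AE !mulmxA mulmxKV //; congr (_ *m _); apply/rowP => i.
  by rewrite mul_mx_diag !mxE divfK.
move=> _ [w w1 ->].
have [|c cs hc] := cS (w *m L *m diag_mx g).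
  move=> i; rewrite mul_mx_diag mxE absvM ha ler_piMl ?rhoX_ge0 //.
  by apply: mxleM1l => //; case: gL.
exists (c *m Q); first exact: map_f.
by rewrite AE !mulmxA -mulmxBl; apply/Qle => //; exact: rhoX_ge0.
Qed.

End Nets.

(** * Volumes of images *)

Section Volume.
Context {R : realType} (K : ultrametricFieldType R) (pi : K).

Local Notation rho := (absv pi).
Local Notation q := (residue_card K).

(* [vol_le S a]: the Haar measure of the closure of [S] is at most [a]. *)
Definition vol_le n (S : set 'rV[K]_n) (a : R) : Prop :=
  exists k0, forall k, (k0 <= k)%N ->
    exists2 s : seq 'rV[K]_n, (size s)%:R <= a * q%:R ^+ (n * k) & covers pi k s S.

Lemma vol_le_sub n (S S' : set 'rV[K]_n) a b :
  S `<=` S' -> a <= b -> vol_le S' a -> vol_le S b.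
Proof.
move=> SS ab [k0 h]; exists k0 => k /h [s sa cs]; exists s.
  by apply: le_trans sa _; rewrite ler_wpM2r ?exprn_ge0.
by move=> x /SS /cs.
Qed.

Lemma vol_le_seq (I : eqType) n (r : seq I) (S : I -> set 'rV[K]_n) (a : I -> R) :
  (forall i, i \in r -> vol_le (S i) (a i)) ->
  vol_le [set x | exists2 i, i \in r & S i x] (\sum_(i <- r) a i).
Proof.
elim: r => [|i r IHr] h.
  by exists 0%N => k _; exists [::]; rewrite ?big_nil ?mul0r // => x [].
have [k1 h1] := h i (mem_head _ _).
have [|k2 h2] := IHr; first by move=> j jr; apply: h; rewrite inE jr orbT.
exists (maxn k1 k2) => k; rewrite geq_max => /andP[/h1[s ss cs] /h2[t tt ct]].
exists (s ++ t); first by rewrite size_cat natrD big_cons mulrDl lerD.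
move=> x [j]; rewrite inE => /predU1P[->|jr Sx].
  by move=> /cs[c cs' xc]; exists c => //; rewrite mem_cat cs'.
by have [|c ct' xc] := ct x; [exists j|exists c => //; rewrite mem_cat ct' orbT].
Qed.

Lemma covers_flatten n (I : eqType) k N (r : seq I) (S : I -> set 'rV[K]_n) :
  (forall i, i \in r -> exists2 s, (size s <= N)%N & covers pi k s (S i)) ->
  exists2 s, (size s <= size r * N)%N &
    covers pi k s [set x | exists2 i, i \in r & S i x].
Proof.
elim: r => [|i r IHr] h; first by exists [::] => // x [].
have [s ss cs] := h i (mem_head _ _).
have [|t tt ct] := IHr; first by move=> j jr; apply: h; rewrite inE jr orbT.
exists (s ++ t); first by rewrite size_cat mulSn leq_add.
move=> x [j]; rewrite inE => /predU1P[->|jr Sx].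
  by move=> /cs[c cs' xc]; exists c => //; rewrite mem_cat cs'.
by have [|c ct' xc] := ct x; [exists j|exists c => //; rewrite mem_cat ct' orbT].
Qed.

Lemma covers_translate n k s (S : set 'rV[K]_n) (c : 'rV[K]_n) :
  covers pi k s S -> covers pi k [seq c + x | x <- s] [set c + x | x in S].
Proof.
move=> h _ [x /h[d ds xd] <-]; exists (c + d); first exact: map_f.
by rewrite opprD addrACA subrr add0r.
Qed.

Lemma spread_flatten n (I : eqType) k (r : seq I) (g : I -> seq 'rV[K]_n) :
  uniq r -> (forall i, i \in r -> spread pi k (g i)) ->
  (forall i j x y, i \in r -> j \in r -> x \in g i -> y \in g j ->
     mxle (x - y) (rho ^+ k) -> i = j) ->
  spread pi k (flatten [seq g i | i <- r]).
Proof.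
elim: r => [|i r IHr] //= /andP[ir ur] hs hc.
have [u2 h2] : spread pi k (flatten [seq g i | i <- r]).
  apply: IHr => // [j jr|j1 j2 x y j1r j2r]; first by apply: hs; rewrite inE jr orbT.
  by apply: hc; rewrite inE ?j1r ?j2r orbT.
have [u1 h1] := hs i (mem_head _ _).
have hx x y : x \in g i -> y \in flatten [seq g i | i <- r] ->
    mxle (x - y) (rho ^+ k) -> False.
  move=> xi /flatten_mapP[j jr yj] /(hc i j x y (mem_head _ _)) ij.
  by move: ir; rewrite ij ?jr // inE jr orbT.
split.
  rewrite cat_uniq u1 u2 andbT /=; apply/hasPn => y ys; apply/negP => /= yi.
  by apply: (hx y y) => //; rewrite subrr; apply: mxle0; rewrite exprn_ge0 ?absv_ge0.
move=> x y; rewrite !mem_cat => /orP[xi|xs] /orP[yi|ys].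
- exact: h1.
- by move=> /hx [].
- by rewrite mxle_distC => /hx [].
- exact: h2.
Qed.

End Volume.

Section Widen.
Context (n p : nat) (hp : (p <= n)%N).

Lemma widen_ord_inj : injective (widen_ord hp).
Proof. by move=> i j /(congr1 val) /= /val_inj. Qed.

(** Exponents on the first [p] coordinates extended by zero; the sum has at most one term since
    [widen_ord] is injective. *)
Definition ext0 (m : 'I_p -> nat) (i : 'I_n) : nat :=
  (\sum_(k < p | widen_ord hp k == i) m k)%N.

Lemma ext0_widen m k : ext0 m (widen_ord hp k) = m k.
Proof.
rewrite /ext0 (big_pred1 k) // => j; rewrite /= (inj_eq widen_ord_inj) //.
Qed.

Lemma ext0_out m i : (forall k, widen_ord hp k != i) -> ext0 m i = 0%N.
Proof. by move=> h; rewrite /ext0 big_pred0 // => k; exact/negbTE. Qed.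

Lemma ext0_sum m : (\sum_i ext0 m i = \sum_k m k)%N.
Proof.
by rewrite [RHS](partition_big (widen_ord hp) predT).
Qed.

Lemma ext0_le m M : (\sum_k m k <= M)%N -> forall i, (ext0 m i <= M)%N.
Proof.
move=> hM i; apply: leq_trans hM; rewrite -ext0_sum (bigD1 i) //=.
exact: leq_addr.
Qed.

Lemma widen_cases i : (exists k, widen_ord hp k = i) \/
  forall k, widen_ord hp k != i.
Proof.
have [/existsP[k /eqP h]|/existsPn h] := boolP [exists k, widen_ord hp k == i].
  by left; exists k.
by right.
Qed.

End Widen.

(** * Images of shells and slabs under a normalized map *)

Section NormalizedMap.
Context {R : realType} (K : ultrametricFieldType R).
Context (pi : K) (pi_unif : is_uniformizer pi) (cK : compact (unit_ball K)).

Local Notation rho := (absv pi).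
Local Notation q := (residue_card K).
Let rg0 := rho_gt0 pi_unif.
Let rX0 := rhoX_gt0 pi_unif.
Let rXge0 := rhoX_ge0 pi_unif.
Let lrX := ler_rhoX pi_unif.
Let rX1 := rhoX_le1 pi_unif.

Context (n p : nat) (hp : (p <= n)%N) (n_gt0 : (0 < n)%N).
Context (Phi : 'rV[K]_n -> 'rV[K]_n) (J : 'rV[K]_n -> 'M[K]_n).
Context (v : 'I_p -> nat) (e : nat).

(** A Taylor expansion whose quadratic remainder has constant 1 at every scale; the rescaling of the
    charts is designed to reach this form. *)
Hypothesis PhiJ : forall w h k, mxle w 1 -> mxle h (rho ^+ k) ->
  mxle (Phi (w + h) - Phi w - h *m J w) (rho ^+ (k + k)).
Hypothesis J1 : forall w, mxle w 1 -> mxle (J w) 1.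
Hypothesis Jdet : forall w, mxle w 1 ->
  absv (\det (J w)) = rho ^+ e * \prod_(k < p) absv (w 0 (widen_ord hp k)) ^+ (v k).-1.
Hypothesis v_gt0 : forall k, (0 < v k)%N.

Local Notation crd w k := ((w : 'rV[K]_n) 0 (widen_ord hp k)).

Lemma Phi_lip w h k : mxle w 1 -> mxle h (rho ^+ k) ->
  mxle (Phi (w + h) - Phi w) (rho ^+ k).
Proof.
move=> w1 hk; rewrite -(subrK (h *m J w) (_ - _)); apply: mxleD.
  by apply: mxle_trans (PhiJ w1 hk) _; rewrite lrX leq_addr.
by apply: mxleM1r => //; exact: J1.
Qed.

Lemma mxle_rhoX1 m r (w : 'M[K]_(m, r)) k : mxle w (rho ^+ k) -> mxle w 1.
Proof. by move=> h; apply: mxle_trans h (rX1 k). Qed.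

(** Inverting [A] costs exactly the factor [rho ^+ d] of its determinant. *)
Lemma mxle_solve (A : 'M[K]_n) d (x : 'rV[K]_n) k :
  mxle A 1 -> absv (\det A) = rho ^+ d -> mxle x (rho ^+ (d + k)) ->
  exists2 y, mxle y (rho ^+ k) & x = y *m A.
Proof.
move=> A1 dA hx; have dA0 : \det A != 0 by rewrite -absv_gt0 dA.
exists (x *m invmx A); last by rewrite mulmxKV // unitmxE unitfE.
have -> : rho ^+ k = rho ^+ (d + k) * (rho ^+ d)^-1.
  by rewrite exprD mulrC mulKf // gt_eqF.
apply: mxleM => //; first by rewrite invr_ge0.
by rewrite -dA; exact: mxle_inv.
Qed.

Lemma mxle_piX m r (x : 'M[K]_(m, r)) k :
  mxle x (rho ^+ k) <-> exists2 y, mxle y 1 & x = pi ^+ k *: y.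
Proof.
split=> [h|[y y1 ->]]; last first.
  by rewrite -[rho ^+ k]mulr1; apply: mxleZ => //; rewrite absvX.
exists (pi ^- k *: x).
  rewrite -[1](@mulVf _ (rho ^+ k)) ?gt_eqF //; apply: mxleZ => //.
  by rewrite absvV absvX.
by rewrite scalerA mulfV ?scale1r // expf_neq0 ?(unif_neq0 pi_unif).
Qed.

Lemma lattice_piX (A : 'M[K]_n) M x :
  lattice (pi ^+ M *: A) x <-> exists2 y, mxle y (rho ^+ M) & x = y *m A.
Proof.
split=> [[w w1 ->]|[y /mxle_piX[w w1 ->] ->]].
  exists (pi ^+ M *: w); first by apply/mxle_piX; exists w.
  by rewrite -scalemxAl -scalemxAr.
by exists w => //; rewrite -scalemxAl -scalemxAr.
Qed.

Lemma piX_lattice_net (A : 'M[K]_n) d M k :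
  mxle A 1 -> absv (\det A) = rho ^+ d -> (n * M + d <= k)%N ->
  exists2 s, is_net pi k s (lattice (pi ^+ M *: A)) & size s = (q ^ (n * k - (n * M + d)))%N.
Proof.
move=> A1 dA hk; apply: lattice_net => //.
  apply: (@mxle_rhoX1 _ _ _ M); rewrite -[rho ^+ M]mulr1.
  by apply: mxleZ => //; rewrite absvX.
by rewrite detZ absvM dA -exprM absvX exprD mulnC.
Qed.

(** The remainder has size [rho ^+ (M + M)], and since [d <= M] it can be solved against [J w] with
    a vector of size [rho ^+ M]; it is thus absorbed in the lattice of the linear part. *)
Lemma Phi_image w h M d : mxle w 1 -> mxle h (rho ^+ M) ->
  absv (\det (J w)) = rho ^+ d -> (d <= M)%N ->
  lattice (pi ^+ M *: J w) (Phi (w + h) - Phi w).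
Proof.
move=> w1 hM dJ dM; apply/lattice_piX.
have [|y yM E] := mxle_solve (J1 w1) dJ (k := M) (x := Phi (w + h) - Phi w - h *m J w).
  by apply: mxle_trans (PhiJ w1 hM) _; rewrite lrX leq_add2r.
exists (h + y); first exact: mxleD.
by rewrite mulmxDl -E [RHS]addrC subrK.
Qed.

Definition shell (m : 'I_p -> nat) : set 'rV[K]_n :=
  [set w | mxle w 1 /\ forall k, absv (crd w k) = rho ^+ m k].

Definition jac_exp (m : 'I_p -> nat) : nat := (e + \sum_(k < p) (v k).-1 * m k)%N.

Lemma shell_det m w : shell m w -> absv (\det (J w)) = rho ^+ jac_exp m.
Proof.
move=> [w1 hw]; rewrite Jdet // /jac_exp exprD; congr (_ * _).
elim/big_rec2: _ => [|k x y _ ->]; first by rewrite expr0.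
by rewrite hw -exprM exprD mulnC.
Qed.

(** Exponent of the Jacobian plus exponent of the volume of the shell: this is where [v k - 1]
    becomes [v k]. *)
Lemma jac_expE m : (jac_exp m + \sum_k m k = e + \sum_k v k * m k)%N.
Proof.
rewrite /jac_exp -addnA -big_split /=; congr (_ + _)%N; apply: eq_bigr => k _.
by rewrite addnC -mulSn prednK.
Qed.

(** A piece is expanded around one of its own points, so the empty piece is handled apart. *)
Lemma cond_cover (S S' : set 'rV[K]_n) N k :
  (S !=set0 -> exists2 s, (size s <= N)%N & covers pi k s S') ->
  (S = set0 -> S' = set0) ->
  exists2 s, (size s <= N)%N & covers pi k s S'.
Proof.
move=> h h0; have [/h0 ->|/set0P //] := eqVneq S set0.
by exists [::].
Qed.

Lemma qX_gt0 k : 0 < (q%:R : R) ^+ k.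
Proof. by rewrite exprn_gt0 // ltr0n ltnW // (residue_card_gt1 pi_unif). Qed.

Lemma expn_subX a b c : (b <= a)%N -> (c = a - b)%N -> (q ^ c)%:R = q%:R ^- b * q%:R ^+ a :> R.
Proof.
move=> ba ->; rewrite natrX -[in RHS](subnK ba) exprD mulrCA mulVf ?mulr1 //.
by rewrite gt_eqF // qX_gt0.
Qed.

(** Cut the shell into cosets modulo [pi ^+ M]; each of them maps into a translate of a lattice of
    known volume. *)
Lemma shell_upper m :
  vol_le pi (Phi @` shell m) (q%:R ^- (\sum_k v k * m k)).
Proof.
(* [M] is at least [d], as [Phi_image] requires, and at least every [m k], so that the enclosing box
   is a union of cosets modulo [pi ^+ M]. *)
set d := jac_exp m; pose M := (d + \sum_k m k)%N.
have aM : forall i, (ext0 hp m i <= M)%N by apply: ext0_le; rewrite leq_addl.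
have [s0 [_ _ cs0] sz0] := box_net pi_unif cK aM.
have sh_box : shell m `<=` box pi (ext0 hp m).
  move=> w [w1 hw] i; have [[k <-]|h] := widen_cases hp i.
    by rewrite ext0_widen hw.
  by rewrite ext0_out // expr0.
have sM : (\sum_i (M - ext0 hp m i) = n * M - \sum_k m k)%N.
  rewrite sumnB; last by move=> i _.
  by rewrite sum_nat_const card_ord ext0_sum.
exists (n * M + d)%N => k hk.
pose piece (c : 'rV[K]_n) := [set w | shell m w /\ mxle (w - c) (rho ^+ M)].
have [|s ss cs] := @covers_flatten _ K pi n _ k (q ^ (n * k - (n * M + d))) s0
    (fun c => Phi @` piece c).
  move=> c _; apply: (@cond_cover (piece c)); last by move=> ->; rewrite image_set0.
  move=> [w [ws wc]].
  have [w1 _] := ws.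
  have [s [_ _ cs] sz] := piX_lattice_net (J1 w1) (shell_det ws) hk.
  exists [seq Phi w + x | x <- s]; first by rewrite size_map sz.
  move=> _ [w' [ws' wc'] <-].
  have := covers_translate (c := Phi w) cs; apply; exists (Phi w' - Phi w); last first.
    by rewrite addrC subrK.
  have := @Phi_image w (w' - w) M d w1; rewrite [w + _]addrC subrK; apply.
  - by apply: mxle_dist_trans wc' _; rewrite mxle_distC.
  - exact: shell_det.
  - exact: leq_addr.
exists s.
  have Mk : (n * M + d <= n * k)%N by apply: leq_trans hk _; rewrite leq_pmull.
  have mM : (\sum_k m k <= n * M)%N.
    by rewrite -(ext0_sum hp); apply: leq_trans (leq_sum _ (fun i _ => aM i)) _;
       rewrite sum_nat_const card_ord.
  (* The auxiliary scale cancels: [n * M - \sum_k m k] for the number of cosets plus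
     [n * k - (n * M + d)] for each image. *)
  apply: (@le_trans _ _ (q ^ (n * k - (d + \sum_k m k)))%:R).
    rewrite ler_nat; apply: leq_trans ss _; rewrite sz0 sM -expnD.
    by rewrite leq_exp2l ?(residue_card_gt1 pi_unif) //; lia.
  rewrite (@expn_subX (n * k) (d + \sum_k m k)) //; last by lia.
  rewrite ler_wpM2r ?(ltW (qX_gt0 _)) // lef_pV2 ?posrE ?qX_gt0 //.
  (* The factor [q ^- e], at most 1, is dropped. *)
  by rewrite jac_expE ler_weXn2l ?leq_addl // ler1n ltnW // (residue_card_gt1 pi_unif).
move=> _ [w ws <-]; have [c cs0' wc] := cs0 w (sh_box w ws).
by apply: cs; exists c => //; exists w.
Qed.

(** The Jacobian may vanish on a slab, so only the Lipschitz bound is available: balls of radius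
    [rho ^+ s] map into balls of the same radius, and the image is no larger than the slab. *)
Lemma slab_upper s (k0 : 'I_p) :
  vol_le pi (Phi @` [set w | mxle w 1 /\ absv (crd w k0) <= rho ^+ s]) (q%:R ^- s).
Proof.
pose a (i : 'I_n) := if i == widen_ord hp k0 then s else 0%N.
have ak i : (a i <= s)%N by rewrite /a; case: ifP.
have [s0 [_ _ cs0] sz0] := box_net pi_unif cK ak.
have sE : (\sum_i (s - a i) = n * s - s)%N.
  rewrite sumnB // sum_nat_const card_ord; congr (_ - _)%N.
  by rewrite /a -big_mkcond big_pred1_eq.
exists s => k sk.
have [s1 [_ _ cs1] sz1] := box_net pi_unif cK (a := fun _ : 'I_n => s) (fun _ => sk).
have s1E : (size s1 = q ^ (n * k - n * s))%N.
  by rewrite sz1 sum_nat_const card_ord mulnBr.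
pose S := [set w : 'rV[K]_n | mxle w 1 /\ absv (crd w k0) <= rho ^+ s].
pose piece (c : 'rV[K]_n) := [set w | S w /\ mxle (w - c) (rho ^+ s)].
have [|t st ct] := @covers_flatten _ K pi n _ k (q ^ (n * k - n * s)) s0
    (fun c => Phi @` piece c).
  move=> c _; apply: (@cond_cover (piece c)); last by move=> ->; rewrite image_set0.
  move=> [w [[w1 _] wc]].
  exists [seq Phi w + x | x <- s1]; first by rewrite size_map s1E.
  move=> _ [w' [[w'1 _] wc'] <-].
  apply: (covers_translate (c := Phi w) cs1); exists (Phi w' - Phi w); last first.
    by rewrite addrC subrK.
  move=> i; have := @Phi_lip w (w' - w) s w1; rewrite [w + _]addrC subrK; apply.
  by apply: mxle_dist_trans wc' _; rewrite mxle_distC.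
exists t.
  have nsk : (n * s <= n * k)%N by rewrite leq_pmul2l.
  have sn : (s <= n * s)%N by rewrite leq_pmull.
  rewrite -(@expn_subX (n * k) s (n * k - s)) //; last by lia.
  rewrite ler_nat; apply: leq_trans st _; rewrite sz0 sE -expnD.
  by rewrite leq_exp2l ?(residue_card_gt1 pi_unif) //; lia.
move=> _ [w [w1 ws] <-]; have [|c cs0' wc] := cs0 w.
  move=> i; rewrite /a; case: eqP => [->|] //; by rewrite expr0.
by apply: ct; exists c => //; exists w.
Qed.

(** The expansion of [Phi] controls [J] as well: expanding [Phi] at [w] and at [w + h] with the
    increment [u] gives [u *m (J (w + h) - J w)] as a combination of three remainders, and with [u]
    equal to [pi ^+ k] times a basis vector one divides by [pi ^+ k]. *)
Lemma J_lip w h k : mxle w 1 -> mxle h (rho ^+ k) ->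
  mxle (J (w + h) - J w) (rho ^+ k).
Proof.
move=> w1 hk; have h1 := mxle_rhoX1 hk.
have wh1 : mxle (w + h) 1 by exact: mxleD.
suff : mxle (pi ^+ k *: (J (w + h) - J w)) (rho ^+ (k + k)).
  move=> H i j; have := H i j; rewrite mxE absvM absvX exprD.
  by rewrite ler_pM2l.
move=> i j.
pose u : 'rV[K]_n := pi ^+ k *: delta_mx 0 i.
have uk : mxle u (rho ^+ k).
  apply/mxle_piX; exists (delta_mx 0 i) => // i' j'.
  by rewrite mxE; case: andP; rewrite ?absv1 // absv0.
have huk : mxle (h + u) (rho ^+ k) by exact: mxleD.
suff : mxle (u *m (J (w + h) - J w)) (rho ^+ (k + k)).
  by move=> /(_ 0 j); rewrite /u -scalemxAl -rowE !mxE.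
have E1 := PhiJ wh1 uk; have E2 := PhiJ w1 huk; have E3 := PhiJ w1 hk.
have -> : u *m (J (w + h) - J w) =
    (Phi (w + (h + u)) - Phi w - (h + u) *m J w)
    - (Phi (w + h) - Phi w - h *m J w)
    - (Phi (w + h + u) - Phi (w + h) - u *m J (w + h)).
  rewrite mulmxBr mulmxDl addrA.
  move: (Phi _) (Phi _) (Phi _) (u *m J w) (u *m J _) (h *m J w) => *.
  by apply/matrixP => ? ?; rewrite !mxE; ring.
exact/mxleB/E1/mxleB.
Qed.

Section Surjectivity.
Context (w : 'rV[K]_n) (M d : nat) (w1 : mxle w 1).
Context (dJ : absv (\det (J w)) = rho ^+ d) (dM : (d < M)%N).

(* Newton's iteration: each correction improves the residual by a factor
   [rho], because the error term is quadratic and [d < M]. *)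
Lemma newton_approx x i : lattice (pi ^+ M *: J w) x ->
  exists h y, [/\ mxle h (rho ^+ M), mxle y (rho ^+ (M + i)) &
    Phi w + x - Phi (w + h) = y *m J w].
Proof.
move=> /lattice_piX[y0 hy0 ->]; elim: i => [|i [h [y [hM hy E]]]].
  exists 0, y0; split; rewrite ?addn0 //; first exact: mxle0.
  by rewrite addr0 addrC addKr.
have yM : mxle y (rho ^+ M) by apply: mxle_trans hy _; rewrite lrX leq_addr.
have wh1 : mxle (w + h) 1 by apply: mxleD => //; exact: mxle_rhoX1 hM.
(* Minus the new residual, split into the Taylor remainder at [w + h] and the error of using [J w]
   in place of [J (w + h)]. *)
pose r := Phi (w + h + y) - Phi (w + h) - y *m J (w + h) + y *m (J (w + h) - J w).
have hr : mxle r (rho ^+ (d + (M + i.+1))).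
  apply: (@mxle_trans _ _ _ _ _ (rho ^+ (M + i + M))); last by rewrite lrX; lia.
  apply: mxleD; first by apply: mxle_trans (PhiJ wh1 hy) _; rewrite lrX; lia.
  by rewrite exprD; apply: mxleM => //; exact: J_lip.
have [z hz rE] := mxle_solve (J1 w1) dJ hr.
exists (h + y), (- z); split; [exact: mxleD|exact/mxleN|].
rewrite mulNmx -rE /r mulmxBr addrA.
have -> : Phi w + y0 *m J w = Phi (w + h) + y *m J w by rewrite -E [RHS]addrC subrK.
move: (Phi _) (Phi _) (y *m J w) (y *m J _) => *.
by apply/matrixP => ? ?; rewrite !mxE; ring.
Qed.

(** Without an exact solution every [h] in the ball would have a residual above some power of [rho].
    Compactness makes this power uniform, against [newton_approx]. *)
Lemma Phi_surj x : lattice (pi ^+ M *: J w) x ->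
  exists2 h, mxle h (rho ^+ M) & Phi (w + h) = Phi w + x.
Proof.
move=> hx; apply: contrapT => nosol.
pose T := Phi w + x.
have bad (h : 'rV[K]_n) : exists i, mxle h (rho ^+ M) -> ~ mxle (T - Phi (w + h)) (rho ^+ i).
  have [hM|] := pselect (mxle h (rho ^+ M)); last by exists 0%N.
  have Th : T - Phi (w + h) != 0.
    by apply/eqP => /subr0_eq Th; apply: nosol; exists h.
  have [j Tj _] := exists_maxabs Th.
  have [||i hi] := @exp_small R rho (absv ((T - Phi (w + h)) 0 j)).
  - by rewrite ltW //= (rho_lt1 pi_unif).
  - by rewrite absv_gt0.
  by exists i => _ /(_ 0 j); rewrite leNgt hi.
have [g hg] := choice bad.
have cP : compact [set h : 'rV[K]_n | forall i, unit_ball K (h 0 i)].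
  exact: rV_compact_all.
(* The ball of radius [rho ^+ M] is parametrized by the unit ball through [pi ^+ M *: c]. On [W c]
   the map [Phi] moves by no more than the residual forbidden at [c]. *)
pose W (c : 'rV[K]_n) := [set h : 'rV[K]_n | mxle (c - h) (rho ^+ g (pi ^+ M *: c))].
have [|s [s1 hs]] := compact_seq_cover (W := W) cP.
  move=> c _; apply/nbhs_rVP; exists (rho ^+ g (pi ^+ M *: c)) => // y hy i j.
  by rewrite ord1 !mxE; exact: ltW.
pose i0 := \max_(c <- s) g (pi ^+ M *: c).
have [h [y [hM hy E]]] := newton_approx i0 hx.
have [h' h'1 hE] := (mxle_piX h M).1 hM.
have [|c cs Wc] := hs h'; first by move=> i; exact: h'1.
have gi : (g (pi ^+ M *: c) <= i0)%N by rewrite /i0; exact: leq_bigmax_seq.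
have c1 : mxle c 1 by move=> i j; rewrite ord1; exact: s1.
have piM k : mxle (pi ^+ M *: c - h) (rho ^+ k) <-> mxle (pi ^+ M *: (c - h')) (rho ^+ k).
  by rewrite hE scalerBr.
have hcM : mxle (pi ^+ M *: c) (rho ^+ M) by apply/mxle_piX; exists c.
apply: (hg (pi ^+ M *: c)) => //.
set k := g _ in Wc gi *.
have ck : mxle (pi ^+ M *: c - h) (rho ^+ k).
  apply/piM; rewrite -[rho ^+ k]mul1r; apply: mxleZ => //.
  by rewrite absvX.
have wh1 : mxle (w + h) 1 by apply: mxleD => //; exact: mxle_rhoX1 hM.
have := Phi_lip wh1 ck; rewrite -[w + h + _]addrA [h + _]addrC subrK => Pk.
apply: (@mxle_dist_trans _ _ _ _ _ (Phi (w + h))).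
  rewrite E; apply: mxleM1r => //; last exact: J1.
  by apply: mxle_trans hy _; rewrite lrX; lia.
by rewrite mxle_distC.
Qed.

End Surjectivity.

(** Around each coset representative Newton's iteration produces a full translated lattice in the
    image. Injectivity of [Phi] keeps the lattices of different cosets apart, so their nets can be
    concatenated. *)
Lemma shell_lower m :
  (forall w w', mxle w 1 -> mxle w' 1 -> (forall k, crd w k != 0) ->
     (forall k, crd w' k != 0) -> Phi w = Phi w' -> w = w') ->
  let D := (e + \sum_k v k * m k + p)%N in
  exists k0, forall k, (k0 <= k)%N -> (D <= n * k)%N /\
    exists s, [/\ spread pi k s, forall x, x \in s -> (Phi @` shell m) x &
                  size s = (q ^ (n * k - D))%N].
Proof.
move=> Phi_inj D; set d := jac_exp m.
(* Only the part of the shell with leading digits fixed by [u] is used: perturbing [u] in the box of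
   exponents [m k + 1] leaves the absolute values unchanged. This costs the summand [p] of [D]. The
   successor in [M] gives the strict inequality needed by Newton's iteration. *)
pose m1 k := (m k).+1; pose M := (d + \sum_k m1 k).+1.
have sm1 : (\sum_k m1 k = \sum_k m k + p)%N.
  rewrite (eq_bigr (fun k => m k + 1)%N) => [|k _]; last by rewrite addn1.
  by rewrite big_split /= sum_nat_const card_ord muln1.
have aM : forall i, (ext0 hp m1 i <= M)%N by apply: ext0_le; rewrite /M; lia.
have [s0 [sp0 sb0 _] sz0] := box_net pi_unif cK aM.
have sM : (\sum_i (M - ext0 hp m1 i) = n * M - \sum_k m1 k)%N.
  by rewrite sumnB // sum_nat_const card_ord ext0_sum.
have mM : (\sum_k m1 k <= n * M)%N.
  by rewrite -(ext0_sum hp); apply: leq_trans (leq_sum _ (fun i _ => aM i)) _;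
     rewrite sum_nat_const card_ord.
pose u : 'rV[K]_n := \sum_k pi ^+ m k *: delta_mx 0 (widen_ord hp k).
have uk k : crd u k = pi ^+ m k.
  rewrite summxE (bigD1 k) //= big1 ?addr0 => [|j jk].
    by rewrite !mxE !eqxx mulr1.
  by rewrite !mxE (inj_eq (@widen_ord_inj _ _ hp)) eq_sym (negPf jk) andbF mulr0.
have u1 : mxle u 1.
  move=> i j; rewrite summxE; apply: absv_sum => // k _.
  rewrite !mxE absvM absvX mulr_ile1 ?absv_ge0 //.
  by case: andP; rewrite ?absv1 // absv0.
have sh c h : c \in s0 -> mxle h (rho ^+ M) -> shell m (u + c + h).
  move=> cs hM; have cb := sb0 c cs; split.
    apply: mxleD; last exact: mxle_rhoX1 hM.
    by apply: mxleD => // i j; rewrite ord1; apply: le_trans (cb j) _.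
  move=> k; rewrite !mxE uk -addrA; set y := c 0 _ + h 0 _.
  have yk : absv y < rho ^+ m k.
    apply: (@le_lt_trans _ _ (rho ^+ (m k).+1)).
      apply: absvD_le; first by have := cb (widen_ord hp k); rewrite ext0_widen.
      apply: le_trans (hM _ _) _; rewrite lrX.
      by apply: leq_trans (aM (widen_ord hp k)); rewrite ext0_widen.
    by rewrite exprS gtr_pMl // (rho_lt1 pi_unif).
  apply/eqP; rewrite eq_le; apply/andP; split.
    by apply: absvD_le; rewrite ?absvX // ltW.
  rewrite leNgt; apply/negP => lt.
  have : absv (pi ^+ m k) < rho ^+ m k.
    by rewrite -[X in absv X](addrK y); exact: absvB_lt.
  by rewrite absvX ltxx.
have shc c : c \in s0 -> shell m (u + c).
  by move=> cs; rewrite -[u + c]addr0; apply: sh => //; exact: mxle0.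
have dM : (d < M)%N by rewrite /M; lia.
have sh_neq0 w : shell m w -> forall k, crd w k != 0.
  by move=> [_ hw] k; rewrite -absv_gt0 hw.
have nM : (M <= n * M)%N by rewrite leq_pmull.
exists (n * M + d)%N => k hk.
have hk' : (n * M + d <= n * k)%N by apply: leq_trans hk _; rewrite leq_pmull.
have Dk : (D <= n * k)%N.
  have := jac_expE m; rewrite -/d /D; move: mM hk'; rewrite sm1 /M; lia.
split => //.
have net c : exists s, c \in s0 ->
    is_net pi k s (lattice (pi ^+ M *: J (u + c))) /\
    size s = (q ^ (n * k - (n * M + d)))%N.
  have [cs|] := boolP (c \in s0); last by exists [::].
  have [s ns sz] := piX_lattice_net (J1 (shc c cs).1) (shell_det (shc c cs)) hk.
  by exists s.
have [g hg] := choice net.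
pose G c := [seq Phi (u + c) + x | x <- g c].
have Gimg c y x : c \in s0 -> lattice (pi ^+ M *: J (u + c)) x ->
    y = Phi (u + c) + x -> exists2 h, mxle h (rho ^+ M) & Phi (u + c + h) = y.
  move=> cs hx ->; have [w1 _] := shc c cs.
  exact: (@Phi_surj (u + c) M d w1 (shell_det (shc c cs)) dM x hx).
exists (flatten [seq G c | c <- s0]); split.
- apply: spread_flatten => [|c cs|c c' x y cs c's]; first by case: sp0.
    have [[[ug sg] _ _] _] := hg c cs; split.
      by rewrite map_inj_uniq //; exact: addrI.
    move=> _ _ /mapP[x xs ->] /mapP[y ys ->].
    by rewrite opprD addrACA subrr add0r => /(sg _ _ xs ys) ->.
  move=> /mapP[a ag ->] /mapP[b bg ->] xy.
  have [[_ la _] _] := hg c cs; have [[_ lb _] _] := hg c' c's.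
  have [h' h'M E'] := Gimg c' _ b c's (lb b bg) erefl.
  (* As [k >= M + d], the lattice at [c] absorbs vectors of size [rho ^+ k]; hence the nearby point
     built from [c'] is also an image from the ball around [u + c]. *)
  have Lxy : lattice (pi ^+ M *: J (u + c)) (a + (Phi (u + c') + b - (Phi (u + c) + a))).
    have [w wM aE] := (lattice_piX _ _ _).1 (la a ag).
    have [|z zM zE] := mxle_solve (J1 (shc c cs).1) (shell_det (shc c cs)) (k := M)
        (x := Phi (u + c') + b - (Phi (u + c) + a)).
      apply/mxle_distC; apply: mxle_trans xy _; rewrite lrX -/d.
      by apply: leq_trans hk; rewrite addnC leq_add2r.
    apply/lattice_piX; exists (w + z); first exact: mxleD.
    by rewrite mulmxDl -aE -zE.
  have [h hM E] := Gimg c _ _ cs Lxy erefl.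
  have {}E : Phi (u + c + h) = Phi (u + c' + h').
    by rewrite E' E; apply/matrixP => ? ?; rewrite !mxE; ring.
  have [A B] := (sh c h cs hM, sh c' h' c's h'M).
  have := Phi_inj _ _ A.1 B.1 (sh_neq0 _ A) (sh_neq0 _ B) E.
  (* Injectivity gives [u + c + h = u + c' + h'], so [c] and [c'] agree modulo [pi ^+ M] and
     coincide by the spread of [s0]. *)
  move=> hh; case: sp0 => _; apply=> //.
  have -> : c - c' = h' - h.
    apply/eqP; rewrite subr_eq addrAC eq_sym subr_eq; apply/eqP.
    by move: hh; rewrite -!addrA => /addrI ->; rewrite addrC.
  exact: mxleB.
- move=> x /flatten_mapP[c cs /mapP[a ag ->]].
  have [[_ la _] _] := hg c cs.
  have [h hM <-] := Gimg c _ a cs (la a ag) erefl.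
  by exists (u + c + h) => //; exact: sh.
rewrite size_flatten /shape -map_comp sumnE big_map big_seq.
rewrite (eq_bigr (fun=> q ^ (n * k - (n * M + d))))%N; last first.
  by move=> c cs; rewrite /= size_map; have [_] := hg c cs.
rewrite -big_seq big_const_seq count_predT iter_addn_0 sz0 sM mulnC -expnD.
congr (_ ^ _)%N; have := jac_expE m; rewrite -/d sm1 /D; move: mM; rewrite sm1; lia.
Qed.

Lemma local_upper (N : 'I_p -> nat) (lam : R) (C : nat) :
  0 <= lam -> (forall k, lam * (N k)%:R <= (v k)%:R) ->
  exists2 B : R, 0 <= B & forall j,
    vol_le pi (Phi @` [set w | mxle w 1 /\
        \prod_(k < p) absv (crd w k) ^+ N k * rho ^+ C <= rho ^+ j])
      (B * j.+1%:R ^+ n * q%:R `^ (- (lam * j%:R))).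
Proof.
move=> lam0 hlam.
have q1 : 1 <= (q%:R : R) by rewrite ler1n ltnW // (residue_card_gt1 pi_unif).
(* An integer above [lam], so that a slab of width [rho ^+ (L * j)] has image of volume at most
   [q ^ (- lam j)]. *)
pose L := Num.bound lam.
have lamL : lam <= L%:R by rewrite ltW // archi_boundP.
exists ((p + L ^ p)%:R * q%:R `^ (lam * C%:R)).
  by rewrite mulr_ge0 ?powR_ge0.
move=> j; set s := (L * j)%N; set S := [set w | _].
pose A : R := q%:R `^ (lam * C%:R) * q%:R `^ (- (lam * j%:R)).
have A0 : 0 <= A by rewrite mulr_ge0 ?powR_ge0.
have qXN a : q%:R ^- a = q%:R `^ (- a%:R) :> R by rewrite powRN powR_mulrn.
have AE : A = q%:R `^ (lam * C%:R - lam * j%:R).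
  rewrite /A -powRD //; apply/implyP => _.
  by rewrite gt_eqF // (lt_le_trans ltr01 q1).
(* Index of the pieces: one slab for each crossing coordinate, and one shell for each exponent
   vector below [s]. *)
pose I := ('I_p + {ffun 'I_p -> 'I_s})%type.
pose P (i : I) : set 'rV[K]_n := match i with
  | inl k => [set w | mxle w 1 /\ absv (crd w k) <= rho ^+ s]
  | inr m => shell (fun k => m k) `&` S end.
have hP i : vol_le pi (Phi @` P i) A.
  case: i => [k|m].
    apply: vol_le_sub (slab_upper s k) => //.
    rewrite qXN AE ler_powR // /s natrM; have jL := ler_wpM2r (ler0n R j) lamL.
    have lC : 0 <= lam * C%:R by rewrite mulr_ge0.
    by move: jL lC; set a := lam * _; set b := L%:R * _; set c := lam * _; lra.
  (* The product is constant on a shell, so a shell with [\sum_k N k * m k + C < j] misses [S]. *)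
  have [h|h] := leqP j (\sum_k N k * m k + C)%N; last first.
    apply: (@vol_le_sub _ _ _ _ _ set0 _ A) => //; last first.
      exists 0%N => k _; exists [::] => //; by rewrite mulr_ge0 // exprn_ge0.
    move=> x [w [[w1 hw] [_ hS]] _]; move: h; rewrite ltnNge -lrX => /negP; apply.
    apply: le_trans _ hS; rewrite exprD ler_pM2r //.
    elim/big_rec2: _ => [|k a b _ ab]; first by rewrite expr0.
    by rewrite exprD mulnC exprM hw ler_pM2l ?exprn_gt0.
  apply: vol_le_sub (shell_upper (fun k => m k)) => [x [w [ws _] <-]|]; first by exists w.
  rewrite qXN AE ler_powR // lerNl opprB.
  apply: (@le_trans _ _ (lam * (\sum_k N k * m k)%N%:R)).
    rewrite -mulrBr ler_wpM2l // lerBlDr -natrD ler_nat //.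
  rewrite !natr_sum mulr_sumr; apply: ler_sum => k _.
  by rewrite !natrM mulrA ler_wpM2r.
have hE := @vol_le_seq R K pi _ n (enum {: I}) (fun i => Phi @` P i) (fun=> A)
  (fun i _ => hP i).
apply: vol_le_sub hE.
  move=> _ [w wS <-]; have [w1 hw] := wS.
  have [[k wk]|nk] := pselect (exists k, absv (crd w k) <= rho ^+ s).
    by exists (inl k); [rewrite mem_enum|exists w].
  have hm k : exists m : 'I_s, absv (crd w k) = rho ^+ m.
    have wk : rho ^+ s < absv (crd w k).
      by rewrite ltNge; apply/negP => h; apply: nk; exists k.
    have [||m mE] := absv_rhoX pi_unif (x := crd w k).
    - by rewrite -absv_gt0; apply: lt_trans wk.
    - exact: w1.
    have ms : (m < s)%N by rewrite ltnNge -lrX -mE -ltNge.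
    by exists (Ordinal ms).
  have [m mE] := choice hm.
  exists (inr [ffun k => m k]); first by rewrite mem_enum.
  by exists w => //; split => //; split=> // k; rewrite ffunE.
rewrite big_const_seq count_predT iter_addr_0 -cardT card_sum card_ord.
rewrite card_ffun !card_ord -[X in X <= _]mulr_natl /A.
set x := q%:R `^ (lam * C%:R) in A0 *; set y := q%:R `^ (- _) in A0 *.
rewrite (_ : _ * x * _ * y = ((p + L ^ p)%:R * j.+1%:R ^+ n) * (x * y)); last by ring.
rewrite ler_wpM2r // -natrX -natrM ler_nat.
(* There are [(L * j) ^ p] shells; [p <= n] turns this into a bound with exponent [n], common to all
   points of the manifold. *)
have j1 : (j ^ p <= j.+1 ^ n)%N.
  apply: (@leq_trans (j.+1 ^ p)); first by have [->|p0] := posnP p; rewrite ?expn0 ?leq_exp2r.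
  by rewrite leq_pexp2l.
have j2 : (0 < j.+1 ^ n)%N by rewrite expn_gt0.
rewrite /s expnMn; nia.
Qed.

End NormalizedMap.

(** * Differentiability of analytic functions *)

Section Differentiability.
Context {R : realType} (K : ultrametricFieldType R).
Context (pi : K) (pi_unif : is_uniformizer pi) (cK : compact (unit_ball K)).

Local Notation rho := (absv pi).
Let rX0 := rhoX_gt0 pi_unif.

Definition dot n (x y : 'rV[K]_n) : K := \sum_i x 0 i * y 0 i.

Lemma absv_dot n (x y : 'rV[K]_n) r t : 0 <= r -> 0 <= t ->
  mxle x r -> mxle y t -> absv (dot x y) <= r * t.
Proof.
move=> r0 t0 hx hy; apply: absv_sum => [|i _]; first exact: mulr_ge0.
by rewrite absvM ler_pM ?absv_ge0.
Qed.

Lemma dotDr n (x y z : 'rV[K]_n) : dot x (y + z) = dot x y + dot x z.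
Proof. by rewrite -big_split; apply: eq_bigr => i _; rewrite mxE mulrDr. Qed.

Lemma dotZr n a (x y : 'rV[K]_n) : dot x (a *: y) = a * dot x y.
Proof. by rewrite mulr_sumr; apply: eq_bigr => i _; rewrite mxE mulrCA. Qed.

Lemma dot0r n (x : 'rV[K]_n) : dot x 0 = 0.
Proof. by rewrite /dot big1 // => i _; rewrite mxE mulr0. Qed.

Lemma dotBr n (x y z : 'rV[K]_n) : dot x (y - z) = dot x y - dot x z.
Proof. by rewrite -scaleN1r dotDr dotZr mulN1r. Qed.

Lemma dot_sumr (I : Type) (s : seq I) n (x : 'rV[K]_n) (g : I -> 'rV[K]_n) :
  dot x (\sum_(i <- s) g i) = \sum_(i <- s) dot x (g i).
Proof.
elim: s => [|i s IHs]; first by rewrite !big_nil dot0r.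
by rewrite !big_cons dotDr IHs.
Qed.

Definition int_diff n (g : 'rV[K]_n -> K) (D : 'rV[K]_n -> 'rV[K]_n) : Prop :=
  forall u, mxle u 1 -> [/\ absv (g u) <= 1, mxle (D u) 1 &
    forall v r, 0 <= r <= 1 -> mxle v r ->
      absv (g (u + v) - g u - dot v (D u)) <= r ^+ 2].

Lemma int_diff_ext n (g g' : 'rV[K]_n -> K) D : g =1 g' -> int_diff g D -> int_diff g' D.
Proof. by move=> gg' h u /h [h1 h2 h3]; split=> //; rewrite -?gg' // => *; rewrite -!gg' h3. Qed.

Lemma int_diff_coord n (i : 'I_n) : exists D, int_diff (fun u : 'rV[K]_n => u 0 i) D.
Proof.
exists (fun=> delta_mx 0 i) => u u1; split=> [|k j|v r _ _]; first exact: u1.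
  by rewrite mxE; case: andP; rewrite ?absv1 // absv0.
have -> : dot v (delta_mx 0 i) = v 0 i.
  rewrite /dot (bigD1 i) //= big1 ?addr0 => [|j ji]; first by rewrite mxE !eqxx mulr1.
  by rewrite mxE (negPf ji) andbF mulr0.
by rewrite mxE (_ : _ - _ - _ = 0) ?absv0 ?exprn_even_ge0 //; ring.
Qed.

Lemma int_diff1 n : int_diff (fun=> 1 : K) (fun=> 0 : 'rV[K]_n).
Proof.
move=> u _; split=> [||v r _ _]; first by rewrite absv1.
  exact: mxle0.
by rewrite dot0r subr0 subrr absv0 exprn_even_ge0.
Qed.

Lemma int_diffM n (g1 g2 : 'rV[K]_n -> K) D1 D2 : int_diff g1 D1 -> int_diff g2 D2 ->
  int_diff (fun u => g1 u * g2 u) (fun u => g1 u *: D2 u + g2 u *: D1 u).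
Proof.
move=> h1 h2 u u1; have [a1 d1 e1] := h1 u u1; have [a2 d2 e2] := h2 u u1.
split=> [||v r /andP[r0 r1] vr].
- by rewrite absvM mulr_ile1 ?absv_ge0.
- by apply: mxleD; rewrite -[1]mulr1; exact: mxleZ.
have r01 : 0 <= r <= 1 by rewrite r0.
have uv1 : mxle (u + v) 1 by apply: mxleD => //; exact: mxle_trans vr r1.
have [a1' _ _] := h1 _ uv1; have [a2' _ _] := h2 _ uv1.
have {}e1 := e1 v r r01 vr; have {}e2 := e2 v r r01 vr.
have l1 : absv (dot v (D1 u)) <= r by rewrite -[r]mulr1; exact: absv_dot.
have l2 : absv (dot v (D2 u)) <= r by rewrite -[r]mulr1; exact: absv_dot.
rewrite dotDr !dotZr.
set x1 := dot v (D1 u) in e1 l1 *; set x2 := dot v (D2 u) in e2 l2 *.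
have -> : g1 (u + v) * g2 (u + v) - g1 u * g2 u - (g1 u * x2 + g2 u * x1)
   = (g1 (u + v) - g1 u - x1) * g2 (u + v) + x1 * x2
     + (g2 (u + v) - g2 u - x2) * (g1 u + x1) by ring.
rewrite expr2 in e1 e2 *; apply: absvD_le; first apply: absvD_le.
- by rewrite absvM -[leRHS]mulr1 ler_pM ?absv_ge0.
- by rewrite absvM ler_pM ?absv_ge0.
rewrite absvM -[leRHS]mulr1 ler_pM ?absv_ge0 //.
by apply: absvD_le => //; exact: le_trans l1 r1.
Qed.

(** The constants do not depend on the exponents, so the estimate passes to sums of monomials with
    bounded coefficients. *)
Lemma int_diff_monomial n (m : 'I_n -> nat) :
  exists D, int_diff (fun u : 'rV[K]_n => \prod_i u 0 i ^+ m i) D.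
Proof.
have hX i k : exists D, int_diff (fun u : 'rV[K]_n => u 0 i ^+ k) D.
  elim: k => [|k [D hD]]; first by exists (fun=> 0); exact: int_diff1.
  have [D1 h1] := int_diff_coord i.
  exists (fun u : 'rV[K]_n => u 0 i *: D u + (u 0 i ^+ k) *: D1 u).
  by apply: int_diff_ext (int_diffM h1 hD) => u; rewrite exprS.
elim: (index_enum _) => [|i s [D hD]].
  exists (fun=> 0); apply: int_diff_ext (@int_diff1 n) => u.
  by rewrite big_nil.
have [D1 h1] := hX i (m i).
by eexists; apply: int_diff_ext (int_diffM h1 hD) => u; rewrite big_cons.
Qed.

(** Outside one finite set a term is the difference of two partial sums both within 1 of [s]. *)
Lemma has_sum_bounded (I : choiceType) (u : I -> K) s : has_sum u s ->
  exists B : R, forall i, absv (u i) <= B.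
Proof.
move=> hu; have [|F0 hF] := hu [set x | absv (s - x) < 1].
  by apply/nbhs_absvP; exists 1.
exists (1 + \sum_(i <- F0) absv (u i)) => i.
have B0 (t : seq I) : 0 <= \sum_(j <- t) absv (u j) by apply: sumr_ge0 => *; exact: absv_ge0.
have [iF|iF] := boolP (i \in F0).
  by rewrite (big_fsetD1 i) //= addrCA lerDl addr_ge0.
have h1 := hF F0 (fsubset_refl _); have h2 := hF (i |` F0)%fset (fsubsetU1 _ _).
have -> : u i = (s - \sum_(j <- F0) u j) - (s - \sum_(j <- (i |` F0)%fset) u j).
  rewrite big_fsetU1 //=; by ring.
apply: (@le_trans _ _ 1); last by rewrite lerDl.
exact/ltW/absvB_lt.
Qed.

Lemma large_elt (B : R) : exists2 b : K, b != 0 & B <= absv b.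
Proof.
have B0 : 0 < (1 + `|B|)^-1 by rewrite invr_gt0 ltr_pwDl.
have [|k hk] := @exp_small R rho (1 + `|B|)^-1 _ B0.
  by rewrite absv_ge0 (rho_lt1 pi_unif).
have pk : pi ^- k != 0 by rewrite invr_eq0 expf_neq0 ?(unif_neq0 pi_unif).
exists (pi ^- k) => //; rewrite absvV absvX; apply: (@le_trans _ _ (1 + `|B|)).
  by rewrite (le_trans (ler_norm _)) // lerDr.
by rewrite -[leLHS]invrK lef_pV2 ?posrE ?invr_gt0 ?ltr_pwDl // ltW.
Qed.

(* The derivative of the sum is a cluster point of the derivatives of the
   partial sums. *)
Lemma power_series_diff n (C : {ffun 'I_n -> nat} -> K) (G : 'rV[K]_n -> K) (b : K) :
  b != 0 -> (forall m, absv (C m) <= absv b) ->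
  (forall u, mxle u 1 -> has_sum (fun m => C m * \prod_i u 0 i ^+ m i) (G u)) ->
  forall u, mxle u 1 -> exists2 D : 'rV[K]_n, mxle D (absv b) &
    forall v r, 0 <= r <= 1 -> mxle v r ->
      absv (G (u + v) - G u - dot v D) <= absv b * r ^+ 2.
Proof.
move=> b0 Cb hG u u1; have [Dm hDm] := choice (fun m : {ffun 'I_n -> nat} => int_diff_monomial m).
have ab0 : 0 < absv b by rewrite absv_gt0.
(* The filter along which unordered sums converge: finite sets of exponents ordered by inclusion. *)
pose PF := filter_from [set: {fset {ffun 'I_n -> nat}}]
  (fun A => [set B | (A `<=` B)%fset]).
have pPF : ProperFilter PF.
  apply: filter_from_proper; last by move=> A _; exists A => /=.
  apply: filter_from_filter; first by exists fset0.
  move=> A B _ _; exists (A `|` B)%fset => // X /= ABX.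
  by split; apply: fsubset_trans ABX; rewrite ?fsubsetUl ?fsubsetUr.
(* Derivatives of the partial sums, divided by [b] so that they all lie in the compact unit ball.
   The cluster point is taken before [v] and [r], so one derivative serves every increment. *)
pose DS (X : {fset {ffun 'I_n -> nat}}) : 'rV[K]_n := \sum_(m <- X) (C m / b) *: Dm m u.
have DS1 X : mxle (DS X) 1.
  rewrite /DS; elim: (X : seq _) => [|m s IHs].
    by rewrite big_nil; exact: mxle0.
  rewrite big_cons; apply: mxleD => //; rewrite -[1]mulr1; apply: mxleZ.
    by rewrite absvM absvV ler_pdivrMr // mul1r.
  by have [] := hDm m u u1.
have cP : compact [set h : 'rV[K]_n | forall i, unit_ball K (h 0 i)].
  exact: rV_compact_all.
have [|E [E1 cE]] := cP (DS @ PF) _.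
  by exists fset0 => // X _ i; exact: DS1.
exists (b *: E) => [|v r r01 vr].
  by rewrite -[absv b]mulr1; apply: mxleZ => // i j; rewrite ord1; exact: E1.
have /andP[r0 r1] := r01.
have uv1 : mxle (u + v) 1 by apply: mxleD => //; exact: mxle_trans vr r1.
(* If [X] were too large, a finite set [Y] of exponents would approximate both values of [G] and the
   derivative to accuracy better than [absv X], while the error of the finite sum is itself below
   [absv X]; the ultrametric inequality then gives [absv X < absv X]. *)
set X := G (u + v) - G u - dot v (b *: E).
rewrite leNgt; apply/negP => hX.
have X0 : 0 < absv X by apply: le_lt_trans hX; rewrite mulr_ge0 ?exprn_ge0 ?absv_ge0.
have nb w : nbhs (G w) [set x | absv (G w - x) < absv X] by apply/nbhs_absvP; exists (absv X).
have [A1 hA1] := hG _ uv1 _ (nb _); have [A2 hA2] := hG _ u1 _ (nb _).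
have nE : nbhs E [set x : 'rV[K]_n | forall i, absv (E 0 i - x 0 i) < absv X / absv b].
  by apply/nbhs_rVP; exists (absv X / absv b); rewrite ?divr_gt0.
have FA : (DS @ PF) [set DS Y | Y in [set Y | (A1 `|` A2 `<=` Y)%fset]].
  by exists (A1 `|` A2)%fset => // Y AY; exists Y.
have [_ [[Y AY <-] /= hE]] := cE _ _ FA nE.
have h1 := hA1 Y (fsubset_trans (fsubsetUl _ _) AY).
have h2 := hA2 Y (fsubset_trans (fsubsetUr _ _) AY).
rewrite /= in h1 h2; set S1 := bigop.body _ _ _ in h1; set S2 := bigop.body _ _ _ in h2.
have h3 : absv (S1 - S2 - dot v (b *: DS Y)) < absv X.
  apply: le_lt_trans hX.
  have -> : S1 - S2 - dot v (b *: DS Y) =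
      \sum_(m <- Y) C m * (\prod_i (u + v) 0 i ^+ m i - \prod_i u 0 i ^+ m i - dot v (Dm m u)).
    rewrite dotZr dot_sumr mulr_sumr -!sumrB; apply: eq_bigr => m _.
    by rewrite dotZr mulrA mulrCA mulfV // mulr1 -!mulrBr.
  apply: absv_sum => [|m _]; first by rewrite mulr_ge0 ?exprn_ge0 ?absv_ge0.
  rewrite absvM ler_pM ?absv_ge0 //.
  by have [_ _] := hDm m u u1; apply.
have h4 : absv (dot v (b *: (E - DS Y))) < absv X.
  have [->|/exists_maxabs [i Ei hi]] := eqVneq (E - DS Y) 0.
    by rewrite scaler0 dot0r absv0.
  rewrite dotZr absvM mulrC -ltr_pdivlMr //.
  have hEi : absv ((E - DS Y) 0 i) < absv X / absv b by rewrite !mxE.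
  apply: le_lt_trans hEi; rewrite -[leRHS]mul1r; apply: absv_dot; rewrite ?absv_ge0 //.
    exact: mxle_trans vr r1.
  by move=> j k; rewrite ord1.
suff : absv X < absv X by rewrite ltxx.
have {1}-> : X = (G (u + v) - S1) - (G u - S2) + (S1 - S2 - dot v (b *: DS Y))
    - dot v (b *: (E - DS Y)).
  by rewrite /X scalerBr dotBr; ring.
by apply: absvB_lt => //; apply: absvD_lt => //; exact: absvB_lt.
Qed.

Lemma analytic_at_diff n (g : 'rV[K]_n -> K) (a : 'rV[K]_n) : analytic_at g a ->
  exists (e B : R) (D : 'rV[K]_n -> 'rV[K]_n), [/\ 0 < e <= 1, 1 <= B &
    forall y, mxle (y - a) e -> mxle (D y) B /\
      forall h r, 0 <= r <= e -> mxle h r ->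
        absv (g (y + h) - g y - dot h (D y)) <= B * r ^+ 2].
Proof.
move=> [c /nbhs_rVP[e e0 hc]].
have [|t te] := @exp_small R rho e _ e0; first by rewrite absv_ge0 (rho_lt1 pi_unif).
have pt0 : pi ^+ t != 0 by rewrite expf_neq0 ?(unif_neq0 pi_unif).
pose C (m : {ffun 'I_n -> nat}) := c m * \prod_i (pi ^+ t) ^+ m i.
pose G (w : 'rV[K]_n) := g (a + pi ^+ t *: w).
have hG w : mxle w 1 -> has_sum (fun m => C m * \prod_i w 0 i ^+ m i) (G w).
  move=> w1; have -> : (fun m : {ffun 'I_n -> nat} => C m * \prod_i w 0 i ^+ m i) =
      (fun m => c m * \prod_i ((a + pi ^+ t *: w) 0 i - a 0 i) ^+ m i).
    apply/funext => m; rewrite /C -mulrA -big_split /=; congr (_ * _).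
    by apply: eq_bigr => i _; rewrite !mxE addrC addKr exprMn.
  apply: hc => i; rewrite !mxE opprD addNKr absvN absvM absvX.
  by apply: le_lt_trans te; rewrite ler_piMr ?exprn_ge0 ?absv_ge0.
(* At the all-ones point every monomial equals 1, so bounded terms mean bounded rescaled
   coefficients. *)
have one1 : mxle (const_mx 1 : 'rV[K]_n) 1 by move=> i j; rewrite mxE absv1.
have [B0 hB0] := has_sum_bounded (hG _ one1).
have [b b0 Bb] := large_elt B0.
have Cb m : absv (C m) <= absv b.
  apply: le_trans Bb; have := hB0 m.
  by rewrite big1 ?mulr1 // => i _; rewrite mxE expr1n.
have h0 w : exists D : 'rV[K]_n, mxle w 1 -> mxle D (absv b) /\
    forall v r, 0 <= r <= 1 -> mxle v r ->
      absv (G (w + v) - G w - dot v D) <= absv b * r ^+ 2.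
  have [w1|] := pselect (mxle w 1); last by exists 0.
  by have [D D1 D2] := power_series_diff b0 Cb hG w1; exists D.
have [D hD] := choice h0.
have re : 0 < rho ^+ t by exact: rX0.
have rt1 : 1 <= rho ^- t by rewrite invf_ge1 // (rhoX_le1 pi_unif).
(* Undoing the substitution [y = a + pi ^+ t *: w] turns the error [absv b * (r / rho ^+ t) ^+ 2]
   into two factors [rho ^- t]; adding 1 ensures [1 <= B]. *)
pose B := (1 + absv b) * rho ^- t * rho ^- t.
have b1 : absv b <= 1 + absv b by rewrite lerDr.
have bB : absv b * rho ^- t <= B.
  have z0 : 0 <= rho ^- t by rewrite invr_ge0 ltW.
  rewrite /B -mulrA; apply: ler_pM => //; first exact: absv_ge0.
  exact: ler_peMl.
exists (rho ^+ t), B, (fun y => pi ^- t *: D (pi ^- t *: (y - a))).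
have B1 : 1 <= B.
  by rewrite /B !mulr_ege1 // lerDl absv_ge0.
split=> //; first by rewrite re (rhoX_le1 pi_unif).
move=> y ya; set w := pi ^- t *: (y - a).
have w1 : mxle w 1.
  rewrite -(@mulVf _ (rho ^+ t)) ?gt_eqF //; apply: mxleZ => //.
  by rewrite absvV absvX.
have yE : y = a + pi ^+ t *: w by rewrite scalerA mulfV // scale1r addrC subrK.
have [D1 D2] := hD w w1; split.
  by apply: mxle_trans bB; rewrite mulrC; apply: mxleZ => //; rewrite absvV absvX.
move=> h r /andP[r0 re'] hr; pose v := pi ^- t *: h.
have hE : h = pi ^+ t *: v by rewrite scalerA mulfV // scale1r.
have vr : mxle v (r / rho ^+ t).
  by rewrite mulrC; apply: mxleZ => //; rewrite absvV absvX.
have := D2 v (r / rho ^+ t) _ vr; rewrite divr_ge0 ?ler_pdivrMr ?mul1r ?(ltW re) // => /(_ re').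
rewrite /G scalerDr addrA -yE -hE dotZr.
have -> : dot v (D w) = pi ^- t * dot h (D w).
  by rewrite /dot mulr_sumr; apply: eq_bigr => i _; rewrite mxE mulrA.
move=> /le_trans; apply; rewrite expr_div_n expr2 [X in _ / X]expr2 invfM.
rewrite /B; set x := absv b in b1 *; set z := _^-1 in rt1 *.
rewrite (_ : x * (r * r * (z * z)) = x * (z * z * (r * r))); last by ring.
rewrite (_ : (1 + x) * z * z * (r * r) = (1 + x) * (z * z * (r * r))); last by ring.
by rewrite ler_wpM2r // !mulr_ge0 // (le_trans _ rt1).
Qed.

(* A composite of [C11] maps is [C11], so that changes of charts can be handled
   without composing power series. *)
Definition C11 n m (u : 'rV[K]_n -> 'rV[K]_m) (a : 'rV[K]_n) : Prop :=
  exists (e B : R) (D : 'rV[K]_n -> 'M[K]_(n, m)), [/\ 0 < e <= 1, 1 <= B &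
    forall y, mxle (y - a) e -> mxle (D y) B /\
      forall h r, 0 <= r <= e -> mxle h r ->
        mxle (u (y + h) - u y - h *m D y) (B * r ^+ 2)].

Lemma analytic_C11 n m (u : 'rV[K]_n -> 'rV[K]_m) (a : 'rV[K]_n) :
  (forall i, analytic_at (fun y => u y 0 i) a) -> C11 u a.
Proof.
move=> /(fun h i => analytic_at_diff (h i)) /choice[e /choice[B /choice[D hD]]].
have [E E0 hE] := finite_bound (fun i => (e i)^-1).
have [B' B'0 hB'] := finite_bound B.
have e0 i : 0 < e i by have [/andP[]] := hD i.
exists (1 + E)^-1, (1 + B'), (fun y => \matrix_(j, i) D i y 0 j).
have eE i : (1 + E)^-1 <= e i.
  rewrite -[leRHS]invrK lef_pV2 ?posrE ?invr_gt0 ?addr_gt0 //.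
  by apply: le_trans (hE i) _; rewrite lerDr.
have BB i : B i <= 1 + B' by apply: le_trans (hB' i) _; rewrite lerDr.
split=> [||y ya].
- by rewrite invr_gt0 addr_gt0 //= invf_le1 ?addr_gt0 // lerDl ltW.
- by rewrite lerDl ltW.
split=> [j i|h r /andP[r0 re] hr j i].
  have [_ _ /(_ y)] := hD i; rewrite mxE => -[|H _]; first exact: mxle_trans ya (eE i).
  exact: le_trans (H 0 j) (BB i).
have [_ _ /(_ y)] := hD i => -[|_ H]; first exact: mxle_trans ya (eE i).
have := H h r _ hr; rewrite r0 (le_trans re (eE i)) => /(_ isT) H'.
rewrite ord1 !mxE; have -> : \sum_k h 0 k * (\matrix_(j, i) D i y 0 j) k i = dot h (D i y).
  by apply: eq_bigr => k _; rewrite mxE.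
by apply: le_trans H' _; rewrite ler_wpM2r ?exprn_ge0.
Qed.

Lemma C11_comp n m p (u : 'rV[K]_n -> 'rV[K]_m) (g : 'rV[K]_m -> 'rV[K]_p) a :
  C11 u a -> C11 g (u a) -> C11 (g \o u) a.
Proof.
move=> [e1 [B1 [D1 [/andP[e10 e11] B11 h1]]]] [e2 [B2 [D2 [/andP[e20 e21] B21 h2]]]].
have B10 : 0 < B1 by apply: lt_le_trans B11.
have B20 : 0 < B2 by apply: lt_le_trans B21.
(* [u] turns a step [r] into one of size at most [B1 * r], whence the radius. [B2 * B1 ^+ 2]
   dominates the outer quadratic error and also the inner one multiplied by a derivative of size
   [B2]. *)
exists (Num.min e1 (e2 / B1)), (B2 * B1 ^+ 2), (fun y => D1 y *m D2 (u y)).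
have BB : B1 * B2 <= B2 * B1 ^+ 2.
  by rewrite mulrC ler_pM2l // expr2 ler_peMl // ltW.
split.
- by rewrite lt_min e10 divr_gt0 //= ge_min e11.
- by rewrite mulr_ege1 // expr2 mulr_ege1.
have lip y h r : mxle (y - a) e1 -> 0 <= r <= e1 -> mxle h r ->
    mxle (u (y + h) - u y) (B1 * r).
  move=> ya /andP[r0 re] hr; have [D1y /(_ h r)] := h1 y ya.
  rewrite r0 re => /(_ isT hr) H; rewrite -(subrK (h *m D1 y) (_ - _)).
  apply: mxleD; last by rewrite mulrC; apply: mxleM => //; exact: ltW.
  apply: mxle_trans H _; rewrite ler_pM2l // expr2 ler_piMl //.
  by rewrite (le_trans re).
move=> y; set e := Num.min _ _ => ya.
have ee1 : e <= e1 by rewrite ge_min lexx.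
have ee2 : B1 * e <= e2 by rewrite mulrC -ler_pdivlMr // ge_min lexx orbT.
have e0 : 0 <= e by rewrite le_min (ltW e10) divr_ge0 // ltW.
have ya1 : mxle (y - a) e1 by exact: mxle_trans ya ee1.
have uya : mxle (u y - u a) e2.
  apply: mxle_trans ee2; have := @lip a (y - a) e; rewrite [a + (y - a)]addrC subrK.
  by apply=> //; rewrite ?e0 // subrr; apply: mxle0; exact: ltW.
have [D1y H1] := h1 y ya1; have [D2y H2] := h2 (u y) uya.
split=> [|h r /andP[r0 re] hr].
  by apply: mxle_trans BB; apply: mxleM => //; exact: ltW.
have r1 : 0 <= r <= e1 by rewrite r0 (le_trans re).
pose k := u (y + h) - u y.
have kr : mxle k (B1 * r) by exact: lip.
have r2 : 0 <= B1 * r <= e2.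
  by rewrite mulr_ge0 ?(ltW B10) //=; apply: le_trans ee2; rewrite ler_pM2l.
have -> : (g \o u) (y + h) - (g \o u) y - h *m (D1 y *m D2 (u y)) =
    (g (u y + k) - g (u y) - k *m D2 (u y)) + (k - h *m D1 y) *m D2 (u y).
  have kE : u y + k = u (y + h) by rewrite /k addrC subrK.
  clearbody k; rewrite mulmxBl mulmxA kE /=.
  move: (k *m _) (h *m D1 y *m _) (g _) (g _) => *.
  by apply/matrixP => ? ?; rewrite !mxE; ring.
apply: mxleD.
  by apply: mxle_trans (H2 _ _ r2 kr) _; rewrite exprMn mulrA.
apply: (@mxle_trans _ _ _ _ _ (B1 * r ^+ 2 * B2)).
  apply: mxleM (H1 _ _ r1 hr) D2y; last exact: ltW.
  by rewrite mulr_ge0 ?exprn_ge0 // ltW.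
by rewrite mulrAC ler_wpM2r ?exprn_ge0.
Qed.

Lemma C11_near n m (u u' : 'rV[K]_n -> 'rV[K]_m) a :
  (\forall y \near a, u y = u' y) -> C11 u a -> C11 u' a.
Proof.
move=> /nbhs_rVP[d d0 hd] [e [B [D [/andP[e0 e1] B1 h]]]].
pose e' := Num.min e (d / 2); have d20 : 0 < d / 2 by rewrite divr_gt0.
have e'd : e' < d by rewrite gt_min orbC ltr_pdivrMr // ltr_pMr // ltr1n.
have e'e : e' <= e by rewrite ge_min lexx.
have uE y : mxle (y - a) e' -> u y = u' y.
  move=> ya; apply: hd => i; rewrite absv_distC; have := ya 0 i; rewrite !mxE => H.
  exact: le_lt_trans H e'd.
exists e', B, D; split=> [||y ya].
- by rewrite lt_min e0 d20 /= (le_trans e'e).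
- by [].
have [Dy H] := h y (mxle_trans ya e'e); split=> // k r /andP[r0 re] kr.
have yka : mxle (y + k - a) e'.
  by rewrite addrAC; apply: mxleD => //; exact: mxle_trans kr re.
rewrite -(uE y ya) -(uE _ yka).
by apply: H => //; rewrite r0 (le_trans re).
Qed.

Lemma C11_continuous n m (u : 'rV[K]_n -> 'rV[K]_m) a : C11 u a ->
  forall e : R, 0 < e -> \forall y \near a, mxle (u y - u a) e.
Proof.
move=> [e1 [B [D [/andP[e10 e11] B1 h]]]] e e0.
have B0 : 0 < B by apply: lt_le_trans B1.
pose r := Num.min e1 (e / B); have r0 : 0 < r by rewrite lt_min e10 divr_gt0.
have re1 : r <= e1 by rewrite ge_min lexx.
have rB : B * r <= e by rewrite mulrC -ler_pdivlMr // ge_min lexx orbT.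
apply/nbhs_rVP; exists r => // y ya.
have hr : mxle (y - a) r.
  by move=> i j; rewrite ord1 !mxE absv_distC ltW.
have aa : mxle (a - a) e1 by rewrite subrr; apply: mxle0; exact: ltW.
have [Da /(_ (y - a) r)] := h a aa.
rewrite (ltW r0) re1 => /(_ isT hr); rewrite [a + _]addrC subrK => H.
rewrite -(subrK ((y - a) *m D a) (_ - _)); apply: mxle_trans rB; apply: mxleD.
  apply: mxle_trans H _; rewrite ler_pM2l // expr2 ler_piMl ?(ltW r0) //.
  exact: le_trans re1 e11.
by rewrite mulrC; apply: mxleM => //; exact: ltW.
Qed.

(** [partial] selects a limit with [xget], so [d] has to be shown to be a limit and the only one. *)
Lemma partial_unique n (g : 'rV[K]_n -> K) (j : 'I_n) (a : 'rV[K]_n) (d : K) (e B : R) :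
  0 < e -> 0 <= B ->
  (forall t, absv t <= e ->
    absv (g (a + t *: delta_mx 0 j) - g a - t * d) <= B * absv t ^+ 2) ->
  partial g j a = d.
Proof.
move=> e0 B0 h.
pose Q := fun d : K => (g (a + t *: delta_mx 0 j) - g a) / t @[t --> (0 : K)^'] --> d.
have Qd : Q d.
  move=> A /nbhs_absvP[r r0 hA].
  pose s := Num.min e (r / (1 + B)); have B10 : 0 < 1 + B by rewrite ltr_pwDl.
  have s0 : 0 < s by rewrite lt_min e0 divr_gt0.
  apply/nbhs_absvP; exists s => // t; rewrite sub0r absvN => ts t0; apply: hA.
  have at0 : 0 < absv t by rewrite absv_gt0.
  have te : absv t <= e by apply/ltW/(lt_le_trans ts); rewrite ge_min lexx.
  rewrite absv_distC -[d](mulfK t0) -mulrBl absvM absvV ltr_pdivrMr // [d * t]mulrC.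
  apply: le_lt_trans (h t te) _; rewrite expr2 mulrA ltr_pM2r //.
  have : absv t < r / (1 + B) by apply: lt_le_trans ts _; rewrite ge_min lexx orbT.
  rewrite ltr_pdivlMr // => H; apply: le_lt_trans H.
  by rewrite mulrDr mulr1 mulrC lerDr absv_ge0.
(* Two limits are compared along [t = pi ^+ k], which is nonzero and arbitrarily small. *)
have uniq d' : Q d' -> d' = d.
  move=> Qd'; apply/eqP; rewrite -subr_eq0 -absv_eq0 eq_le absv_ge0 andbT leNgt.
  apply/negP => dd.
  have /Qd /nbhs_absvP[r1 r10 H1] : nbhs d [set x | absv (d - x) < absv (d' - d)].
    by apply/nbhs_absvP; exists (absv (d' - d)).
  have /Qd' /nbhs_absvP[r2 r20 H2] : nbhs d' [set x | absv (d' - x) < absv (d' - d)].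
    by apply/nbhs_absvP; exists (absv (d' - d)).
  have m0 : 0 < Num.min r1 r2 by rewrite lt_min r10.
  have [|k] := @exp_small R rho _ _ m0; first by rewrite absv_ge0 (rho_lt1 pi_unif).
  rewrite lt_min => /andP[k1 k2].
  have pk : pi ^+ k != 0 by rewrite expf_neq0 ?(unif_neq0 pi_unif).
  have := H1 (pi ^+ k); rewrite sub0r absvN absvX => /(_ k1 pk) /= E1.
  have := H2 (pi ^+ k); rewrite sub0r absvN absvX => /(_ k2 pk) /= E2.
  set x := _ / _ in E1 E2.
  have : absv (d' - d) < absv (d' - d).
    rewrite -{1}(subrK x d') -addrA; apply: absvD_lt => //.
    by rewrite (absv_distC x).
  by rewrite ltxx.
exact: uniq (@xgetPex _ 0 Q (ex_intro _ d Qd)).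
Qed.

End Differentiability.

(** * Local models of a log-principalization *)

Section LocalModel.
Local Notation coord := Defs.coord.
Local Notation dom := Defs.dom.
Local Notation codom := Defs.codom.
Local Notation jacobian := Defs.jacobian.
Context {R : realType} (K : ultrametricFieldType R).
Context (pi : K) (pi_unif : is_uniformizer pi) (cK : compact (unit_ball K)).

Local Notation rho := (absv pi).
Let rX0 := rhoX_gt0 pi_unif.

Lemma analytic_at_cst n (c : K) (a : 'rV[K]_n) : analytic_at (fun=> c) a.
Proof.
pose m0 : {ffun 'I_n -> nat} := [ffun=> 0%N].
exists (fun m => if m == m0 then c else 0); apply/nbhs_rVP; exists 1 => // x _ A.
move=> /nbhs_singleton Ac; exists [fset m0]%fset => G sG.
rewrite (big_fsetD1 m0) /=; last by apply: (fsubsetP sG); rewrite inE.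
rewrite eqxx big1 => [|i _]; last by rewrite ffunE expr0.
rewrite mulr1 big_seq big1 ?addr0 // => m.
by rewrite !inE => /andP[/negPf -> _]; rewrite mul0r.
Qed.

Lemma analytic_fun_cst n (M : manifold K n) (c : K) (b : M) :
  analytic_fun_at (fun=> c) b.
Proof. by move=> d _ _; exact: analytic_at_cst. Qed.

Lemma nbhs_param n (X : topologicalType) (c : chart K n X) (b : X) (P : set X) :
  dom c b -> nbhs b P -> nbhs (coord c b) (fun z => P (param c z)).
Proof.
move=> cb Pb; have := @param_cont _ _ _ _ c (coord c b) (coord_codom cb).
by apply; rewrite coordK.
Qed.

(** Analyticity is stated in atlas charts; the expansion is carried to an arbitrary local coordinate
    system through the change of charts and [C11_comp]. *)
Lemma analytic_C11_chart n m (M : manifold K n) (h : M -> 'rV[K]_m) (b : M)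
    (c : chart K n M) :
  (forall i, analytic_fun_at (fun y => h y 0 i) b) -> local_coordinates c ->
  dom c b -> C11 (h \o param c) (coord c b).
Proof.
move=> hb lc cb; have [d ad db] := atlas_cover b.
have hd : C11 (h \o param d) (coord d b).
  by apply: (analytic_C11 pi_unif cK) => i; exact: (hb i d ad db).
have cd : C11 (coord d \o param c) (coord c b).
  apply: (analytic_C11 pi_unif cK) => i; exact: (lc d ad b cb db i).1.
have hd' : C11 (h \o param d) ((coord d \o param c) (coord c b)).
  by rewrite /= coordK.
apply: (C11_near _ (C11_comp cd hd')).
have := nbhs_param cb (open_nbhs_nbhs (conj (dom_open d) db)).
apply: filterS => z dz /=; by rewrite coordK.
Qed.

Lemma analytic_fun_C11 n (M : manifold K n) (h : M -> K) (b : M)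
    (c : chart K n M) :
  analytic_fun_at h b -> local_coordinates c -> dom c b ->
  C11 (fun z => const_mx (h (param c z)) : 'rV[K]_1) (coord c b).
Proof.
move=> hb lc cb; apply: (@analytic_C11_chart n 1 M (fun x => const_mx (h x))) => // i d ad db.
have := hb d ad db; congr analytic_at; apply/funext => z /=; by rewrite mxE.
Qed.

Lemma analytic_fun_near n (M : manifold K n) (h : M -> K) (b : M)
    (c : chart K n M) (e : R) :
  analytic_fun_at h b -> local_coordinates c -> dom c b -> 0 < e ->
  \forall z \near coord c b, absv (h (param c z) - h b) <= e.
Proof.
move=> hb lc cb e0; have := C11_continuous (analytic_fun_C11 hb lc cb) e0.
by apply: filterS => z /(_ 0 0); rewrite !mxE coordK.
Qed.

(** An ultrametric absolute value is locally constant away from zero. *)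
Lemma germ_unit_near n (M : manifold K n) (h : M -> K) (b : M)
    (c : chart K n M) :
  germ_unit b h -> local_coordinates c -> dom c b ->
  \forall z \near coord c b, absv (h (param c z)) = absv (h b).
Proof.
move=> [hb hb0] lc cb; have h0 : 0 < absv (h b) / 2 by rewrite divr_gt0 // absv_gt0.
have := analytic_fun_near hb lc cb h0; apply: filterS => z hz.
have hz' : absv (h (param c z) - h b) < absv (h b).
  by apply: le_lt_trans hz _; rewrite ltr_pdivrMr // ltr_pMr ?absv_gt0 // ltr1n.
apply/eqP; rewrite eq_le; apply/andP; split.
  by rewrite -[X in absv X](subrK (h b)); apply: absvD_le => //; exact: ltW.
rewrite leNgt; apply/negP => lt.
have : absv (h b) < absv (h b).
  by rewrite -{1}(subKr (h (param c z)) (h b)); exact: absvB_lt.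
by rewrite ltxx.
Qed.

Lemma analytic_fun_bounded n (M : manifold K n) (h : M -> K) (b : M)
    (c : chart K n M) :
  analytic_fun_at h b -> local_coordinates c -> dom c b ->
  exists2 A : R, 0 < A & \forall z \near coord c b, absv (h (param c z)) <= A.
Proof.
move=> hb lc cb; exists (1 + absv (h b)); first by rewrite ltr_pwDl // absv_ge0.
have := analytic_fun_near hb lc cb ltr01; apply: filterS => z hz.
rewrite -[X in absv X](subrK (h b)); apply: absvD_le; last by rewrite lerDr.
by apply: le_trans hz _; rewrite lerDl absv_ge0.
Qed.

Lemma near_bounded_all n (I : finType) (z0 : 'rV[K]_n) (g : I -> 'rV[K]_n -> K) :
  (forall i, exists2 A : R, 0 < A & \forall z \near z0, absv (g i z) <= A) ->
  exists2 A : R, 0 < A & \forall z \near z0, forall i, absv (g i z) <= A.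
Proof.
move=> h; have h' i : exists A : R, \forall z \near z0, absv (g i z) <= A.
  by have [A _ hA] := h i; exists A.
have [A hA] := choice h'; have [B B0 hB] := finite_bound A.
exists B => //; apply: (@filter_forall _ I (fun i z => is_true (absv (g i z) <= B))
  (nbhs z0) (nbhs_filter z0)) => i.
have := hA i; apply: filterS => z hz.
exact: le_trans hz (hB i).
Qed.

End LocalModel.

Section LogData.
Local Notation coord := Defs.coord.
Local Notation dom := Defs.dom.
Local Notation codom := Defs.codom.
Local Notation jacobian := Defs.jacobian.
Context {R : realType} (K : ultrametricFieldType R).
Context (pi : K) (pi_unif : is_uniformizer pi) (cK : compact (unit_ball K)).

Local Notation rho := (absv pi).
Let rX0 := rhoX_gt0 pi_unif.

Context (n l : nat) (f : 'I_l -> mpoly.mpoly n (valring K)).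
Context (M : manifold K n) (sigma : M -> polydisc_manifold K n).
Context (T : finType) (E : T -> set M) (N v : T -> nat).
Hypothesis an_sigma : analytic_map sigma.

Let F (i : 'I_l) (x : M) : K := val (eval_at f i (sigma x)).
Let sg (x : M) : 'rV[K]_n := polydisc_coord (sigma x).

Lemma sigma_C11 (b : M) (c : chart K n M) : local_coordinates c -> dom c b ->
  C11 (fun z => sg (param c z)) (coord c b).
Proof.
move=> lc cb; apply: (@analytic_C11_chart _ _ _ pi_unif cK n n M sg) => // i d ad db.
by have [_ h] := an_sigma b; exact: (h (polydisc_chart K n) erefl I i d ad db).
Qed.

(** [D] multiplies row vectors from the right, so its rows are the directional derivatives, while
    [jacobian] has one row per component: hence the transpose. *)
Lemma jacobian_near (b : M) (c : chart K n M) e B (D : 'rV[K]_n -> 'M[K]_n) :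
  0 < e -> 1 <= B -> dom c b ->
  (forall y, mxle (y - coord c b) e -> mxle (D y) B /\
     forall h r, 0 <= r <= e -> mxle h r ->
       mxle (sg (param c (y + h)) - sg (param c y) - h *m D y) (B * r ^+ 2)) ->
  forall z, mxle (z - coord c b) e -> codom c z ->
    jacobian sigma c (param c z) = (D z)^T.
Proof.
move=> e0 B1 cb hD z ze cz; apply/matrixP => i j; rewrite !mxE paramK //.
apply: (partial_unique pi_unif e0 (le_trans ler01 B1)) => t te.
have [_ /(_ (t *: delta_mx 0 j) (absv t))] := hD z ze.
rewrite absv_ge0 te => /(_ isT) H.
have tt : mxle (t *: delta_mx 0 j : 'rV[K]_n) (absv t).
  move=> k m; rewrite !mxE; case: andP; rewrite ?mulr1 // mulr0 absv0 => _.
  exact: absv_ge0.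
have := H tt 0 i; rewrite -scalemxAl -rowE !mxE.
by [].
Qed.

(** Equality of the two germ ideals becomes a pair of inequalities, because analytic coefficients
    are bounded near [b] and units have constant absolute value there. *)
Lemma crossings_near (b : M) : normal_crossings f sigma E N v b ->
  exists (p : nat) (hp : (p <= n)%N) (e : 'I_p -> T) (c : chart K n M) (A eta : R),
  [/\ forall i, E i b <-> exists k, e k = i,
      local_coordinates c /\ dom c b,
      forall k, coord c b 0 (widen_ord hp k) = 0,
      0 < A /\ 0 < eta &
      \forall z \near coord c b, [/\ codom c z,
        absv (\det (jacobian sigma c (param c z))) =
          eta * \prod_(k < p) absv ((z : 'rV[K]_n) 0 (widen_ord hp k)) ^+ (v (e k)).-1,
        forall i, absv (F i (param c z)) <=
          A * \prod_(k < p) absv ((z : 'rV[K]_n) 0 (widen_ord hp k)) ^+ N (e k) &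
        forall r, 0 <= r -> (forall i, absv (F i (param c z)) <= r) ->
          \prod_(k < p) absv ((z : 'rV[K]_n) 0 (widen_ord hp k)) ^+ N (e k) <= A * r]].
Proof.
move=> [p [hp [e [c [eps [eta]]]]]] /= [[_ eE lc cb] [ueps ueta] hE hI hJ].
have [aeps eps0] := ueps; have [aeta eta0] := ueta.
have Fin (i : 'I_l) : germ_ideal b (fun j x => val (eval_at f j (sigma x))) (F i).
  exists (fun j => fun=> (j == i)%:R); split=> [j|]; first exact: analytic_fun_cst.
  apply: nearW => y; rewrite (bigD1 i) //= eqxx mul1r big1 ?addr0 // => j /negPf ->.
  by rewrite mul0r.
have hup i : exists2 A : R, 0 < A & \forall z \near coord c b,
    absv (F i (param c z)) <=
    A * \prod_(k < p) absv (coord c (param c z) 0 (widen_ord hp k)) ^+ N (e k).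
  have := Fin i; rewrite hI => -[a [aa ha]].
  have [A A0 hA] := analytic_fun_bounded pi_unif cK (aa 0) lc cb.
  exists (A * absv (eps b)); first by rewrite mulr_gt0 ?absv_gt0.
  have := nbhs_param cb ha; have := germ_unit_near pi_unif cK ueps lc cb.
  apply: filterS3 hA => z h1 h2 ->; rewrite big_ord1 !absvM h2 absv_prod mulrA.
  rewrite (eq_bigr _ (fun k _ => absvX _ _)) ler_wpM2r ?prodr_ge0 //.
    by move=> k _; rewrite exprn_ge0 ?absv_ge0.
  by rewrite ler_wpM2r ?absv_ge0.
have [A1 A10 hA1] : exists2 A : R, 0 < A & \forall z \near coord c b, forall i,
    absv (F i (param c z)) <=
    A * \prod_(k < p) absv (coord c (param c z) 0 (widen_ord hp k)) ^+ N (e k).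
  have hup' i : exists A : R, \forall z \near coord c b,
    absv (F i (param c z)) <=
    A * \prod_(k < p) absv (coord c (param c z) 0 (widen_ord hp k)) ^+ N (e k).
    by have [A _ hA] := hup i; exists A.
  have [A hA] := choice hup'; have [B B0 hB] := finite_bound A.
  exists B => //.
  apply: (@filter_forall _ _ (fun i z => is_true (absv (F i (param c z)) <= B * _))
    (nbhs (coord c b)) (nbhs_filter _)) => i.
  have := hA i; apply: filterS => z hz; apply: le_trans hz _.
  by rewrite ler_wpM2r // prodr_ge0 // => k _; rewrite exprn_ge0 ?absv_ge0.
have [A2 A20 hA2] : exists2 A : R, 0 < A & \forall z \near coord c b,
    forall r, 0 <= r -> (forall i, absv (F i (param c z)) <= r) ->
    \prod_(k < p) absv (coord c (param c z) 0 (widen_ord hp k)) ^+ N (e k) <= A * r.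
  (* The monomial generator lies in its own ideal, hence is an analytic combination of the [F i]. *)
  have : germ_ideal b (fun (_ : 'I_1) x =>
      eps x * \prod_(k < p) coord c x 0 (widen_ord hp k) ^+ N (e k))
      (fun x => eps x * \prod_(k < p) coord c x 0 (widen_ord hp k) ^+ N (e k)).
    exists (fun _ => fun=> 1); split=> [j|]; first exact: analytic_fun_cst.
    by apply: nearW => y; rewrite big_ord1 mul1r.
  rewrite -hI => -[a [aa ha]].
  have [A A0 hA] := near_bounded_all (fun i => analytic_fun_bounded pi_unif cK (aa i) lc cb).
  exists (A / absv (eps b)); first by rewrite divr_gt0 ?absv_gt0.
  have := nbhs_param cb ha; have := germ_unit_near pi_unif cK ueps lc cb.
  apply: filterS3 hA => z h1 h2 h3 r r0 hr.
  have : absv (eps (param c z) * \prod_(k < p)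
      coord c (param c z) 0 (widen_ord hp k) ^+ N (e k)) <= A * r.
    rewrite h3; apply: absv_sum => [|i _]; first by rewrite mulr_ge0 // ltW.
    by rewrite absvM ler_pM ?absv_ge0 //; exact: hr.
  rewrite absvM h2 absv_prod (eq_bigr _ (fun k _ => absvX _ _)) mulrC.
  by rewrite -ler_pdivlMr ?absv_gt0 // mulrAC.
exists p, hp, e, c, (Num.max A1 A2), (absv (eta b)); split=> //.
- move=> k; have /(_ k) [h _] := nbhs_singleton hE; apply: h.
  by apply/eE; exists k.
- by rewrite lt_max A10 absv_gt0.
have cz : nbhs (coord c b) (codom c).
  by apply: open_nbhs_nbhs; split; [exact: codom_open|exact: coord_codom].
have nF := nbhs_filter (coord c b).
have H1 := @filterI _ _ nF _ _ cz (nbhs_param cb hJ).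
have H2 := @filterI _ _ nF _ _ H1 (germ_unit_near pi_unif cK ueta lc cb).
have := @filterI _ _ nF _ _ H2 (@filterI _ _ nF _ _ hA1 hA2).
apply: filterS => z [[[zc hj] heta] [h1 h2]].
rewrite paramK // in h1 h2 hj.
have P0 : 0 <= \prod_(k < p) absv ((z : 'rV[K]_n) 0 (widen_ord hp k)) ^+ N (e k).
  by rewrite prodr_ge0 // => k _; rewrite exprn_ge0 ?absv_ge0.
split=> // [|i|r r0 hr].
- rewrite hj absvM heta absv_prod; congr (_ * _); apply: eq_bigr => k _.
  by rewrite absvX.
- by apply: le_trans (h1 i) _; rewrite ler_wpM2r // le_max lexx.
- by apply: le_trans (h2 r r0 hr) _; rewrite ler_wpM2r // le_max lexx orbT.
Qed.

Lemma local_model (b : M) : normal_crossings f sigma E N v b ->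
  exists (p : nat) (hp : (p <= n)%N) (e : 'I_p -> T) (xi : 'rV[K]_n -> M)
    (J : 'rV[K]_n -> 'M[K]_n) (d C : nat),
  [/\ forall i, E i b <-> exists k, e k = i,
      nbhs b [set x | exists2 w, mxle w 1 & xi w = x],
      forall w w', mxle w 1 -> mxle w' 1 -> xi w = xi w' -> w = w',
      [/\ forall w h k, mxle w 1 -> mxle h (rho ^+ k) ->
            mxle (sg (xi (w + h)) - sg (xi w) - h *m J w) (rho ^+ (k + k)),
          forall w, mxle w 1 -> mxle (J w) 1 &
          forall w, mxle w 1 -> absv (\det (J w)) =
            rho ^+ d * \prod_(k < p) absv (w 0 (widen_ord hp k)) ^+ (v (e k)).-1] &
      forall w, mxle w 1 ->
        (forall i, absv (F i (xi w)) * rho ^+ C <=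
           \prod_(k < p) absv (w 0 (widen_ord hp k)) ^+ N (e k)) /\
        (forall r, 0 <= r -> (forall i, absv (F i (xi w)) <= r) ->
           \prod_(k < p) absv (w 0 (widen_ord hp k)) ^+ N (e k) * rho ^+ C <= r)].
Proof.
move=> /crossings_near [p [hp [e [c [A [eta [eE [lc cb] z00 [A0 eta0] hz]]]]]]].
have [e1 [B [D [/andP[e10 e11] B1 hD]]]] := sigma_C11 lc cb.
have B0 : 0 < B by apply: lt_le_trans B1.
set z0 := coord c b in z00 hz hD.
have [e2 e20 he2] := (nbhs_rVP z0 _).1 hz.
(* The scale [rho ^+ t] must be below [e1] for the expansion, below [e2] for the monomial estimates,
   and below [B^-1] to make [J] integral and the quadratic constant 1. *)
have m0 : 0 < Num.min (Num.min e1 e2) B^-1 by rewrite !lt_min e10 e20 invr_gt0.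
have [|t] := @exp_small R rho _ _ m0; first by rewrite absv_ge0 (rho_lt1 pi_unif).
rewrite !lt_min -andbA => /and3P[te1 te2 tB].
have t0 : 0 < rho ^+ t by exact: rX0.
have Bt : B * rho ^+ t <= 1 by rewrite mulrC -ler_pdivlMr // mul1r ltW.
pose Z (w : 'rV[K]_n) := z0 + pi ^+ t *: w.
have pt0 : pi ^+ t != 0 by rewrite expf_neq0 ?(unif_neq0 pi_unif).
have Zt w : mxle w 1 -> mxle (Z w - z0) (rho ^+ t).
  move=> w1; rewrite /Z addrC addKr -[rho ^+ t]mulr1; apply: mxleZ => //.
  by rewrite absvX.
have Ze w : mxle w 1 -> mxle (Z w - z0) e1.
  by move=> /Zt h; apply: mxle_trans h (ltW te1).
have ZP w : mxle w 1 -> [/\ codom c (Z w),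
    absv (\det (D (Z w))) = eta * \prod_(k < p) (rho ^+ t * absv (w 0 (widen_ord hp k))) ^+ (v (e k)).-1,
    forall i, absv (F i (param c (Z w))) <=
      A * \prod_(k < p) (rho ^+ t * absv (w 0 (widen_ord hp k))) ^+ N (e k) &
    forall r, 0 <= r -> (forall i, absv (F i (param c (Z w))) <= r) ->
      \prod_(k < p) (rho ^+ t * absv (w 0 (widen_ord hp k))) ^+ N (e k) <= A * r].
  move=> w1; have zk k : absv (Z w 0 (widen_ord hp k)) =
      rho ^+ t * absv (w 0 (widen_ord hp k)).
    by rewrite !mxE z00 add0r absvM absvX.
  have [|cz hj h1 h2] := he2 (Z w).
    move=> i; rewrite absv_distC; have := Zt w w1 0 i; rewrite !mxE => H.
    exact: le_lt_trans H te2.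
  split=> //.
  - rewrite -det_tr -(jacobian_near e10 B1 cb hD (Ze w w1) cz) hj.
    by congr (_ * _); apply: eq_bigr => k _; rewrite zk.
  - move=> i; apply: le_trans (h1 i) _.
    by under eq_bigr do rewrite zk.
  - by move=> r r0 hr; have := h2 r r0 hr; under eq_bigr do rewrite zk.
have prodE (m : 'I_p -> nat) (w : 'rV[K]_n) :
    \prod_(k < p) (rho ^+ t * absv (w 0 (widen_ord hp k))) ^+ m k =
    rho ^+ (t * \sum_k m k) * \prod_(k < p) absv (w 0 (widen_ord hp k)) ^+ m k.
  rewrite (eq_bigr _ (fun k _ => exprMn (m k) _ _)).
  by rewrite big_split /= exprM -prodrXr.
have Pge0 (m : 'I_p -> nat) (w : 'rV[K]_n) :
    0 <= \prod_(k < p) absv (w 0 (widen_ord hp k)) ^+ m k.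
  by rewrite prodr_ge0 // => k _; rewrite exprn_ge0 ?absv_ge0.
pose J w := pi ^+ t *: D (Z w).
have J1 w : mxle w 1 -> mxle (J w) 1.
  move=> w1; have [DB _] := hD (Z w) (Ze w w1).
  apply: mxle_trans Bt; rewrite mulrC; apply: mxleZ => //.
  by rewrite absvX.
pose A3 := rho ^+ (t * n) * (eta * rho ^+ (t * \sum_k (v (e k)).-1)).
have A30 : 0 < A3 by rewrite !mulr_gt0.
have JA w : mxle w 1 -> absv (\det (J w)) =
    A3 * \prod_(k < p) absv (w 0 (widen_ord hp k)) ^+ (v (e k)).-1.
  move=> w1; have [_ hj _ _] := ZP w w1.
  by rewrite detZ absvM hj prodE -exprM absvX /A3 !mulrA.
(* At the all-ones point [A3] is the absolute value of a nonzero integral determinant, hence a power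
   of [rho]. *)
have [d A3d] : exists d, A3 = rho ^+ d.
  have one1 : mxle (const_mx 1 : 'rV[K]_n) 1 by move=> i j; rewrite mxE absv1.
  have := JA _ one1; rewrite big1 ?mulr1 => [jE|k _]; last by rewrite mxE absv1 expr1n.
  have [||d dE] := absv_rhoX pi_unif (x := \det (J (const_mx 1))).
  - by rewrite -absv_gt0 jE.
  - by apply: mxle_det; exact: J1.
  by exists d; rewrite -dE.
pose S := rho ^+ (t * \sum_k N (e k)).
have S0 : 0 < S by exact: rX0.
have S1 : S <= 1 by exact: rhoX_le1.
have SA : 0 < S / A by rewrite divr_gt0.
(* A single [C] serves both comparisons: [A * rho ^+ C < S] gives the second, and with [S <= 1] also
   the first. *)
have [|C] := @exp_small R rho _ _ SA; first by rewrite absv_ge0 (rho_lt1 pi_unif).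
rewrite ltr_pdivlMr // => CA.
have C0 : 0 < rho ^+ C by exact: rX0.
exists p, hp, e, (fun w => param c (Z w)), J, d, C; split=> //.
- have nd : nbhs b (dom c) by apply: open_nbhs_nbhs; split=> //; exact: dom_open.
  have nb : nbhs z0 [set z : 'rV[K]_n | forall i, absv (z0 0 i - z 0 i) < rho ^+ t].
    by apply/nbhs_rVP; exists (rho ^+ t).
  have nF := nbhs_filter b.
  have := @filterI _ _ nF _ _ nd (coord_cont cb nb).
  apply: (@filterS _ _ nF) => x [dx /= xt].
  pose w := pi ^- t *: (coord c x - z0).
  have w1 : mxle w 1.
    rewrite -(@mulVf _ (rho ^+ t)) ?gt_eqF //; apply: mxleZ.
      by rewrite absvV absvX.
    by move=> i j; rewrite ord1 !mxE absv_distC ltW.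
  exists w => //; rewrite /Z scalerA mulfV // scale1r addrC subrK coordK //.
- move=> w w' w1 w'1 /(congr1 (coord c)).
  have [cz _ _ _] := ZP w w1; have [cz' _ _ _] := ZP w' w'1.
  by rewrite !paramK // => /addrI /(scalerI pt0).
- split=> // [w h k w1 hk|w w1]; last by rewrite JA // A3d.
  have [_ H] := hD (Z w) (Ze w w1).
  have tk : 0 <= rho ^+ (t + k) <= e1.
    rewrite ltW ?rX0 //=; apply: le_trans (ltW te1).
    by rewrite (ler_rhoX pi_unif) leq_addr.
  have {}H := H (pi ^+ t *: h) _ tk.
  rewrite /Z scalerDr addrA -/(Z w) /J -scalemxAr scalemxAl.
  have thk : mxle (pi ^+ t *: h) (rho ^+ (t + k)).
    by rewrite exprD; apply: mxleZ => //; rewrite absvX.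
  apply: mxle_trans (H thk) _.
  rewrite expr2 !exprD -[leRHS]mul1r.
  rewrite (_ : B * _ = (B * rho ^+ t) * rho ^+ t * (rho ^+ k * rho ^+ k)); last by ring.
  have k0 : 0 < rho ^+ k by exact: rX0.
  apply: ler_wpM2r; first by rewrite mulr_ge0 // ltW.
  apply: mulr_ile1 => //; [by rewrite mulr_ge0 // ltW|exact: ltW|exact: rhoX_le1].
move=> w w1; have [_ _ h1 h2] := ZP w w1; rewrite prodE -/S in h2; split=> [i|r r0 hr].
  have := h1 i; rewrite prodE -/S => h; rewrite -[leRHS]mul1r.
  apply: (@le_trans _ _ (A * (S * \prod_(k < p) absv (w 0 (widen_ord hp k)) ^+ N (e k)) * rho ^+ C)).
    by rewrite ler_wpM2r // ltW.
  rewrite mulrA -mulrA [_ * rho ^+ C]mulrC mulrA ler_wpM2r ?Pge0 //.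
  rewrite mulrAC; apply: le_trans (_ : S * S <= 1); last by rewrite mulr_ile1 // ltW.
  by rewrite mulrC [A * _]mulrC ler_pM2l // ltW.
have := h2 r r0 hr => h.
rewrite -(ler_pM2l S0) mulrA; apply: (@le_trans _ _ (A * r * rho ^+ C)).
  by rewrite ler_pM2r.
by rewrite mulrAC ler_wpM2r // mulrC ltW.
Qed.

End LogData.

(** * Surjectivity of blow-ups *)

Section Surjective.
Local Notation coord := Defs.coord.
Local Notation dom := Defs.dom.
Local Notation codom := Defs.codom.
Local Notation jacobian := Defs.jacobian.
Context {R : realType} (K : ultrametricFieldType R).

(** Off the centre the local inverse provides a preimage. Over the centre the first [r] coordinates
    vanish, so every nonzero vector is incident and the fibre is a full projective space, nonempty
    as [r > 0]. *)
Lemma is_blowup_surj n (M N : manifold K n) (s : M -> N) (C : set N) :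
  is_blowup s C -> forall y, exists x, s x = y.
Proof.
move=> [r [hr [r0 _ _ [t [ht _]] hb]]] y.
have [Cy|nCy] := pselect (C y); last by exists (t y); have [] := ht y nCy.
have [c [cy [_ hC] [u [_ bij _]]]] := hb y Cy.
have y0 := (hC y cy).1 Cy.
have inc : incident hr (coord c y) (const_mx 1) by move=> i j; rewrite !y0 !mul0r.
have n0 : (const_mx 1 : 'rV[K]_r) != 0.
  apply/eqP => /rowP /(_ (Ordinal r0)); rewrite !mxE => /eqP.
  by rewrite oner_eq0.
have [w [[sw _] _]] := bij y _ cy n0 inc.
by exists w.
Qed.

Lemma blowup_composition_surj n (M N : manifold K n) (s : M -> N) :
  blowup_composition s -> forall y, exists x, s x = y.
Proof.
elim=> {M N s} [M y|M N P s t C /is_blowup_surj hs _ ht y]; first by exists y.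
by have [z <-] := ht y; have [x <-] := hs z; exists x.
Qed.

End Surjective.

(** * Counting solutions *)

Section Solutions.
Context {R : realType} (K : ultrametricFieldType R).
Context (pi : K) (pi_unif : is_uniformizer pi) (cK : compact (unit_ball K)).

Local Notation rho := (absv pi).
Local Notation q := (residue_card K).
Let rX0 := rhoX_gt0 pi_unif.

Context (n l : nat) (f : 'I_l -> mpoly.mpoly n (valring K)).

Definition solution_set j : set 'rV[K]_n :=
  [set polydisc_coord x | x in [set x : 'rV[valring K]_n |
     forall i, absv (val (mpoly.meval (x 0) (f i))) <= rho ^+ j]].

Lemma polydisc_param_le (z : 'rV[K]_n) : mxle z 1 ->
  polydisc_coord (polydisc_param z) = z.
Proof. by move=> z1; apply: polydisc_paramK => i; exact: z1. Qed.

Lemma meval_cong (g : mpoly.mpoly n (valring K)) j (x y : 'I_n -> valring K) :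
  (forall i, absv (val (x i) - val (y i)) <= rho ^+ j) ->
  absv (val (mpoly.meval x g) - val (mpoly.meval y g)) <= rho ^+ j.
Proof.
move=> xy; pose cg (a b : valring K) := absv (val a - val b) <= rho ^+ j.
have cgM a b c d : cg a b -> cg c d -> cg (a * c) (b * d).
  rewrite /cg !val_valringM => ab cd.
  have -> : val a * val c - val b * val d =
    (val a - val b) * val c + val b * (val c - val d) by ring.
  apply: absvD_le; rewrite absvM.
    by rewrite -[leRHS]mulr1 ler_pM ?absv_ge0 //; exact: (valP c).
  by rewrite -[leRHS]mul1r ler_pM ?absv_ge0 //; exact: (valP b).
have cgx a : cg a a by rewrite /cg subrr absv0 ltW.
have cgX a b k : cg a b -> cg (a ^+ k) (b ^+ k).
  move=> ab; elim: k => [|k IHk]; first exact: cgx.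
  by rewrite !exprS; exact: cgM.
rewrite -/(cg _ _) !mpoly.mevalE.
elim/big_rec2: _ => [|m a b _ ab]; first exact: cgx.
rewrite /cg !val_valringD opprD addrACA; apply: absvD_le => //.
apply: (cgM) => //; elim/big_rec2: _ => [|i c d _ cd]; first exact: cgx.
by apply: (cgM) => //; apply: cgX; exact: xy.
Qed.

(** Integral polynomials respect congruences, so the solution set is a union of cosets modulo
    [pi ^+ j]. *)
Lemma solution_set_near j x y : solution_set j x -> mxle (x - y) (rho ^+ j) ->
  solution_set j y.
Proof.
move=> [u hu <-] uy; exists (polydisc_param y) => [i|]; last first.
  apply: polydisc_param_le => i k; have := uy i k; rewrite !mxE => h.
  rewrite -[y i k](subKr (val (u i k))); apply: absvB_le; first exact: (valP (u i k)).
  exact: le_trans h (rhoX_le1 pi_unif _).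
have y1 : mxle y 1.
  move=> i' k; have := uy i' k; rewrite !mxE => h.
  rewrite -[y i' k](subKr (val (u i' k))); apply: absvB_le; first exact: (valP (u i' k)).
  exact: le_trans h (rhoX_le1 pi_unif _).
rewrite -[X in absv X](subrK (val (mpoly.meval (u 0) (f i)))); apply: absvD_le => //.
apply: meval_cong => k; rewrite absv_distC; have := uy 0 k.
by rewrite -[in X in X -> _](polydisc_param_le y1) !mxE.
Qed.

Lemma solutions_net j : exists2 s : seq 'rV[K]_n,
  size s = num_solutions f j & is_net pi j s (solution_set j).
Proof.
have [s0 [_ s0b cs0] _] := box_net pi_unif cK (a := fun _ : 'I_n => 0%N) (fun _ => leq0n j).
pose S := [set x : 'rV[valring K]_n |
     forall i, idealX (maxideal (K := K)) j (mpoly.meval (x 0) (f i))].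
have gP (x y : 'rV[valring K]_n) :
    map_mx (coset_mod j) x = map_mx (coset_mod j) y <->
    mxle (polydisc_coord x - polydisc_coord y) (rho ^+ j).
  split=> [/rowP h i k|h]; first by rewrite ord1; have := h k; rewrite !mxE => /(coset_modP pi_unif).
  by apply/rowP => k; rewrite !mxE; apply/(coset_modP pi_unif); have := h 0 k; rewrite !mxE.
have [|s [sz us sS hs inj]] := @fset_set_reps _ _ (map_mx (coset_mod (K := K) j)) S
    (map (@polydisc_param R K n) s0).
  move=> x _; have [|c cs xc] := cs0 (polydisc_coord x).
    by move=> i; rewrite expr0; exact: polydisc_coord_codom.
  exists (polydisc_param c); first exact: map_f.
  apply/gP; rewrite polydisc_param_le // => i k; rewrite ord1.
  by have := s0b c cs k; rewrite expr0.
have pc_inj : injective (@polydisc_coord R K n) by exact: can_inj (@polydisc_coordK R K n).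
exists (map (@polydisc_coord R K n) s).
  rewrite size_map sz /num_solutions; congr (#|` fset_set _|).
  apply/seteqP; split=> [_ [x xS <-]|X [x -> xS]]; first by exists x.
  by exists x.
split.
- split; first by rewrite map_inj_uniq.
  by move=> _ _ /mapP[x xs ->] /mapP[y ys ->] /gP /(inj x y xs ys) ->.
- move=> _ /mapP[x xs ->]; exists x => // i.
  by apply/(idealXP pi_unif); exact: sS.
move=> _ [x hx <-]; have [|c cs /gP xc] := hs x.
  by move=> i; apply/(idealXP pi_unif).
by exists (polydisc_coord c) => //; exact: map_f.
Qed.

(** Each coset modulo [pi ^+ j] splits into [q ^ (n * (k - j))] cosets modulo [pi ^+ k]; the
    normalized count can therefore be read at whatever level the volume estimates require. *)
Lemma solutions_net_at j k : (j <= k)%N -> exists2 s : seq 'rV[K]_n,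
  size s = (num_solutions f j * q ^ (n * (k - j)))%N & is_net pi k s (solution_set j).
Proof.
move=> jk; have [s sz [[us sep] sS cs]] := solutions_net j.
have [t [[ut sept] tb ct] tz] := box_net pi_unif cK (a := fun _ : 'I_n => j) (fun _ => jk).
have tj x : x \in t -> mxle x (rho ^+ j) by move=> /tb h i k'; rewrite ord1; exact: h.
have kj m (x : 'rV[K]_m) : mxle x (rho ^+ k) -> mxle x (rho ^+ j).
  by move=> h; apply: mxle_trans h _; rewrite (ler_rhoX pi_unif).
pose g (c : 'rV[K]_n) := [seq c + x | x <- t].
exists (flatten [seq g c | c <- s]).
  rewrite size_flatten /shape -map_comp sumnE big_map.
  rewrite (eq_bigr (fun=> q ^ (n * (k - j))))%N; last first.
    by move=> c _; rewrite /= size_map tz sum_nat_const card_ord.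
  by rewrite big_const_seq count_predT iter_addn_0 sz mulnC.
split.
- apply: spread_flatten => // [c cs'|c c' x y cs' c's].
    split; first by rewrite map_inj_uniq //; exact: addrI.
    move=> _ _ /mapP[x xs ->] /mapP[y ys ->].
    by rewrite opprD addrACA subrr add0r => /(sept _ _ xs ys) ->.
  move=> /mapP[a /tj ag ->] /mapP[b /tj bg ->] xy; apply: sep => //.
  have -> : c - c' = (c + a - (c' + b)) - (a - b).
    by apply/matrixP => ? ?; rewrite !mxE; ring.
  by apply: mxleB; [exact: kj|exact: mxleB].
- move=> x /flatten_mapP[c cs' /mapP[a /tj ag ->]].
  apply: solution_set_near (sS c cs') _.
  by rewrite opprD addrA subrr add0r; exact/mxleN.
move=> x /cs[c cs' xc]; have [|d dt xd] := ct (x - c).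
  by move=> i; exact: xc.
exists (c + d); first by apply/flatten_mapP; exists c => //; exact: map_f.
by rewrite opprD addrA.
Qed.

Let q0 : 0 < (q%:R : R).
Proof. by rewrite ltr0n ltnW // (residue_card_gt1 pi_unif). Qed.

Lemma num_solutions_le j a : vol_le pi (solution_set j) a ->
  (num_solutions f j)%:R * q%:R ^- (n * j) <= a.
Proof.
move=> [k0 h]; pose k := maxn k0 j.
have [s ss cs] := h k (leq_maxl _ _).
have jk : (j <= k)%N by exact: leq_maxr.
have [t tz [st tS _]] := solutions_net_at jk.
have := spread_le_covers st tS cs; rewrite tz -(ler_nat R) => /le_trans /(_ ss).
rewrite natrM natrX mulnBr expfB_cond; last first.
  by rewrite gt_eqF //= leq_mul2l jk orbT.
by rewrite mulrA mulrAC ler_pM2r ?exprn_gt0.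
Qed.

Lemma num_solutions_ge j k D (s : seq 'rV[K]_n) : (j <= k)%N ->
  spread pi k s -> (forall x, x \in s -> solution_set j x) ->
  (D <= n * k)%N -> size s = (q ^ (n * k - D))%N ->
  q%:R ^- D <= (num_solutions f j)%:R * q%:R ^- (n * j) :> R.
Proof.
move=> jk sp sS Dk sz; have [t tz [_ _ ct]] := solutions_net_at jk.
have := spread_le_covers sp sS ct; rewrite sz tz -(ler_nat R) natrM !natrX.
rewrite mulnBr !expfB_cond; last 2 first.
- by rewrite gt_eqF //= leq_mul2l jk orbT.
- by rewrite gt_eqF.
by rewrite mulrA mulrAC [_ ^+ (n * k) / _]mulrC ler_pM2r ?exprn_gt0.
Qed.

End Solutions.

(** * Upper and lower bounds for the number of solutions *)

Section Bounds.
Context {R : realType} (K : ultrametricFieldType R).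
Context (pi : K) (pi_unif : is_uniformizer pi) (cK : compact (unit_ball K)).

Local Notation rho := (absv pi).
Local Notation q := (residue_card K).
Let rX0 := rhoX_gt0 pi_unif.

Context (n l : nat) (f : 'I_l -> mpoly.mpoly n (valring K)).
Context (M : manifold K n) (sigma : M -> polydisc_manifold K n).
Context (T : finType) (E : T -> set M) (N v : T -> nat).
Hypothesis lp : log_principalization f sigma E N v.

Local Notation lam := (lambda R N v).

(** A common zero lifts through the blow-ups and lies over some component, so the minimum defining
    [lambda] ranges over a nonempty set. *)
Lemma components_nonempty : zero_locus f !=set0 -> exists i : T, True.
Proof.
move=> [y Zy]; have [x xy] := blowup_composition_surj (lp_blowups lp) y.
have : (sigma @^-1` zero_locus f) x by rewrite /= xy.
by rewrite (lp_preimage lp) => -[i _ _]; exists i.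
Qed.

Lemma lambda_attained (i0 : T) : exists i, lam = (v i)%:R / (N i)%:R.
Proof.
pose g i : R := (v i)%:R / (N i)%:R.
case: (@Order.TotalTheory.arg_minP _ _ _ i0 predT g) => //= i _ hi.
exists i; apply/eqP; rewrite eq_le; apply/andP; split.
  apply: ge_inf; last by exists i.
  by exists 0 => _ [j _ <-]; rewrite divr_ge0.
apply: lb_le_inf; first by exists (g i), i.
by move=> _ [j _ <-]; exact: hi.
Qed.

Lemma lambda_le i : lam * (N i)%:R <= (v i)%:R.
Proof.
have [Ni _] := lp_positive lp i.
rewrite -ler_pdivlMr ?ltr0n //; apply: ge_inf; last by exists i.
by exists 0 => _ [j _ <-]; rewrite divr_ge0.
Qed.

Lemma lambda_ge0 (i0 : T) : 0 <= lam.
Proof. by have [i ->] := lambda_attained i0; rewrite divr_ge0. Qed.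

Lemma components_dim (i0 : T) : (0 < n)%N.
Proof. by have [n1 _] := lp_divisor lp i0. Qed.

(** Properness of [sigma] and compactness of the whole polydisc. *)
Lemma compact_domain : compact [set: M].
Proof.
rewrite -(preimage_setT sigma); apply: (lp_proper lp).
have cP : compact [set z : 'rV[K]_n | forall i, unit_ball K (z 0 i)].
  exact: rV_compact_all.
have -> : [set: polydisc_manifold K n] =
    (@polydisc_param R K n) @` [set z : 'rV[K]_n | forall i, unit_ball K (z 0 i)].
  apply/seteqP; split=> // x _; exists (polydisc_coord x).
    exact: polydisc_coord_codom.
  exact: polydisc_coordK.
apply: (@continuous_compact _ 'rV[valring K]_n) => //.
apply: continuous_in_subspaceT => z /set_mem zP.
exact: polydisc_param_cont.
Qed.

Lemma local_volume (i0 : T) (b : M) : exists (W : set M) (B : R),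
  [/\ nbhs b W, 0 <= B & forall j, vol_le pi
    [set x | exists m : M, [/\ W m, polydisc_coord (sigma m) = x &
       forall i, absv (val (eval_at f i (sigma m))) <= rho ^+ j]]
    (B * (j.+1%:R ^+ n * q%:R `^ (- (lam * j%:R))))].
Proof.
have [p [hp [e [xi [J [d [C [_ bW _ [hPhi hJ1 hJd] hF]]]]]]]] :=
  local_model pi_unif cK (lp_analytic lp) (lp_crossings lp b).
have [B B0 hB] := local_upper pi_unif cK (components_dim i0) hPhi hJ1 hJd
  (fun k => (lp_positive lp (e k)).2) C (lambda_ge0 i0) (fun k => lambda_le (e k)).
exists [set x | exists2 w, mxle w 1 & xi w = x], B; split=> // j.
apply: vol_le_sub (hB j); last by rewrite mulrA.
move=> _ [m [[w w1 <-] <- hm]]; exists w => //; split=> //.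
by have [_ h] := hF w w1; apply: h => //; exact: ltW.
Qed.

(** The finite cover of the manifold is chosen before [j], so [B] is uniform in [j]; surjectivity of
    [sigma] ensures that the local images exhaust the solution set. *)
Lemma solutions_upper (i0 : T) : exists2 B : R, 0 <= B & forall j,
  (num_solutions f j)%:R * q%:R ^- (n * j) <=
    B * (j.+1%:R ^+ n * q%:R `^ (- (lam * j%:R))).
Proof.
have [W hW] := choice (local_volume i0).
have [B hB] := choice hW.
have [|s [_ hs]] := compact_seq_cover (W := W) compact_domain.
  by move=> b _; have [] := hB b.
exists (\sum_(b <- s) B b); first by apply: sumr_ge0 => b _; have [] := hB b.
move=> j; apply: (num_solutions_le pi_unif cK).
rewrite mulr_suml.
pose S b := [set x | exists m : M, [/\ W b m, polydisc_coord (sigma m) = x &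
  forall i, absv (val (eval_at f i (sigma m))) <= rho ^+ j]].
pose a b := B b * (j.+1%:R ^+ n * q%:R `^ (- (lam * j%:R))).
have vS b : b \in s -> vol_le pi (S b) (a b).
  by move=> _; have [_ _ h] := hB b; exact: h.
have vs := vol_le_seq vS.
apply: vol_le_sub vs => // x [u hu <-].
have [m mu] := blowup_composition_surj (lp_blowups lp) u.
have [b bs Wb] := hs m I; exists b => //; exists m; rewrite mu; split=> //.
Qed.

Lemma sigma_inj_off (x y : M) : ~ zero_locus f (sigma x) -> sigma x = sigma y -> x = y.
Proof.
have [t [_ ht]] := lp_iso lp => nx xy.
have [<- _] := ht x nx; rewrite xy; have [] := ht y _ => //; by rewrite -xy.
Qed.

Lemma solutions_lower (i0 : T) : exists2 c : R, 0 < c & forall j,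
  c * q%:R `^ (- (lam * j%:R)) <= (num_solutions f j)%:R * q%:R ^- (n * j).
Proof.
have [i lamE] := lambda_attained i0.
have [b Eb] := lp_nonempty lp i.
have [p [hp [e [xi [J [d [C [eE bW xi_inj [hPhi hJ1 hJd] hF]]]]]]]] :=
  local_model pi_unif cK (lp_analytic lp) (lp_crossings lp b).
have [k0 ek0] := (eE i).1 Eb.
have [Ni vi] := lp_positive lp i.
have q1 : 1 < (q%:R : R) by rewrite ltr1n (residue_card_gt1 pi_unif).
(* Total loss in the exponent: [d] and [p] come from [shell_lower], the rest from the shift [C] and
   from rounding [t] up. *)
pose c0 : R := d%:R + p%:R + (lam * C%:R + (v i)%:R).
exists (q%:R `^ (- c0)); first by rewrite powR_gt0 // (lt_trans ltr01).
(* The shell is deep only along the component [i], at depth just above [(j + C) / N i]; it then lies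
   over the solutions modulo [pi ^+ j], and [v i * t] is at most [lam * (j + C) + v i]. *)
move=> j; pose t := ((j + C) %/ N i).+1; pose m (k : 'I_p) := if k == k0 then t else 0%N.
have sumE (g : 'I_p -> nat) : (\sum_k g k * m k = g k0 * t)%N.
  rewrite (bigD1 k0) //= /m eqxx big1 ?addn0 // => k /negPf ->.
  by rewrite muln0.
have tN : (j + C <= N i * t)%N.
  have := ltn_pmod (j + C) Ni; have := divn_eq (j + C) (N i); rewrite /t.
  by set u := (_ %/ _)%N; set r := (_ %% _)%N; nia.
have Phi_inj w w' : mxle w 1 -> mxle w' 1 ->
    (forall k, w 0 (widen_ord hp k) != 0) -> (forall k, w' 0 (widen_ord hp k) != 0) ->
    polydisc_coord (sigma (xi w)) = polydisc_coord (sigma (xi w')) -> w = w'.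
  move=> w1 w'1 w0 _ /(can_inj (@polydisc_coordK R K n)) sE; apply: xi_inj => //.
  (* A point over the zero locus would, by the estimate with [r = 0], have a vanishing crossing
     coordinate. *)
  apply: sigma_inj_off sE => Z; have [_ h] := hF w w1.
  have hz i' : absv (val (eval_at f i' (sigma (xi w)))) <= 0 by rewrite Z absv0.
  have := h 0 (lexx _) hz; rewrite leNgt pmulr_lgt0 ?rX0 // prodr_gt0 // => k _.
  by rewrite exprn_gt0 // absv_gt0.
have [k1 hk1] := shell_lower pi_unif cK (components_dim i0) hPhi hJ1 hJd
  (fun k => (lp_positive lp (e k)).2) m Phi_inj.
have [Dk [s [sp sS sz]]] := hk1 (maxn k1 j) (leq_maxl _ _).
have sS' x : x \in s -> solution_set pi f j x.
  move=> /sS [w [w1 hw] <-]; exists (sigma (xi w)) => // i'.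
  have [h _] := hF w w1; have := h i'.
  rewrite (_ : \prod_(k < p) _ = rho ^+ (N i * t)); last first.
    rewrite -ek0 -(sumE (fun k => N (e k))) -prodrXr.
    by apply: eq_bigr => k _; rewrite hw -exprM mulnC.
  move=> h'; rewrite -(ler_pM2r (rX0 C)) -exprD; apply: le_trans h' _.
  by rewrite (ler_rhoX pi_unif).
have := num_solutions_ge pi_unif cK (leq_maxr _ _) sp sS' Dk sz.
apply: le_trans; rewrite (sumE (fun k => v (e k))) ek0 -powRD; last first.
  by apply/implyP => _; rewrite gt_eqF // (lt_trans ltr01).
rewrite -powR_mulrn ?(ltW (lt_trans ltr01 q1)) // -powRN ler_powR ?(ltW q1) //.
rewrite -opprD lerN2 /c0 !natrD natrM.
have : (v i)%:R * t%:R <= lam * j%:R + (lam * C%:R + (v i)%:R).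
  rewrite lamE /t -addn1 natrD mulrDr mulr1 addrA lerD2r -mulrDr -natrD.
  rewrite -mulrA ler_wpM2l // mulrC ler_pdivlMr ?ltr0n // -natrM ler_nat.
  exact: leq_divM.
lra.
Qed.

End Bounds.

(** * The limit superior *)

Section Roots.
Context {R : realType}.

(** From [ln x = 2 * ln (sqrt x) <= 2 * sqrt x] with [x = j + 2], and [j + 2 <= 4 * (j + 1)]. *)
Lemma ln_div_nat_bound (j : nat) :
  ln (j.+2%:R : R) * harmonic j <= 4 * Num.sqrt (harmonic j).
Proof.
have j0 : 0 < j.+1%:R :> R by [].
have s2 : Num.sqrt (j.+2%:R : R) ^+ 2 = j.+2%:R by rewrite sqr_sqrtr.
have s0 : 0 < Num.sqrt (j.+2%:R : R) by rewrite sqrtr_gt0.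
have t0 : 0 < Num.sqrt (j.+1%:R : R) by rewrite sqrtr_gt0.
have lnle : ln (j.+2%:R : R) <= 2 * Num.sqrt j.+2%:R.
  rewrite -s2 lnXn // [leRHS](_ : _ = Num.sqrt j.+2%:R *+ 2); last first.
    by rewrite sqrtr_sqr ger0_norm ?(ltW s0) // mulr_natl.
  by rewrite lerMn2r /= ltW // ln_sublinear.
have s2t : Num.sqrt (j.+2%:R : R) <= 2 * Num.sqrt j.+1%:R.
  rewrite -ler_sqr ?nnegrE ?mulr_ge0 ?sqrtr_ge0 // exprMn s2 sqr_sqrtr //.
  by rewrite -natrX -natrM ler_nat; lia.
rewrite /harmonic /= sqrtrV //.
have -> : (j.+1%:R : R)^-1 = (Num.sqrt j.+1%:R)^-1 * (Num.sqrt j.+1%:R)^-1.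
  by rewrite -invfM -expr2 sqr_sqrtr.
rewrite mulrA ler_pM2r ?invr_gt0 // ler_pdivrMr //.
apply: le_trans lnle _; apply: le_trans (_ : 2 * (2 * Num.sqrt (j.+1%:R : R)) <= _).
  by rewrite ler_pM2l.
by lra.
Qed.

(** After taking logarithms and dividing by the index, both bounds tend to [- lam * ln Q]; the
    polynomial factor contributes only a term that tends to zero. *)
Lemma limn_esup_root (a : nat -> R) (c B Q lam : R) (n : nat) :
  1 < Q -> 0 < c -> 0 < B ->
  (forall j, c * Q `^ (- (lam * j%:R)) <= a j) ->
  (forall j, a j <= B * (j.+1%:R ^+ n * Q `^ (- (lam * j%:R)))) ->
  limn_esup (fun j => (a j `^ (j%:R^-1))%:E) = (Q `^ (- lam))%:E.
Proof.
move=> Q1 c0 B0 lo up.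
have Q0 : 0 < Q by exact: lt_trans Q1.
have a0 j : 0 < a j by apply: lt_le_trans (lo j); rewrite mulr_gt0 ?powR_gt0.
have Qj j : ln (Q `^ (- (lam * j%:R))) = - lam * ln Q * j%:R.
  by rewrite ln_powR; ring.
have hp j : 0 < harmonic j :> R by rewrite invr_gt0.
have jh j : j.+1%:R * harmonic j = 1 :> R by rewrite mulfV.
have lnlo j : - lam * ln Q + ln c * harmonic j <= ln (a j.+1) * harmonic j.
  have : ln (c * Q `^ (- (lam * j.+1%:R))) <= ln (a j.+1).
    by rewrite ler_ln ?posrE ?mulr_gt0 ?powR_gt0 // lo.
  rewrite lnM ?posrE ?powR_gt0 // Qj -(ler_pM2r (hp j)); apply: le_trans.
  by rewrite mulrDl -[_ * j.+1%:R * _]mulrA jh mulr1 addrC.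
have lnup j : ln (a j.+1) * harmonic j <=
    - lam * ln Q + (ln B * harmonic j + n%:R * (4 * Num.sqrt (harmonic j))).
  have : ln (a j.+1) <= ln (B * (j.+2%:R ^+ n * Q `^ (- (lam * j.+1%:R)))).
    by rewrite ler_ln ?posrE ?mulr_gt0 ?exprn_gt0 ?powR_gt0 // up.
  rewrite lnM ?posrE ?mulr_gt0 ?exprn_gt0 ?powR_gt0 //.
  rewrite lnM ?posrE ?exprn_gt0 ?powR_gt0 // Qj lnXn //.
  rewrite -(ler_pM2r (hp j)) => /le_trans; apply.
  rewrite (mulrDl (ln B)) (mulrDl (ln _ *+ n)) -[_ * j.+1%:R * _]mulrA jh mulr1.
  have := ln_div_nat_bound j => /(ler_wpM2l (ler0n R n)) H.
  rewrite -[ln _ *+ n]mulr_natl -mulrA.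
  rewrite [leRHS]addrC -[leRHS]addrA lerD2l lerD2r. exact: H.
have h0 : harmonic j @[j --> \oo] --> (0 : R) := cvg_harmonic.
have sh0 : Num.sqrt (harmonic j) @[j --> \oo] --> (0 : R).
  rewrite -[X in _ --> X](sqrtr0 R).
  by apply: (continuous_cvg _ (@sqrt_continuous R 0)).
have lnlim : ln (a j.+1) * harmonic j @[j --> \oo] --> - lam * ln Q.
  apply: (@squeeze_cvgr _ _ _ _ (fun j => - lam * ln Q + ln c * harmonic j)
    (fun j => - lam * ln Q + (ln B * harmonic j + n%:R * (4 * Num.sqrt (harmonic j))))).
  - by apply: nearW => j; rewrite lnlo lnup.
  - rewrite -[X in _ --> X]addr0; apply: cvgD; first exact: cvg_cst.
    by rewrite -[X in _ --> X](mulr0 (ln c)); apply: cvgM => //; exact: cvg_cst.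
  - rewrite -[X in _ --> X]addr0; apply: cvgD; first exact: cvg_cst.
    rewrite -[X in _ --> X](addr0 0); apply: cvgD.
      by rewrite -[X in _ --> X](mulr0 (ln B)); apply: cvgM => //; exact: cvg_cst.
    rewrite -[X in _ --> X](mulr0 n%:R); apply: cvgM; first exact: cvg_cst.
    by rewrite -[X in _ --> X](mulr0 4); apply: cvgM => //; exact: cvg_cst.
have rootlim : a j `^ (j%:R^-1) @[j --> \oo] --> Q `^ (- lam).
  (* The shift discards [j = 0], where the inverse is 0 by convention, and turns [j%:R^-1] into
     [harmonic j]. *)
  rewrite -cvg_shiftS /powR gt_eqF //.
  have : expR (ln (a j.+1) * harmonic j) @[j --> \oo] --> expR (- lam * ln Q).
    by apply: (continuous_cvg _ (@continuous_expR R _)).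
  apply: cvg_trans; apply: near_eq_cvg; apply: nearW => j /=.
  by rewrite gt_eqF // mulrC.
have ul : (a j `^ (j%:R^-1))%:E @[j --> \oo] --> (Q `^ (- lam))%:E.
  by apply: cvg_EFin => //; exact: nearW.
by rewrite (cvg_limn_einf_sup ul).2.
Qed.

End Roots.

Theorem corollary2p9 (R : realType) (p : nat) (F : ultrametricFieldType R)
    (K : ultrametricExtType F) (n l : nat)
    (f : 'I_l -> mpoly.mpoly n (valring K))
    (M : manifold K n) (sigma : M -> polydisc_manifold K n)
    (T : finType) (E : T -> set M) (N v : T -> nat) :
  prime p -> is_Qp p F ->
  (exists i, f i != 0) ->
  zero_locus f !=set0 ->
  log_principalization f sigma E N v ->
  limn_esup (fun j : nat =>
    (((num_solutions f j)%:R * (residue_card K)%:R ^- (n * j)) `^ (j%:R^-1))%:E)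
  = ((residue_card K)%:R `^ (- lambda R N v))%:E.
Proof.
move=> pp QF _ Z0 lp.
have cK : compact (unit_ball K) by exact: padic_extension_compact QF.
have [pi pi_unif] : exists pi : K, is_uniformizer pi.
  (* The image of [p] is nonzero of absolute value below 1, so the absolute value is not trivial. *)
  apply: uniformizer_exists cK _; exists ((p%:R : F)%:A : K).
    rewrite -absv_gt0 absv_alg (Qp_absv QF) ?prime_gt0 //.
    by rewrite invr_gt0 exprn_gt0 // ltr0n prime_gt0.
  rewrite absv_alg (Qp_absv QF) ?prime_gt0 // logn_prime // eqxx expr1.
  by rewrite invf_lt1 ?ltr1n ?prime_gt1 // ltr0n prime_gt0.
have [i0 _] := components_nonempty lp Z0.
have [B B0 hB] := solutions_upper pi_unif cK lp i0.
have [c c0 hc] := solutions_lower pi_unif cK lp i0.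
(* [B] is only known to be nonnegative, and the logarithm needs a positive constant. *)
apply: (@limn_esup_root R _ c (1 + B) _ _ n) => //.
- by rewrite ltr1n (residue_card_gt1 pi_unif).
- by rewrite ltr_pwDl.
by move=> j; apply: le_trans (hB j) _; rewrite ler_wpM2r ?lerDr.
Qed.
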